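(* Let $h:(0,1)\to(0,\infty)$ be a continuous function with $\lim_{t\to 0^+}h(t)=0$. Let $z_n=r_ne^{i\theta_n}$, $n\ge 1$, be a Carleson sequence in the unit disc $\mathbb{D}$ satisfying $\sum_{n=1}^{\infty}h(1-r_n)<\infty$. Let $B$ be the Blaschke product formed with zeros $z_n$, $n\ge1$, and let $K_B=H^2\ominus BH^2$. Suppose that there is $p\in(2/3,1)$ such that $h(t)/t^{p/2}$ is decreasing and $h(t)/t^{1-p}$ is increasing on $(0,1)$. Then, for all $f\in K_B$, we have \[ \left(\int_0^{2\pi}|f'(re^{i\theta})|^{\sigma}\,d\theta\right)^{1/\sigma}\le\frac{C\,\|f\|_2}{\big((1-r)^{p-1}h(1-r)\big)^{1/p}},\qquad (r\to1), \] with $\sigma=2p/(p+2)$ and $C$ an absolute constant.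
   Context: $\mathbb{D}$ is the open unit disc in $\mathbb{C}$; $r_n=|z_n|\in(0,1)$ and $\theta_n\in\mathbb{R}$. A Blaschke sequence is a sequence $(z_n)_{n\ge1}$ in $\mathbb{D}\setminus\{0\}$ with $\sum_{n}(1-|z_n|)<\infty$; the Blaschke product with these zeros is $B(z)=\prod_{n=1}^{\infty}\frac{|z_n|}{z_n}\,\frac{z_n-z}{1-\bar z_n z}$, $z\in\mathbb{D}$. A Carleson (or interpolating) sequence is a Blaschke sequence satisfying the Carleson condition $\inf_{n\ge1}\prod_{k\ne n}\left|\frac{z_k-z_n}{1-\bar z_k z_n}\right|>0$. $H^2$ is the Hardy space of $\mathbb{D}$ with norm $\|f\|_2=\lim_{r\to1^-}\big(\int_0^{2\pi}|f(re^{i\theta})|^2\,\frac{d\theta}{2\pi}\big)^{1/2}$, and $K_B=H^2\ominus BH^2$ is the orthogonal complement in $H^2$ of the closed subspace $BH^2$ (the model subspace generated by $B$).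
   Formalization: The constant C is independent of f and r but may depend on h, p and the sequence (z_n); a truly absolute constant is impossible, since replacing h by λh preserves all hypotheses but multiplies the right-hand side by λ^(-1/p). *)

(* Defs.v *)
From Stdlib Require Import Reals Lra.
From Coquelicot Require Import Coquelicot.
Open Scope R_scope.

(* x^a for x >= 0 and a > 0.  Stdlib's Rpower is exp (a * ln x) with ln 0 = 0,
   so that Rpower 0 a = 1; here rpow 0 a = 0. *)
Definition rpow (x a : R) : R :=
  if Rlt_dec 0 x then Rpower x a else 0.

Definition decreasing_on_01 (g : R -> R) : Prop :=
  forall s t : R, 0 < s -> s <= t -> t < 1 -> g t <= g s.

Definition increasing_on_01 (g : R -> R) : Prop :=
  forall s t : R, 0 < s -> s <= t -> t < 1 -> g s <= g t.

(* r e^{i theta} *)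
Definition polar (r theta : R) : C := (r * cos theta, r * sin theta).

Definition holomorphic_on_disc (f : C -> C) : Prop :=
  forall z : C, Cmod z < 1 ->
    ex_derive (K := C_AbsRing) (V := C_NormedModule) f z.

(* Functions on the disc are represented by total functions C -> C; only
   their values in the open unit disc are ever used. *)

Definition circle_mean2 (f : C -> C) (r : R) : R :=
  sqrt (RInt (fun theta => (Cmod (f (polar r theta))) ^ 2 / (2 * PI)) 0 (2 * PI)).

Definition circle_inner (f g : C -> C) (r : R) : C :=
  RInt (V := C_R_CompleteNormedModule)
    (fun theta =>
       Cdiv (Cmult (f (polar r theta)) (Cconj (g (polar r theta))))
            (RtoC (2 * PI)))
    0 (2 * PI).

Definition H2 (f : C -> C) : Prop :=
  holomorphic_on_disc f /\
  exists l : R, filterlim (circle_mean2 f) (at_left 1) (locally l).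

Definition H2_norm (f : C -> C) : R :=
  lim (T := R_CompleteSpace) (filtermap (circle_mean2 f) (at_left 1)).

(* The inner product of H2 (the polarization of H2_norm) is the limit of
   circle_inner f g r as r -> 1-. *)
Definition H2_orthogonal (f g : C -> C) : Prop :=
  filterlim (circle_inner f g) (at_left 1)
    (locally (T := C_UniformSpace) (RtoC 0)).

(* Sequences are indexed from 0. *)
Definition blaschke_sequence (z : nat -> C) : Prop :=
  (forall n : nat, 0 < Cmod (z n) < 1) /\
  ex_series (fun n => 1 - Cmod (z n)).

Definition blaschke_factor (a w : C) : C :=
  (RtoC (Cmod a) / a * ((a - w) / (RtoC 1 - Cconj a * w)))%C.

Fixpoint blaschke_partial (z : nat -> C) (N : nat) (w : C) : C :=
  match N with
  | O => RtoC 1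
  | S N' => Cmult (blaschke_partial z N' w) (blaschke_factor (z N') w)
  end.

Definition blaschke (z : nat -> C) (w : C) : C :=
  lim (T := C_CompleteNormedModule)
    (filtermap (fun N => blaschke_partial z N w) eventually).

(* The product over all k <> n of |z_k - z_n| / |1 - conj(z_k) z_n|. *)
Definition carleson_product (z : nat -> C) (n : nat) : Rbar :=
  Lim_seq (prod_f_R0 (fun k =>
    if Nat.eq_dec k n then 1
    else Cmod ((z k - z n) / (RtoC 1 - Cconj (z k) * z n))%C)).

Definition carleson_sequence (z : nat -> C) : Prop :=
  blaschke_sequence z /\
  Rbar_lt (Finite 0) (Inf_seq (carleson_product z)).

(* K_B = H2 (-) B H2, for B the Blaschke product with zeros z. *)
Definition model_space (z : nat -> C) (f : C -> C) : Prop :=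
  H2 f /\
  forall g : C -> C, H2 g ->
    H2_orthogonal f (fun w => Cmult (blaschke z w) (g w)).

(* Main.v *)
(* For a Carleson sequence the kernels 1 / (1 - conj(z_n) w) expand every f in K_B with coefficients
   c_n such that the sum of |c_n|^2 / (1 - |z_n|^2) is at most C |f|^2.  As sigma < 1, |f'|^sigma is at
   most the sum of |c_n|^sigma |1 - conj(z_n) w|^(-2 sigma), whose terms have means of order
   (1 - r |z_n|)^(1 - 2 sigma); Hoelder's inequality with exponents 2 / sigma and (p + 2) / 2 and the
   monotonicity of h(t) / t^(p/2) (where 1 - |z_n| <= 1 - r) and of h(t) / t^(1-p) (elsewhere) conclude.

   H2 being defined by radial limits, the expansion is proved on the unit circle for F = f(rho .) and
   finite products B_N.  Partial fractions of B_N show that F(w) - B_N(w) <F, B_N k_w> is a combination of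
   the kernels at z_0, ..., z_(N-1).  The subtracted term is small for large N and rho close to 1, because f
   is orthogonal to every B z^k and the circle means of |B - B_N|^2 are at most 2 - 2 |prod_(n >= N) z_n|.

   The coefficient bound is Bessel's inequality for the normalized kernels, which is dual to the Carleson
   embedding: the sum of (1 - |z_j|^2) |g(z_j)|^2 is at most C |g|^2.  Following P. Jones, g is multiplied by
   Phi_j, the product over |z_k| >= |z_j| of 1 / (1 + q_k), where q_k has positive real part.  On the circle
   the numbers |Phi_j|^2 turn the sum over j of the Poisson kernels weighted by 1 - |z_j|^2 into a telescoping
   sum bounded by 1, whereas |Phi_j(z_j)| is bounded below by the separation constant. *)
Require Import Defs.
From Stdlib Require Import Reals Lra Lia.
From Coquelicot Require Import Coquelicot.
Open Scope R_scope.

(** The exponents fit through the identity [1 - sigma / 2 = 2 / (p + 2)]. After Hoelder's inequality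
    the powers of [1 - |z_n|^2] combine to the exponent [p / 2] of the hypothesis on [h], the kernel
    means contribute [(1 - 2 sigma) (p + 2) / 2 = 1 - 3 p / 2], and the outer root gives
    [(1 - sigma / 2) / sigma = 1 / p]. The bound [p > 2 / 3] says that [2 sigma > 1]: only then do
    the kernel means grow like a negative power of the distance to the circle.

    The obstacle is that a dilation [f(rho .)] of a function in K_B need not lie in K_B, so its
    finite expansion carries an error term. The error can therefore be sent to zero at the very end.

    Holomorphy means that the complex derivative exists, with no continuity assumed. This is why the
    Cauchy formula is reached through Goursat's bisection instead of Green's theorem. *)

(** * Continuity of real and complex functions of a real variable *)

Definition rcont (f : R -> R) : Prop := forall t : R, continuous f t.

Definition ccont (u : R -> C) : Prop :=
  rcont (fun t => Re (u t)) /\ rcont (fun t => Im (u t)).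

Lemma rcont_const (c : R) : rcont (fun _ => c).
Proof. intros t. apply continuous_const. Qed.

Lemma rcont_plus (f g : R -> R) :
  rcont f -> rcont g -> rcont (fun t => f t + g t).
Proof. intros Hf Hg t. apply (continuous_plus f g); auto. Qed.

Lemma rcont_opp (f : R -> R) : rcont f -> rcont (fun t => - f t).
Proof. intros Hf t. apply (continuous_opp f); auto. Qed.

Lemma rcont_minus (f g : R -> R) :
  rcont f -> rcont g -> rcont (fun t => f t - g t).
Proof. intros Hf Hg t. apply (continuous_minus f g); auto. Qed.

Lemma rcont_mult (f g : R -> R) :
  rcont f -> rcont g -> rcont (fun t => f t * g t).
Proof. intros Hf Hg t. apply (continuous_mult f g); auto. Qed.

Lemma rcont_comp (f g : R -> R) :
  rcont f -> (forall t, continuous g (f t)) -> rcont (fun t => g (f t)).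
Proof. intros Hf Hg t. apply (continuous_comp f g); auto. Qed.

Lemma rcont_inv (f : R -> R) :
  rcont f -> (forall t, f t <> 0) -> rcont (fun t => / f t).
Proof.
  intros Hf H. apply (rcont_comp f Rinv Hf).
  intros t. apply continuous_Rinv. apply H.
Qed.

Lemma rcont_div (f g : R -> R) :
  rcont f -> rcont g -> (forall t, g t <> 0) -> rcont (fun t => f t / g t).
Proof. intros Hf Hg H. apply rcont_mult; [|apply rcont_inv]; auto. Qed.

Lemma rcont_pow (f : R -> R) (n : nat) : rcont f -> rcont (fun t => f t ^ n).
Proof.
  intros Hf. induction n; simpl; [apply rcont_const|now apply rcont_mult].
Qed.

Lemma rcont_sqrt (f : R -> R) : rcont f -> rcont (fun t => sqrt (f t)).
Proof. intros Hf. apply (rcont_comp f sqrt Hf). intros; apply continuous_sqrt. Qed.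

Lemma rcont_ex_RInt (f : R -> R) (a b : R) : rcont f -> ex_RInt f a b.
Proof.
  intros Hf. apply (ex_RInt_continuous (V := R_CompleteNormedModule)).
  intros; apply Hf.
Qed.

Lemma ccont_ext (u v : R -> C) : (forall t, u t = v t) -> ccont u -> ccont v.
Proof.
  intros E [H1 H2]; split; intros t.
  - apply (continuous_ext (fun t => Re (u t))); [intros; now rewrite E|apply H1].
  - apply (continuous_ext (fun t => Im (u t))); [intros; now rewrite E|apply H2].
Qed.

Lemma ccont_const (c : C) : ccont (fun _ => c).
Proof. split; apply rcont_const. Qed.

Lemma ccont_RtoC (f : R -> R) : rcont f -> ccont (fun t => RtoC (f t)).
Proof. intros; split; simpl; [assumption|apply rcont_const]. Qed.

Lemma ccont_plus (u v : R -> C) :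
  ccont u -> ccont v -> ccont (fun t => (u t + v t)%C).
Proof. intros [? ?] [? ?]; split; unfold Cplus; simpl; now apply rcont_plus. Qed.

Lemma ccont_opp (u : R -> C) : ccont u -> ccont (fun t => (- u t)%C).
Proof. intros [? ?]; split; unfold Copp; simpl; now apply rcont_opp. Qed.

Lemma ccont_minus (u v : R -> C) :
  ccont u -> ccont v -> ccont (fun t => (u t - v t)%C).
Proof. intros; apply ccont_plus; [|apply ccont_opp]; auto. Qed.

Lemma ccont_mult (u v : R -> C) :
  ccont u -> ccont v -> ccont (fun t => (u t * v t)%C).
Proof.
  intros [? ?] [? ?]; split; unfold Cmult; simpl.
  - apply rcont_minus; apply rcont_mult; auto.
  - apply rcont_plus; apply rcont_mult; auto.
Qed.

Lemma ccont_conj (u : R -> C) : ccont u -> ccont (fun t => Cconj (u t)).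
Proof. intros [? ?]; split; simpl; [|apply rcont_opp]; auto. Qed.

Lemma C_sum_sqr_neq_0 (z : C) : z <> RtoC 0 -> fst z ^ 2 + snd z ^ 2 <> 0.
Proof.
  intros Hz E. apply Hz. destruct z as [x y]; simpl in *.
  unfold RtoC; f_equal; nra.
Qed.

Lemma ccont_inv (u : R -> C) :
  ccont u -> (forall t, u t <> RtoC 0) -> ccont (fun t => (/ u t)%C).
Proof.
  intros [H1 H2] H; split; unfold Cinv; simpl.
  - apply rcont_div; auto.
    + apply (rcont_plus (fun t => fst (u t) ^ 2) (fun t => snd (u t) ^ 2));
        apply rcont_pow; auto.
    + intros t; apply (C_sum_sqr_neq_0 (u t)), H.
  - apply rcont_div; auto.
    + apply rcont_opp; auto.
    + apply (rcont_plus (fun t => fst (u t) ^ 2) (fun t => snd (u t) ^ 2));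
        apply rcont_pow; auto.
    + intros t; apply (C_sum_sqr_neq_0 (u t)), H.
Qed.

Lemma ccont_div (u v : R -> C) :
  ccont u -> ccont v -> (forall t, v t <> RtoC 0) ->
  ccont (fun t => (u t / v t)%C).
Proof. intros; apply ccont_mult; [|apply ccont_inv]; auto. Qed.

Lemma ccont_pow (u : R -> C) (n : nat) :
  ccont u -> ccont (fun t => Cpow (u t) n).
Proof.
  intros Hu; induction n; simpl; [apply ccont_const|now apply ccont_mult].
Qed.

Lemma rcont_Cmod (u : R -> C) : ccont u -> rcont (fun t => Cmod (u t)).
Proof.
  intros [H1 H2]. unfold Cmod. apply rcont_sqrt, rcont_plus; apply rcont_pow; auto.
Qed.

Lemma rcont_Re (u : R -> C) : ccont u -> rcont (fun t => Re (u t)).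
Proof. now intros [? _]. Qed.

Lemma rcont_Im (u : R -> C) : ccont u -> rcont (fun t => Im (u t)).
Proof. now intros [_ ?]. Qed.

Lemma ccont_polar (r : R) : ccont (fun t => polar r t).
Proof.
  split; unfold polar; simpl; intros t.
  - apply (continuous_scal_r r cos). apply continuous_cos.
  - apply (continuous_scal_r r sin). apply continuous_sin.
Qed.

Create HintDb cont.
#[export] Hint Resolve rcont_const rcont_plus rcont_opp rcont_minus rcont_mult
  rcont_pow rcont_sqrt ccont_const ccont_RtoC ccont_plus ccont_opp ccont_minus
  ccont_mult ccont_conj ccont_pow rcont_Cmod rcont_Re rcont_Im
  ccont_polar : cont.

(** * Means over a circle *)

Definition rmean (f : R -> R) : R := RInt f 0 (2 * PI) / (2 * PI).

Definition cmean (u : R -> C) : C :=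
  (rmean (fun t => Re (u t)), rmean (fun t => Im (u t))).

Lemma two_PI_pos : 0 < 2 * PI.
Proof. generalize PI_RGT_0; lra. Qed.

Lemma rmean_ext (f g : R -> R) : (forall t, f t = g t) -> rmean f = rmean g.
Proof. intros E. unfold rmean. f_equal. apply RInt_ext; auto. Qed.

Lemma rmean_const (c : R) : rmean (fun _ => c) = c.
Proof.
  unfold rmean. rewrite RInt_const. unfold scal; simpl; unfold mult; simpl.
  generalize two_PI_pos; intros; field; lra.
Qed.

Lemma rmean_plus (f g : R -> R) :
  rcont f -> rcont g -> rmean (fun t => f t + g t) = rmean f + rmean g.
Proof.
  intros Hf Hg. unfold rmean.
  rewrite (RInt_plus (V := R_CompleteNormedModule) f g) by (now apply rcont_ex_RInt).
  unfold plus; simpl. generalize two_PI_pos; intros; field; lra.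
Qed.

Lemma rmean_scal (c : R) (f : R -> R) :
  rcont f -> rmean (fun t => c * f t) = c * rmean f.
Proof.
  intros Hf. unfold rmean.
  rewrite (RInt_scal (V := R_CompleteNormedModule) f) by (now apply rcont_ex_RInt).
  unfold scal; simpl; unfold mult; simpl.
  generalize two_PI_pos; intros; field; lra.
Qed.

Lemma rmean_opp (f : R -> R) : rcont f -> rmean (fun t => - f t) = - rmean f.
Proof.
  intros Hf. rewrite (rmean_ext _ (fun t => (-1) * f t)) by (intros; ring).
  rewrite rmean_scal by assumption; ring.
Qed.

Lemma rmean_minus (f g : R -> R) :
  rcont f -> rcont g -> rmean (fun t => f t - g t) = rmean f - rmean g.
Proof.
  intros Hf Hg. unfold Rminus. rewrite rmean_plus, rmean_opp; auto with cont.
Qed.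

Lemma rmean_le (f g : R -> R) :
  rcont f -> rcont g -> (forall t, f t <= g t) -> rmean f <= rmean g.
Proof.
  intros Hf Hg H. unfold rmean, Rdiv. generalize two_PI_pos; intros P.
  apply Rmult_le_compat_r.
  - apply Rlt_le, Rinv_0_lt_compat; lra.
  - apply RInt_le; try (now apply rcont_ex_RInt); [lra|auto].
Qed.

Lemma rmean_ge_0 (f : R -> R) : rcont f -> (forall t, 0 <= f t) -> 0 <= rmean f.
Proof.
  intros Hf H. rewrite <- (rmean_const 0). apply rmean_le; auto with cont.
Qed.

Lemma rmean_le_const (f : R -> R) (c : R) :
  rcont f -> (forall t, f t <= c) -> rmean f <= c.
Proof.
  intros Hf H. rewrite <- (rmean_const c). apply rmean_le; auto with cont.
Qed.

Lemma rmean_CauchySchwarz (f g : R -> R) :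
  rcont f -> rcont g ->
  rmean (fun t => f t * g t) ^ 2
  <= rmean (fun t => f t ^ 2) * rmean (fun t => g t ^ 2).
Proof.
  intros Hf Hg.
  set (a := rmean (fun t => f t ^ 2)). set (b := rmean (fun t => f t * g t)).
  set (c := rmean (fun t => g t ^ 2)).
  assert (Ha : 0 <= a) by (apply rmean_ge_0; auto with cont; intros; apply pow2_ge_0).
  (* The quadratic form is the mean of [(x f + y g)^2]. At [(b, - a)] its nonnegativity is the claim
     multiplied by [a]. *)
  assert (Hq : forall x y, 0 <= x ^ 2 * a + 2 * x * y * b + y ^ 2 * c).
  { intros x y. unfold a, b, c.
    rewrite <- !rmean_scal, <- !rmean_plus; auto 10 with cont.
    apply rmean_ge_0; auto 10 with cont.
    intros t. replace (_ + _) with ((x * f t + y * g t) ^ 2) by ring.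
    apply pow2_ge_0. }
  generalize (Hq b (- a)) (Hq c (- b)). intros H1 H2.
  destruct (Req_dec a 0) as [E|E].
  - destruct (Req_dec b 0) as [->|Eb]; [nra|].
    exfalso.
    (* With [a = 0] and [b <> 0] the form is linear in [x]; this [x] gives it the value -1. *)
    generalize (Hq (- (c + 1) / (2 * b)) 1). rewrite E.
    replace (_ + _ + _) with (-1) by (field; auto). lra.
  - assert (0 <= a * (a * c - b ^ 2)) by nra.
    assert (0 < a) by lra. nra.
Qed.

Lemma cmean_ext (u v : R -> C) : (forall t, u t = v t) -> cmean u = cmean v.
Proof.
  intros E. unfold cmean. f_equal; apply rmean_ext; intros; now rewrite E.
Qed.

Lemma cmean_const (c : C) : cmean (fun _ => c) = c.
Proof. unfold cmean. rewrite !rmean_const. now destruct c. Qed.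

Lemma cmean_plus (u v : R -> C) :
  ccont u -> ccont v -> cmean (fun t => (u t + v t)%C) = (cmean u + cmean v)%C.
Proof.
  intros [? ?] [? ?]. unfold cmean, Cplus; simpl.
  now f_equal; apply rmean_plus.
Qed.

Lemma cmean_scal (c : C) (u : R -> C) :
  ccont u -> cmean (fun t => (c * u t)%C) = (c * cmean u)%C.
Proof.
  intros [H1 H2]. unfold cmean, Cmult; simpl. f_equal.
  - rewrite rmean_minus, !rmean_scal; auto with cont.
  - rewrite rmean_plus, !rmean_scal; auto with cont.
Qed.

Lemma cmean_minus (u v : R -> C) :
  ccont u -> ccont v -> cmean (fun t => (u t - v t)%C) = (cmean u - cmean v)%C.
Proof.
  intros Hu Hv.
  rewrite (cmean_ext _ (fun t => (u t + (- (1)) * v t)%C)) by (intros; ring).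
  rewrite cmean_plus, cmean_scal; auto with cont. ring.
Qed.

Lemma cmean_conj (u : R -> C) :
  ccont u -> cmean (fun t => Cconj (u t)) = Cconj (cmean u).
Proof.
  intros [H1 H2]. unfold cmean, Cconj; simpl. f_equal.
  now apply (rmean_opp (fun t => Im (u t))).
Qed.

Lemma Cmod_sqr (c : C) : Cmod c ^ 2 = Re c ^ 2 + Im c ^ 2.
Proof. apply Cmod2_alt. Qed.

Lemma Re_le_Cmod (c : C) : Re c <= Cmod c.
Proof. eapply Rle_trans; [apply Rle_abs|apply re_le_Cmod]. Qed.

(* Rotating by the conjugate of the mean makes the mean a nonnegative real. *)
Lemma Cmod_cmean_le (u : R -> C) :
  ccont u -> Cmod (cmean u) <= rmean (fun t => Cmod (u t)).
Proof.
  intros Hu. set (m := cmean u).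
  destruct (Req_dec (Cmod m) 0) as [E|E].
  - rewrite E. apply rmean_ge_0; auto with cont. intros; apply Cmod_ge_0.
  - assert (P : 0 < Cmod m) by (generalize (Cmod_ge_0 m); lra).
    assert (H : Cmod m ^ 2 <= Cmod m * rmean (fun t => Cmod (u t))).
    { rewrite <- rmean_scal by auto with cont.
      replace (Cmod m ^ 2) with (Re (cmean (fun t => (Cconj m * u t)%C))).
      - unfold cmean at 1; simpl Re at 1. apply rmean_le; auto 10 with cont.
        intros t. eapply Rle_trans; [apply (Re_le_Cmod (Cconj m * u t)%C)|].
          rewrite Cmod_mult, Cmod_conj. lra.
      - rewrite cmean_scal by assumption. fold m. rewrite Cmod_sqr.
        destruct m; simpl; ring. }
    nra.
Qed.

Lemma Cmod_cmean_mult_le (u v : R -> C) :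
  ccont u -> ccont v ->
  Cmod (cmean (fun t => (u t * v t)%C)) ^ 2
  <= rmean (fun t => Cmod (u t) ^ 2) * rmean (fun t => Cmod (v t) ^ 2).
Proof.
  intros Hu Hv.
  eapply Rle_trans; [|apply (rmean_CauchySchwarz (fun t => Cmod (u t)) (fun t => Cmod (v t))); auto with cont].
  apply pow_incr; split; [apply Cmod_ge_0|].
  eapply Rle_trans; [apply Cmod_cmean_le; auto with cont|].
  apply Req_le, rmean_ext. intros; apply Cmod_mult.
Qed.

(** * Finite sums and products *)

Fixpoint rsum (u : nat -> R) (n : nat) : R :=
  match n with O => 0 | S m => rsum u m + u m end.
Fixpoint csum (u : nat -> C) (n : nat) : C :=
  match n with O => RtoC 0 | S m => (csum u m + u m)%C end.
Fixpoint rprod (u : nat -> R) (n : nat) : R :=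
  match n with O => 1 | S m => rprod u m * u m end.
Fixpoint cprod (u : nat -> C) (n : nat) : C :=
  match n with O => RtoC 1 | S m => (cprod u m * u m)%C end.

Lemma rsum_ext (u v : nat -> R) (n : nat) :
  (forall k, (k < n)%nat -> u k = v k) -> rsum u n = rsum v n.
Proof.
  induction n; intros H; simpl; auto. rewrite IHn, H; auto.
Qed.

Lemma csum_ext (u v : nat -> C) (n : nat) :
  (forall k, (k < n)%nat -> u k = v k) -> csum u n = csum v n.
Proof.
  induction n; intros H; simpl; auto. rewrite IHn, H; auto.
Qed.

Lemma rsum_le (u v : nat -> R) (n : nat) :
  (forall k, (k < n)%nat -> u k <= v k) -> rsum u n <= rsum v n.
Proof.
  induction n; intros H; simpl; [lra|]. apply Rplus_le_compat; auto.
Qed.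

Lemma rsum_ge_0 (u : nat -> R) (n : nat) :
  (forall k, (k < n)%nat -> 0 <= u k) -> 0 <= rsum u n.
Proof.
  induction n; intros H; simpl; [lra|]. apply Rplus_le_le_0_compat; auto.
Qed.

Lemma rsum_scal (c : R) (u : nat -> R) (n : nat) :
  rsum (fun k => c * u k) n = c * rsum u n.
Proof. induction n; simpl; [|rewrite IHn]; ring. Qed.

Lemma rsum_plus (u v : nat -> R) (n : nat) :
  rsum (fun k => u k + v k) n = rsum u n + rsum v n.
Proof. induction n; simpl; [|rewrite IHn]; ring. Qed.

Lemma csum_scal (c : C) (u : nat -> C) (n : nat) :
  csum (fun k => (c * u k)%C) n = (c * csum u n)%C.
Proof. induction n; simpl; [|rewrite IHn]; ring. Qed.

Lemma csum_plus (u v : nat -> C) (n : nat) :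
  csum (fun k => (u k + v k)%C) n = (csum u n + csum v n)%C.
Proof. induction n; simpl; [|rewrite IHn]; ring. Qed.

Lemma csum_conj (u : nat -> C) (n : nat) :
  csum (fun k => Cconj (u k)) n = Cconj (csum u n).
Proof.
  induction n; simpl.
  - unfold Cconj, RtoC; simpl; f_equal; ring.
  - now rewrite IHn, Cplus_conj.
Qed.

Lemma csum_RtoC (u : nat -> R) (n : nat) :
  csum (fun k => RtoC (u k)) n = RtoC (rsum u n).
Proof. induction n; simpl; auto. now rewrite IHn, RtoC_plus. Qed.

Lemma Cmod_csum_le (u : nat -> C) (n : nat) :
  Cmod (csum u n) <= rsum (fun k => Cmod (u k)) n.
Proof.
  induction n; simpl; [rewrite Cmod_0; lra|].
  eapply Rle_trans; [apply Cmod_triangle|lra].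
Qed.

Lemma rsum_CauchySchwarz (a b : nat -> R) (n : nat) :
  rsum (fun k => a k * b k) n ^ 2
  <= rsum (fun k => a k ^ 2) n * rsum (fun k => b k ^ 2) n.
Proof.
  induction n as [|n IHn]; [simpl; lra|].
  change ((rsum (fun k => a k * b k) n + a n * b n) ^ 2
    <= (rsum (fun k => a k ^ 2) n + a n ^ 2) * (rsum (fun k => b k ^ 2) n + b n ^ 2)).
  set (A := rsum (fun k => a k ^ 2) n) in *. set (B := rsum (fun k => b k ^ 2) n) in *.
  set (S := rsum (fun k => a k * b k) n) in *.
  assert (0 <= A) by (apply rsum_ge_0; intros; apply pow2_ge_0).
  assert (0 <= B) by (apply rsum_ge_0; intros; apply pow2_ge_0).
  (* The cross term of the square. Both sides are squared: the induction hypothesis gives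
     [S^2 <= A B], and [4 u v <= (u + v)^2] finishes. *)
  assert (K : 2 * S * (a n * b n) <= A * b n ^ 2 + B * a n ^ 2).
  2: { fold A B; nra. }
  assert (Ha2 := pow2_ge_0 (a n)). assert (Hb2 := pow2_ge_0 (b n)).
  apply Rsqr_incr_0_var; [|apply Rplus_le_le_0_compat; now apply Rmult_le_pos].
  unfold Rsqr.
  assert (0 <= (A * b n ^ 2 - B * a n ^ 2) ^ 2) by apply pow2_ge_0.
  assert (S ^ 2 * (a n * b n) ^ 2 <= A * B * (a n * b n) ^ 2).
  { apply Rmult_le_compat_r; [apply pow2_ge_0|auto]. }
  nra.
Qed.

Lemma rcont_rsum (u : nat -> R -> R) (n : nat) :
  (forall k, (k < n)%nat -> rcont (u k)) -> rcont (fun t => rsum (fun k => u k t) n).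
Proof.
  induction n as [|n IHn]; intros H; simpl; [apply rcont_const|].
  apply rcont_plus; [apply IHn; intros|]; apply H; lia.
Qed.

Lemma ccont_csum (u : nat -> R -> C) (n : nat) :
  (forall k, (k < n)%nat -> ccont (u k)) -> ccont (fun t => csum (fun k => u k t) n).
Proof.
  induction n as [|n IHn]; intros H; simpl; [apply ccont_const|].
  apply ccont_plus; [apply IHn; intros|]; apply H; lia.
Qed.

Lemma rmean_rsum (u : nat -> R -> R) (n : nat) :
  (forall k, (k < n)%nat -> rcont (u k)) ->
  rmean (fun t => rsum (fun k => u k t) n) = rsum (fun k => rmean (u k)) n.
Proof.
  induction n; intros H; simpl; [apply rmean_const|].
  rewrite rmean_plus; auto.
  - rewrite IHn; auto.
  - apply rcont_rsum; auto.
Qed.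

Lemma cmean_csum (u : nat -> R -> C) (n : nat) :
  (forall k, (k < n)%nat -> ccont (u k)) ->
  cmean (fun t => csum (fun k => u k t) n) = csum (fun k => cmean (u k)) n.
Proof.
  induction n; intros H; simpl; [apply cmean_const|].
  rewrite cmean_plus; auto.
  - rewrite IHn; auto.
  - apply ccont_csum; auto.
Qed.

Lemma rprod_ge_0 (u : nat -> R) (n : nat) :
  (forall k, (k < n)%nat -> 0 <= u k) -> 0 <= rprod u n.
Proof.
  induction n; intros H; simpl; [lra|]. apply Rmult_le_pos; auto.
Qed.

Lemma rprod_le (u v : nat -> R) (n : nat) :
  (forall k, (k < n)%nat -> 0 <= u k <= v k) -> rprod u n <= rprod v n.
Proof.
  induction n; intros H; simpl; [lra|].
  apply Rmult_le_compat; auto.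
  - apply rprod_ge_0. intros; apply H; lia.
  - apply H; lia.
  - apply H; lia.
Qed.

Lemma rprod_mult (u v : nat -> R) (n : nat) :
  rprod (fun k => u k * v k) n = rprod u n * rprod v n.
Proof. induction n; simpl; [|rewrite IHn]; ring. Qed.

Lemma Cmod_cprod (u : nat -> C) (n : nat) :
  Cmod (cprod u n) = rprod (fun k => Cmod (u k)) n.
Proof.
  induction n; simpl; [apply Cmod_1|]. now rewrite Cmod_mult, IHn.
Qed.

(** * Goursat's lemma *)

(** Frechet differentiability with gradient [(lx, ly)] at one point. Nothing is said about nearby
    gradients. *)
Definition tot_diff (P : R -> R -> R) (x y lx ly : R) : Prop :=
  forall eps, 0 < eps -> exists d, 0 < d /\
    forall u v, Rabs (u - x) < d -> Rabs (v - y) < d ->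
      Rabs (P u v - P x y - (lx * (u - x) + ly * (v - y)))
      <= eps * (Rabs (u - x) + Rabs (v - y)).

Lemma tot_diff_cont_l (P : R -> R -> R) (x y lx ly : R) :
  tot_diff P x y lx ly -> continuous (fun t => P t y) x.
Proof.
  intros H. apply continuity_pt_filterlim. intros eps Heps.
  destruct (H 1 Rlt_0_1) as (d & Hd & H1).
  set (A := Rabs lx + 2). assert (HA : 0 < A) by (unfold A; generalize (Rabs_pos lx); lra).
  exists (Rmin d (eps / A)). split.
  - apply Rmin_glb_lt; auto. now apply Rdiv_lt_0_compat.
  - intros t [_ Ht]. simpl in Ht |- *. unfold R_dist, Rdist in *.
    assert (T1 := Rlt_le_trans _ _ _ Ht (Rmin_l _ _)).
    assert (T2 := Rlt_le_trans _ _ _ Ht (Rmin_r _ _)).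
    specialize (H1 t y T1). rewrite Rminus_diag, Rabs_R0 in H1. specialize (H1 Hd).
    replace (P t y - P x y) with
      ((P t y - P x y - (lx * (t - x) + ly * 0)) + lx * (t - x)) by ring.
    eapply Rle_lt_trans; [apply Rabs_triang|]. rewrite Rabs_mult.
    assert (Rabs (t - x) * A < eps).
    { apply (Rmult_lt_reg_r (/ A)); [now apply Rinv_0_lt_compat|].
      unfold Rdiv in T2. rewrite Rmult_assoc, Rinv_r; lra. }
    unfold A in *. generalize (Rabs_pos (t - x)) (Rabs_pos lx). nra.
Qed.

Lemma tot_diff_swap (P : R -> R -> R) (x y lx ly : R) :
  tot_diff P x y lx ly -> tot_diff (fun u v => P v u) y x ly lx.
Proof.
  intros H eps Heps. destruct (H eps Heps) as (d & Hd & H1).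
  exists d; split; auto. intros u v Hu Hv.
  rewrite (Rplus_comm (ly * _)), (Rplus_comm (Rabs _)). auto.
Qed.

Lemma tot_diff_cont_r (P : R -> R -> R) (x y lx ly : R) :
  tot_diff P x y lx ly -> continuous (fun s => P x s) y.
Proof.
  intros H. apply tot_diff_swap in H. now apply tot_diff_cont_l in H.
Qed.

Section Goursat.

Variables (P Q : R -> R -> R) (L : R).
Hypothesis HL : 0 < L.
(** The shared [k] is both the second partial derivative of [P] and the first of [Q]: the form
    [P dx + Q dy] is closed at each point, and its partial derivatives may be discontinuous. *)
Hypothesis Hdiff : forall x y, 0 <= x <= 1 -> 0 <= y <= L ->
  exists px k qy, tot_diff P x y px k /\ tot_diff Q x y k qy.

Let ex_P (y a b : R) : 0 <= y <= L -> 0 <= a -> a <= b -> b <= 1 ->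
  ex_RInt (fun t => P t y) a b.
Proof.
  intros. apply (ex_RInt_continuous (V := R_CompleteNormedModule)).
  rewrite Rmin_left, Rmax_right by lra. intros x Hx.
  destruct (Hdiff x y) as (px & k & qy & H3 & _); try lra.
  now apply tot_diff_cont_l in H3.
Qed.

Let ex_Q (x a b : R) : 0 <= x <= 1 -> 0 <= a -> a <= b -> b <= L ->
  ex_RInt (fun s => Q x s) a b.
Proof.
  intros. apply (ex_RInt_continuous (V := R_CompleteNormedModule)).
  rewrite Rmin_left, Rmax_right by lra. intros y Hy.
  destruct (Hdiff x y) as (px & k & qy & _ & H3); try lra.
  now apply tot_diff_cont_r in H3.
Qed.

(** The integral of [P dx + Q dy] counterclockwise along the boundary of the rectangle with lower
    left corner [(x, y)] and sides [h], [k]. *)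
Let J (x y h k : R) : R :=
  RInt (fun t => P t y) x (x + h) - RInt (fun t => P t (y + k)) x (x + h)
  + (RInt (fun s => Q (x + h) s) y (y + k) - RInt (fun s => Q x s) y (y + k)).

Let J_split (x y h k : R) :
  0 <= x -> 0 <= y -> 0 <= h -> 0 <= k -> x + h <= 1 -> y + k <= L ->
  J x y h k = J x y (h / 2) (k / 2) + J (x + h / 2) y (h / 2) (k / 2)
    + (J x (y + k / 2) (h / 2) (k / 2) + J (x + h / 2) (y + k / 2) (h / 2) (k / 2)).
Proof.
  intros. unfold J.
  replace (x + h / 2 + h / 2) with (x + h) by lra.
  replace (y + k / 2 + k / 2) with (y + k) by lra.
  rewrite <- (RInt_Chasles (V := R_CompleteNormedModule) (fun t => P t y) x (x + h / 2) (x + h));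
    try (apply ex_P; lra).
  rewrite <- (RInt_Chasles (V := R_CompleteNormedModule) (fun t => P t (y + k)) x (x + h / 2) (x + h));
    try (apply ex_P; lra).
  rewrite <- (RInt_Chasles (V := R_CompleteNormedModule) (fun t => Q x t) y (y + k / 2) (y + k));
    try (apply ex_Q; lra).
  rewrite <- (RInt_Chasles (V := R_CompleteNormedModule) (fun t => Q (x + h) t) y (y + k / 2) (y + k));
    try (apply ex_Q; lra).
  unfold plus; simpl. ring.
Qed.

(** The affine approximation at [(X, Y)] is itself a closed form and contributes nothing, so only
    the errors of size [eps * (h + k)] along the four sides remain. *)
Let J_small (X Y x y h k d eps px K qy : R) :
  0 <= x -> 0 <= y -> 0 <= h < d -> 0 <= k < d -> x + h <= 1 -> y + k <= L ->
  x <= X <= x + h -> y <= Y <= y + k -> 0 < eps ->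
  (forall u v, Rabs (u - X) < d -> Rabs (v - Y) < d ->
    Rabs (P u v - P X Y - (px * (u - X) + K * (v - Y)))
      <= eps * (Rabs (u - X) + Rabs (v - Y))) ->
  (forall u v, Rabs (u - X) < d -> Rabs (v - Y) < d ->
    Rabs (Q u v - Q X Y - (K * (u - X) + qy * (v - Y)))
      <= eps * (Rabs (u - X) + Rabs (v - Y))) ->
  Rabs (J x y h k) <= 2 * eps * (h + k) ^ 2.
Proof.
  intros Hx Hy Hh Hk Hxh Hyk HX HY Heps HP HQ.
  assert (near : forall a b c e, a <= b <= a + c -> a <= e <= a + c -> Rabs (b - e) <= c).
  { intros. apply Rabs_le; lra. }
  assert (HP' : forall u v, x <= u <= x + h -> y <= v <= y + k ->
    Rabs (P u v - P X Y - (px * (u - X) + K * (v - Y))) <= eps * (h + k)).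
  { intros u v Hu Hv. assert (T1 := near x u h X Hu HX). assert (T2 := near y v k Y Hv HY).
    eapply Rle_trans; [apply HP; lra|]. apply Rmult_le_compat_l; lra. }
  assert (HQ' : forall u v, x <= u <= x + h -> y <= v <= y + k ->
    Rabs (Q u v - Q X Y - (K * (u - X) + qy * (v - Y))) <= eps * (h + k)).
  { intros u v Hu Hv. assert (T1 := near x u h X Hu HX). assert (T2 := near y v k Y Hv HY).
    eapply Rle_trans; [apply HQ; lra|]. apply Rmult_le_compat_l; lra. }
  (* [K * k] and [K * h] compensate the linear parts of the increments across the rectangle.
     Integrated they give [K h k] with opposite signs, so [J] is still the sum of [A] and [B]. *)
  set (A := RInt (fun t => P t y - P t (y + k) + K * k) x (x + h)).
  set (B := RInt (fun s => Q (x + h) s - Q x s - K * h) y (y + k)).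
  assert (exP1 : ex_RInt (fun t => P t y) x (x + h)) by (apply ex_P; lra).
  assert (exP2 : ex_RInt (fun t => P t (y + k)) x (x + h)) by (apply ex_P; lra).
  assert (exQ1 : ex_RInt (fun s => Q (x + h) s) y (y + k)) by (apply ex_Q; lra).
  assert (exQ2 : ex_RInt (fun s => Q x s) y (y + k)) by (apply ex_Q; lra).
  assert (exP : ex_RInt (fun t => P t y - P t (y + k)) x (x + h))
    by now apply (ex_RInt_minus (V := R_CompleteNormedModule)).
  assert (exQ : ex_RInt (fun s => Q (x + h) s - Q x s) y (y + k))
    by now apply (ex_RInt_minus (V := R_CompleteNormedModule)).
  assert (exc : forall c a b : R, ex_RInt (fun _ => c) a b) by (intros; apply ex_RInt_const).
  assert (EJ : J x y h k = A + B).
  { unfold A, B, J.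
    rewrite (RInt_plus (V := R_CompleteNormedModule) (fun t => P t y - P t (y + k)) (fun _ => K * k)) by auto.
    rewrite (RInt_minus (V := R_CompleteNormedModule) (fun s => Q (x + h) s - Q x s) (fun _ => K * h)) by auto.
    rewrite (RInt_minus (V := R_CompleteNormedModule) (fun t => P t y)) by auto.
    rewrite (RInt_minus (V := R_CompleteNormedModule) (fun s => Q (x + h) s)) by auto.
    rewrite !RInt_const. unfold plus, minus, opp, scal; simpl; unfold mult, plus; simpl. change (RInt (fun s => Q x s) y (y + k)) with (RInt (Q x) y (y + k)). ring. }
  rewrite EJ. eapply Rle_trans; [apply Rabs_triang|].
  assert (HA : Rabs A <= (x + h - x) * (2 * eps * (h + k))).
  { apply abs_RInt_le_const; [lra| |].
    - now apply (ex_RInt_plus (V := R_CompleteNormedModule) (fun t => P t y - P t (y + k)) (fun _ => K * k)).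
    - intros t Ht.
      assert (T1 : Rabs (P t y - P X Y - (px * (t - X) + K * (y - Y))) <= eps * (h + k)) by (apply HP'; lra).
      assert (T2 : Rabs (P t (y + k) - P X Y - (px * (t - X) + K * (y + k - Y))) <= eps * (h + k))
        by (apply HP'; lra).
      apply Rabs_le_between in T1. apply Rabs_le_between in T2.
      apply Rabs_le; lra. }
  assert (HB : Rabs B <= (y + k - y) * (2 * eps * (h + k))).
  { apply abs_RInt_le_const; [lra| |].
    - now apply (ex_RInt_minus (V := R_CompleteNormedModule) (fun s => Q (x + h) s - Q x s) (fun _ => K * h)).
    - intros s Hs.
      assert (T1 : Rabs (Q x s - Q X Y - (K * (x - X) + qy * (s - Y))) <= eps * (h + k)) by (apply HQ'; lra).
      assert (T2 : Rabs (Q (x + h) s - Q X Y - (K * (x + h - X) + qy * (s - Y))) <= eps * (h + k))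
        by (apply HQ'; lra).
      apply Rabs_le_between in T1. apply Rabs_le_between in T2.
      apply Rabs_le; lra. }
  lra.
Qed.

Let J0 : R := J 0 0 1 L.

Let bad (n : nat) (c : R * R) : Prop :=
  Rabs J0 / 4 ^ n <= Rabs (J (fst c) (snd c) (/ 2 ^ n) (L / 2 ^ n)).

(** The last quarter is chosen untested: if the other three are below their share, the triangle
    inequality leaves enough for it. *)
Let child (n : nat) (c : R * R) : R * R :=
  let x := fst c in let y := snd c in
  let h := / 2 ^ S n in let k := L / 2 ^ S n in
  let ok c' := Rle_dec (Rabs J0 / 4 ^ S n) (Rabs (J (fst c') (snd c') h k)) in
  if ok (x, y) then (x, y) else
  if ok (x + h, y) then (x + h, y) else
  if ok (x, y + k) then (x, y + k) else (x + h, y + k).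

Let half_inv (n : nat) : / 2 ^ n / 2 = / 2 ^ S n.
Proof. simpl. field. apply pow_nonzero; lra. Qed.

Let half_L (n : nat) : L / 2 ^ n / 2 = L / 2 ^ S n.
Proof. simpl. field. apply pow_nonzero; lra. Qed.

Let inv_pow_pos (n : nat) : 0 < / 2 ^ n.
Proof. apply Rinv_0_lt_compat, pow_lt; lra. Qed.

Let inside (n : nat) (c : R * R) : Prop :=
  0 <= fst c /\ fst c + / 2 ^ n <= 1 /\ 0 <= snd c /\ snd c + L / 2 ^ n <= L.

Let child_spec (n : nat) (c : R * R) : inside n c -> bad n c ->
  inside (S n) (child n c) /\ bad (S n) (child n c) /\
  fst c <= fst (child n c) /\ fst (child n c) + / 2 ^ S n <= fst c + / 2 ^ n /\
  snd c <= snd (child n c) /\ snd (child n c) + L / 2 ^ S n <= snd c + L / 2 ^ n.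
Proof.
  destruct c as [x y]; unfold inside, bad; simpl fst; simpl snd.
  intros (I1 & I2 & I3 & I4) B.
  assert (P1 := inv_pow_pos n). assert (P2 : 0 < L / 2 ^ n) by (apply Rmult_lt_0_compat; auto).
  rewrite J_split in B by lra. rewrite half_inv, half_L in B.
  assert (E1 := half_inv n). assert (E2 := half_L n).
  set (h := / 2 ^ S n) in *. set (k := L / 2 ^ S n) in *.
  assert (E3 : Rabs J0 / 4 ^ n = 4 * (Rabs J0 / 4 ^ S n)).
  { simpl. field. apply pow_nonzero; lra. }
  unfold child; cbv zeta; cbn [fst snd]; fold h k.
  destruct Rle_dec as [|F1]; cbn [fst snd]; [repeat split; auto; lra|].
  destruct Rle_dec as [|F2]; cbn [fst snd]; [repeat split; auto; lra|].
  destruct Rle_dec as [|F3]; cbn [fst snd]; [repeat split; auto; lra|].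
  repeat split; try lra.
  apply Rnot_lt_le; intros Hc.
  cbn [fst snd] in F1, F2, F3. apply Rnot_le_lt in F1. apply Rnot_le_lt in F2. apply Rnot_le_lt in F3.
  revert B. apply Rlt_not_le. rewrite E3.
  eapply Rle_lt_trans; [apply Rabs_triang|].
  eapply Rle_lt_trans; [apply Rplus_le_compat; apply Rabs_triang|]. lra.
Qed.

Let cell : nat -> R * R := fix cell n :=
  match n with O => (0, 0) | S m => child m (cell m) end.

Let cell_ok (n : nat) : inside n (cell n) /\ bad n (cell n).
Proof.
  induction n as [|n [IH1 IH2]].
  - unfold inside, bad; simpl. rewrite Rinv_1, !Rdiv_1_r. fold J0. lra.
  - destruct (child_spec n (cell n) IH1 IH2) as (A & B & _). now split.
Qed.

Let cell_mono (n m : nat) : (n <= m)%nat ->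
  fst (cell n) <= fst (cell m) /\ fst (cell m) + / 2 ^ m <= fst (cell n) + / 2 ^ n /\
  snd (cell n) <= snd (cell m) /\ snd (cell m) + L / 2 ^ m <= snd (cell n) + L / 2 ^ n.
Proof.
  induction 1 as [|m Hm IH]; [lra|].
  destruct (cell_ok m) as [A B].
  destruct (child_spec m (cell m) A B) as (_ & _ & C).
  change (child m (cell m)) with (cell (S m)) in C. lra.
Qed.

Let nested_limit (a l : nat -> R) :
  (forall n, 0 <= l n) ->
  (forall n m, (n <= m)%nat -> a n <= a m /\ a m + l m <= a n + l n) ->
  exists X, forall n, a n <= X <= a n + l n.
Proof.
  intros Hl H.
  assert (U : forall m n, a m <= a n + l n).
  { intros m n. destruct (H m (Nat.max m n)) as [H1 _]; [lia|].
    destruct (H n (Nat.max m n)) as [_ H2]; [lia|]. generalize (Hl (Nat.max m n)); lra. }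
  destruct (completeness (fun x => exists n, x = a n)) as [X [HX1 HX2]].
  - exists (a O + l O). intros x [n ->]. apply U.
  - now exists (a O), O.
  - exists X. intros n. split.
    + apply HX1. now exists n.
    + apply HX2. intros x [m ->]. apply U.
Qed.

Let J0_eq_0 : J0 = 0.
Proof.
  destruct (Req_dec J0 0) as [|E]; auto. exfalso.
  assert (HJ : 0 < Rabs J0) by now apply Rabs_pos_lt.
  destruct (nested_limit (fun n => fst (cell n)) (fun n => / 2 ^ n)) as [X HX].
  { intros; now apply Rlt_le. }
  { intros n m Hnm. generalize (cell_mono n m Hnm). tauto. }
  destruct (nested_limit (fun n => snd (cell n)) (fun n => L / 2 ^ n)) as [Y HY].
  { intros; apply Rlt_le, Rmult_lt_0_compat; auto. }
  { intros n m Hnm. generalize (cell_mono n m Hnm). tauto. }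
  destruct (Hdiff X Y) as (px & K & qy & DP & DQ).
  { generalize (HX O); simpl; lra. }
  { generalize (HY O); simpl; lra. }
  (* With this [eps] the bound of [J_small] is half of what a bad cell retains at every level. *)
  set (eps := Rabs J0 / (4 * (1 + L) ^ 2)).
  assert (P1 : 0 < (1 + L) ^ 2) by (apply pow_lt; lra).
  assert (Heps : 0 < eps) by (apply Rdiv_lt_0_compat; lra).
  destruct (DP eps Heps) as (d1 & Hd1 & D1).
  destruct (DQ eps Heps) as (d2 & Hd2 & D2).
  set (d := Rmin d1 d2).
  assert (Hd : 0 < d) by now apply Rmin_glb_lt.
  assert (exists n, / 2 ^ n < d / (1 + L)) as [n Hn].
  { destruct (pow_lt_1_zero (/ 2)) with (y := d / (1 + L)) as [n Hn].
    - rewrite Rabs_pos_eq; lra.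
    - apply Rdiv_lt_0_compat; lra.
    - exists n. specialize (Hn n (Nat.le_refl n)).
      rewrite pow_inv in Hn. eapply Rle_lt_trans; [apply Rle_abs|exact Hn]. }
  destruct (cell_ok n) as [(I1 & I2 & I3 & I4) B].
  assert (Hn' : / 2 ^ n * (1 + L) < d).
  { apply (Rmult_lt_reg_r (/ (1 + L))); [apply Rinv_0_lt_compat; lra|].
    rewrite Rmult_assoc, Rinv_r; unfold Rdiv in Hn; lra. }
  assert (Q1 := inv_pow_pos n).
  assert (Hh : 0 <= / 2 ^ n < d) by nra.
  assert (Hk : 0 <= L / 2 ^ n < d) by (unfold Rdiv; nra).
  unfold bad in B.
  assert (H : Rabs J0 / 4 ^ n <= 2 * eps * (/ 2 ^ n + L / 2 ^ n) ^ 2).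
  { eapply Rle_trans; [exact B|]. apply (J_small X Y _ _ _ _ d eps px K qy); auto; try exact (HX n); try exact (HY n).
    - intros u v Hu Hv. apply D1; (eapply Rlt_le_trans; [eassumption|apply Rmin_l]).
    - intros u v Hu Hv. apply D2; (eapply Rlt_le_trans; [eassumption|apply Rmin_r]). }
  replace (/ 2 ^ n + L / 2 ^ n) with ((1 + L) * / 2 ^ n) in H by (field; apply pow_nonzero; lra).
  rewrite Rpow_mult_distr in H.
  replace ((/ 2 ^ n) ^ 2) with (/ 4 ^ n) in H.
  2:{ rewrite pow_inv, <- pow_mult, Nat.mul_comm, pow_mult. do 2 f_equal. lra. }
  assert (Q4 : 0 < / 4 ^ n) by (apply Rinv_0_lt_compat, pow_lt; lra).
  replace (2 * eps * ((1 + L) ^ 2 * / 4 ^ n)) with (Rabs J0 / 2 * / 4 ^ n) in H.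
  2:{ unfold eps. field. split; [apply pow_nonzero|]; lra. }
  unfold Rdiv in H. nra.
Qed.

(** The boundary integral of the whole rectangle vanishes. By periodicity the two horizontal sides
    cancel, which leaves the two vertical ones. *)
Lemma closed_form_period :
  (forall x, 0 <= x <= 1 -> P x 0 = P x L) ->
  RInt (fun s => Q 1 s) 0 L = RInt (fun s => Q 0 s) 0 L.
Proof.
  intros Hper. assert (H := J0_eq_0). unfold J0, J in H.
  rewrite !Rplus_0_l in H.
  rewrite (RInt_ext (V := R_CompleteNormedModule) (fun t => P t 0) (fun t => P t L)) in H.
  - lra.
  - rewrite Rmin_left, Rmax_right by lra. intros; apply Hper; lra.
Qed.

End Goursat.

(** * Complex differentiability *)

(** The complex derivative without filters and without division; [is_derive_cder] and
    [cder_is_derive] translate from and to [is_derive]. *)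
Definition cder (f : C -> C) (z l : C) : Prop :=
  forall eps, 0 < eps -> exists d, 0 < d /\
    forall y, Cmod (y - z) < d ->
      Cmod (f y - f z - l * (y - z)) <= eps * Cmod (y - z).

Lemma is_derive_cder (f : C -> C) (z l : C) :
  is_derive (K := C_AbsRing) (V := C_NormedModule) f z l -> cder f z l.
Proof.
  intros [_ H] eps Heps.
  specialize (H z (fun P HP => HP) (mkposreal eps Heps)).
  destruct H as [d Hd].
  exists d; split; [apply cond_pos|].
  intros y Hy.
  assert (B : ball (M := AbsRing_UniformSpace C_AbsRing) z d y) by exact Hy.
  specialize (Hd y B). change (Cmod ((f y - f z) - (y - z) * l) <= eps * Cmod (y - z)) in Hd.
  eapply Rle_trans; [|exact Hd]. apply Req_le.
  f_equal. ring.
Qed.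

Lemma cder_unique (f : C -> C) (z l1 l2 : C) : cder f z l1 -> cder f z l2 -> l1 = l2.
Proof.
  intros H1 H2.
  destruct (Req_dec (Cmod (l1 - l2)) 0) as [E|E].
  { apply Cmod_eq_0 in E. replace l1 with ((l1 - l2) + l2)%C by ring. rewrite E; ring. }
  exfalso. assert (P : 0 < Cmod (l1 - l2)) by (generalize (Cmod_ge_0 (l1 - l2)); lra).
  destruct (H1 (Cmod (l1 - l2) / 4)) as (d1 & Hd1 & D1); [lra|].
  destruct (H2 (Cmod (l1 - l2) / 4)) as (d2 & Hd2 & D2); [lra|].
  set (d := Rmin d1 d2 / 2).
  assert (Hd : 0 < d) by (unfold d; generalize (Rmin_glb_lt _ _ _ Hd1 Hd2); lra).
  assert (Hl := Rmin_l d1 d2). assert (Hr := Rmin_r d1 d2).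
  assert (Em : Cmod (z + RtoC d - z) = d).
  { replace (z + RtoC d - z)%C with (RtoC d) by ring. rewrite Cmod_R. apply Rabs_pos_eq; lra. }
  specialize (D1 (z + RtoC d)%C). specialize (D2 (z + RtoC d)%C).
  rewrite Em in D1, D2. unfold d in D1 at 1, D2 at 1.
  specialize (D1 ltac:(lra)). specialize (D2 ltac:(lra)).
  assert (K : Cmod ((l1 - l2) * (z + RtoC d - z)) <= Cmod (l1 - l2) / 2 * d).
  { replace ((l1 - l2) * (z + RtoC d - z))%C with
      ((f (z + RtoC d)%C - f z - l2 * (z + RtoC d - z))
        - (f (z + RtoC d)%C - f z - l1 * (z + RtoC d - z)))%C by ring.
    eapply Rle_trans; [apply Cmod_triangle|]. rewrite Cmod_opp. lra. }
  rewrite Cmod_mult, Em in K. nra.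
Qed.

Lemma cder_lipschitz (f : C -> C) (z l : C) : cder f z l ->
  exists d, 0 < d /\ forall y, Cmod (y - z) < d ->
    Cmod (f y - f z) <= (Cmod l + 1) * Cmod (y - z).
Proof.
  intros H. destruct (H 1 Rlt_0_1) as (d & Hd & D). exists d; split; auto.
  intros y Hy. specialize (D y Hy).
  replace (f y - f z)%C with ((f y - f z - l * (y - z)) + l * (y - z))%C by ring.
  eapply Rle_trans; [apply Cmod_triangle|]. rewrite Cmod_mult. lra.
Qed.

Lemma cder_continuous (f : C -> C) (z l : C) : cder f z l ->
  forall eps, 0 < eps -> exists d, 0 < d /\
    forall y, Cmod (y - z) < d -> Cmod (f y - f z) < eps.
Proof.
  intros H eps Heps. destruct (cder_lipschitz f z l H) as (d & Hd & D).
  set (A := Cmod l + 1). assert (HA : 0 < A) by (unfold A; generalize (Cmod_ge_0 l); lra).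
  exists (Rmin d (eps / A)); split.
  - apply Rmin_glb_lt; auto. now apply Rdiv_lt_0_compat.
  - intros y Hy. eapply Rle_lt_trans; [apply D|].
    + eapply Rlt_le_trans; [exact Hy|apply Rmin_l].
    + assert (T := Rlt_le_trans _ _ _ Hy (Rmin_r _ _)).
      apply (Rmult_lt_compat_l A) in T; [|auto].
      replace (A * (eps / A)) with eps in T by (field; lra). exact T.
Qed.

Lemma cder_const (c z : C) : cder (fun _ => c) z 0.
Proof.
  intros eps Heps. exists 1; split; [lra|]. intros y _.
  replace (c - c - 0 * (y - z))%C with (RtoC 0) by ring. rewrite Cmod_0.
  generalize (Cmod_ge_0 (y - z)); nra.
Qed.

Lemma cder_id (z : C) : cder (fun x => x) z 1.
Proof.
  intros eps Heps. exists 1; split; [lra|]. intros y _.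
  replace (y - z - 1 * (y - z))%C with (RtoC 0) by ring. rewrite Cmod_0.
  generalize (Cmod_ge_0 (y - z)); nra.
Qed.

Lemma cder_plus (f g : C -> C) (z lf lg : C) :
  cder f z lf -> cder g z lg -> cder (fun x => (f x + g x)%C) z (lf + lg)%C.
Proof.
  intros Hf Hg eps Heps.
  destruct (Hf (eps / 2)) as (d1 & Hd1 & D1); [lra|].
  destruct (Hg (eps / 2)) as (d2 & Hd2 & D2); [lra|].
  exists (Rmin d1 d2); split; [now apply Rmin_glb_lt|]. intros y Hy.
  specialize (D1 y (Rlt_le_trans _ _ _ Hy (Rmin_l _ _))).
  specialize (D2 y (Rlt_le_trans _ _ _ Hy (Rmin_r _ _))).
  replace (f y + g y - (f z + g z) - (lf + lg) * (y - z))%C with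
    ((f y - f z - lf * (y - z)) + (g y - g z - lg * (y - z)))%C by ring.
  eapply Rle_trans; [apply Cmod_triangle|]. lra.
Qed.

Lemma cder_comp (f g : C -> C) (z lf lg : C) :
  cder f (g z) lf -> cder g z lg -> cder (fun x => f (g x)) z (lf * lg)%C.
Proof.
  intros Hf Hg eps Heps.
  destruct (cder_lipschitz g z lg Hg) as (d0 & Hd0 & D0).
  set (A := Cmod lg + 1). assert (HA : 0 < A) by (unfold A; generalize (Cmod_ge_0 lg); lra).
  set (B := Cmod lf + 1). assert (HB : 0 < B) by (unfold B; generalize (Cmod_ge_0 lf); lra).
  destruct (Hf (eps / (2 * A))) as (d1 & Hd1 & D1); [apply Rdiv_lt_0_compat; lra|].
  destruct (Hg (eps / (2 * B))) as (d2 & Hd2 & D2); [apply Rdiv_lt_0_compat; lra|].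
  destruct (cder_continuous g z lg Hg d1 Hd1) as (d3 & Hd3 & D3).
  exists (Rmin (Rmin d0 d2) d3); split; [repeat apply Rmin_glb_lt; auto|]. intros y Hy.
  assert (T1 := Rlt_le_trans _ _ _ Hy (Rmin_r _ _)).
  assert (T2 := Rlt_le_trans _ _ _ Hy (Rmin_l _ _)).
  specialize (D0 y (Rlt_le_trans _ _ _ T2 (Rmin_l _ _))).
  specialize (D2 y (Rlt_le_trans _ _ _ T2 (Rmin_r _ _))).
  specialize (D1 (g y) (D3 y T1)). fold A in D0.
  replace (f (g y) - f (g z) - lf * lg * (y - z))%C with
    ((f (g y) - f (g z) - lf * (g y - g z)) + lf * (g y - g z - lg * (y - z)))%C by ring.
  eapply Rle_trans; [apply Cmod_triangle|]. rewrite (Cmod_mult lf).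
  assert (T3 : eps / (2 * A) * Cmod (g y - g z) <= eps / 2 * Cmod (y - z)).
  { replace (eps / 2 * Cmod (y - z)) with (eps / (2 * A) * (A * Cmod (y - z))) by (field; lra).
    apply Rmult_le_compat_l; auto. apply Rlt_le, Rdiv_lt_0_compat; lra. }
  assert (T4 : Cmod lf * Cmod (g y - g z - lg * (y - z)) <= eps / 2 * Cmod (y - z)).
  { replace (eps / 2 * Cmod (y - z)) with (B * (eps / (2 * B) * Cmod (y - z))) by (field; lra).
    apply Rmult_le_compat; auto; try apply Cmod_ge_0. unfold B; lra. }
  lra.
Qed.

Lemma cder_sqr (z : C) : cder (fun x => (x * x)%C) z (2 * z)%C.
Proof.
  intros eps Heps. exists eps; split; auto. intros y Hy.
  replace (y * y - z * z - 2 * z * (y - z))%C with ((y - z) * (y - z))%C by ring.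
  rewrite Cmod_mult. apply Rmult_le_compat_r; [apply Cmod_ge_0|lra].
Qed.

Lemma cder_linear (c z : C) : cder (fun x => (c * x)%C) z c.
Proof.
  intros eps Heps. exists 1; split; [lra|]. intros y _.
  replace (c * y - c * z - c * (y - z))%C with (RtoC 0) by ring. rewrite Cmod_0.
  generalize (Cmod_ge_0 (y - z)); nra.
Qed.

Lemma cder_scal (c : C) (f : C -> C) (z l : C) :
  cder f z l -> cder (fun x => (c * f x)%C) z (c * l)%C.
Proof.
  intros H. apply (cder_comp (fun x => (c * x)%C) f z c l); auto. apply cder_linear.
Qed.

Lemma cder_ext (f g : C -> C) (z l : C) :
  (forall x, f x = g x) -> cder f z l -> cder g z l.
Proof.
  intros E H eps Heps. destruct (H eps Heps) as (d & Hd & D).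
  exists d; split; auto. intros y Hy. rewrite <- !E. auto.
Qed.

(* Polarization reduces the product rule to the rule for squares. *)
Lemma cder_mult (f g : C -> C) (z lf lg : C) :
  cder f z lf -> cder g z lg -> cder (fun x => (f x * g x)%C) z (lf * g z + f z * lg)%C.
Proof.
  intros Hf Hg.
  assert (Hp := cder_comp _ _ z _ _ (cder_sqr (f z + g z)) (cder_plus f g z lf lg Hf Hg)).
  assert (Hf2 := cder_comp _ _ z _ _ (cder_sqr (f z)) Hf).
  assert (Hg2 := cder_comp _ _ z _ _ (cder_sqr (g z)) Hg).
  assert (K := cder_scal (/ 2) _ z _ (cder_plus _ _ z _ _ Hp
     (cder_scal (- (1)) _ z _ (cder_plus _ _ z _ _ Hf2 Hg2)))).
  replace (lf * g z + f z * lg)%C with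
   (/ 2 * (2 * (f z + g z) * (lf + lg) + (- (1)) * (2 * f z * lf + 2 * g z * lg)))%C
   by (field; auto).
  eapply cder_ext; [|exact K]. intros x; simpl. field; auto.
Qed.

Lemma Cmod_pos (z : C) : z <> RtoC 0 -> 0 < Cmod z.
Proof. apply Cmod_gt_0. Qed.

Lemma cder_Cinv (z : C) : z <> RtoC 0 -> cder Cinv z (- / (z * z))%C.
Proof.
  intros Hz eps Heps. assert (P := Cmod_pos z Hz). set (m := Cmod z) in *.
  exists (Rmin (m / 2) (eps * (m * (m * m)) / 2)); split.
  { apply Rmin_glb_lt; [lra|]. assert (0 < m * (m * m)) by (repeat apply Rmult_lt_0_compat; auto).
    assert (0 < eps * (m * (m * m))) by now apply Rmult_lt_0_compat. lra. }
  intros y Hy.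
  assert (T1 := Rlt_le_trans _ _ _ Hy (Rmin_l _ _)).
  assert (T2 := Rlt_le_trans _ _ _ Hy (Rmin_r _ _)).
  assert (Hy2 : m / 2 <= Cmod y).
  { assert (Cmod z <= Cmod y + Cmod (y - z)).
    { replace z with (y + - (y - z))%C at 1 by ring.
      eapply Rle_trans; [apply Cmod_triangle|]. rewrite Cmod_opp; lra. }
    fold m in H; lra. }
  assert (Hy0 : y <> RtoC 0) by (apply Cmod_gt_0; lra).
  replace (/ y - / z - - / (z * z) * (y - z))%C with ((y - z) * (y - z) * / (y * (z * z)))%C
    by (field; auto).
  assert (Hyz : (y * (z * z))%C <> RtoC 0) by (repeat apply Cmult_neq_0; auto).
  rewrite !Cmod_mult, Cmod_inv, !Cmod_mult by auto. fold m.
  rewrite (Rmult_comm eps), Rmult_assoc. apply Rmult_le_compat_l; [apply Cmod_ge_0|].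
  assert (P2 : 0 < m * m) by nra.
  apply (Rmult_le_reg_r (Cmod y * (m * m))); [apply Rmult_lt_0_compat; lra|].
  rewrite Rmult_assoc, Rinv_l by (apply Rgt_not_eq, Rmult_lt_0_compat; lra).
  assert (eps * (m / 2 * (m * m)) <= eps * (Cmod y * (m * m))); [|lra].
  apply Rmult_le_compat_l; [lra|]. apply Rmult_le_compat_r; lra.
Qed.

Lemma cder_inv (f : C -> C) (z l : C) :
  f z <> RtoC 0 -> cder f z l -> cder (fun x => (/ f x)%C) z (- / (f z * f z) * l)%C.
Proof. intros H0 H. apply (cder_comp Cinv f); auto. now apply cder_Cinv. Qed.

(** The Cauchy theory below takes [1 < r], so that the unit circle lies inside the domain and no
    boundary values occur. *)
Definition hol (r : R) (f : C -> C) : Prop :=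
  forall z, Cmod z < r -> exists l, cder f z l.

Lemma hol_const (r : R) (c : C) : hol r (fun _ => c).
Proof. intros z _. eexists; apply cder_const. Qed.

Lemma hol_id (r : R) : hol r (fun z => z).
Proof. intros z _. eexists; apply cder_id. Qed.

Lemma hol_plus (r : R) (f g : C -> C) : hol r f -> hol r g -> hol r (fun z => (f z + g z)%C).
Proof.
  intros Hf Hg z Hz. destruct (Hf z Hz), (Hg z Hz). eexists; apply cder_plus; eauto.
Qed.

Lemma hol_mult (r : R) (f g : C -> C) : hol r f -> hol r g -> hol r (fun z => (f z * g z)%C).
Proof.
  intros Hf Hg z Hz. destruct (Hf z Hz), (Hg z Hz). eexists; apply cder_mult; eauto.
Qed.

Lemma hol_ext (r : R) (f g : C -> C) : (forall z, f z = g z) -> hol r f -> hol r g.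
Proof.
  intros E Hf z Hz. destruct (Hf z Hz) as [l Hl]. exists l; now apply (cder_ext f).
Qed.

Lemma hol_minus (r : R) (f g : C -> C) : hol r f -> hol r g -> hol r (fun z => (f z - g z)%C).
Proof.
  intros Hf Hg. apply (hol_ext r (fun z => (f z + (- (1)) * g z)%C)); [intros; ring|].
  apply hol_plus; auto. apply hol_mult; auto. apply hol_const.
Qed.

Lemma hol_inv (r : R) (f : C -> C) :
  (forall z, Cmod z < r -> f z <> RtoC 0) -> hol r f -> hol r (fun z => (/ f z)%C).
Proof.
  intros H0 Hf z Hz. destruct (Hf z Hz). eexists; apply cder_inv; eauto.
Qed.

Lemma hol_csum (r : R) (u : nat -> C -> C) (n : nat) :
  (forall k, (k < n)%nat -> hol r (u k)) -> hol r (fun z => csum (fun k => u k z) n).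
Proof.
  induction n as [|n IH]; intros H; simpl; [apply hol_const|].
  apply hol_plus; [apply IH; intros|]; apply H; lia.
Qed.

Lemma hol_cprod (r : R) (u : nat -> C -> C) (n : nat) :
  (forall k, (k < n)%nat -> hol r (u k)) -> hol r (fun z => cprod (fun k => u k z) n).
Proof.
  induction n as [|n IH]; intros H; simpl; [apply hol_const|].
  apply hol_mult; [apply IH; intros|]; apply H; lia.
Qed.

(** For [a < 1] the domain grows: a function on the unit disc becomes holomorphic across the unit
    circle after dilation. *)
Lemma hol_scale (r a : R) (f : C -> C) :
  0 < a -> hol r f -> hol (r / a) (fun z => f (RtoC a * z)%C).
Proof.
  intros Ha Hf z Hz.
  destruct (Hf (RtoC a * z)%C) as [l Hl].
  { rewrite Cmod_mult, Cmod_R, Rabs_pos_eq by lra.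
    apply (Rmult_lt_reg_r (/ a)); [now apply Rinv_0_lt_compat|].
    replace (a * Cmod z * / a) with (Cmod z) by (field; lra). exact Hz. }
  eexists. apply (cder_comp f (fun z => (RtoC a * z)%C)); [exact Hl|].
  apply cder_linear.
Qed.

Lemma hol_le (r s : R) (f : C -> C) : s <= r -> hol r f -> hol s f.
Proof. intros H Hf z Hz. apply Hf. lra. Qed.

Lemma Cmod_le_abs (z : C) : Cmod z <= Rabs (Re z) + Rabs (Im z).
Proof.
  assert (H1 := Rabs_pos (Re z)). assert (H2 := Rabs_pos (Im z)).
  apply Rsqr_incr_0_var; [|lra]. unfold Rsqr.
  assert (H := Cmod_sqr z). rewrite <- (pow2_abs (Re z)), <- (pow2_abs (Im z)) in H. nra.
Qed.

Lemma im_le_Cmod (z : C) : Rabs (Im z) <= Cmod z.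
Proof. eapply Rle_trans; [apply Rmax_r|apply (Rmax_Cmod z)]. Qed.

Lemma cont_eps (f : R -> R) (x : R) :
  continuous f x <->
  forall eps, 0 < eps -> exists d, 0 < d /\
    forall y, Rabs (y - x) < d -> Rabs (f y - f x) < eps.
Proof.
  split.
  - intros H eps Heps. apply continuity_pt_filterlim in H.
    destruct (H eps Heps) as (d & Hd & D). exists d; split; auto.
    intros y Hy. destruct (Req_dec x y) as [->|N].
    + rewrite Rminus_diag, Rabs_R0; lra.
    + apply D. repeat split; auto.
  - intros H. apply continuity_pt_filterlim. intros eps Heps.
    destruct (H eps Heps) as (d & Hd & D). exists d; split; auto.
    intros y [_ Hy]. now apply D.
Qed.

Lemma ccont_eps (u : R -> C) :
  ccont u <-> forall x eps, 0 < eps -> exists d, 0 < d /\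
    forall y, Rabs (y - x) < d -> Cmod (u y - u x) < eps.
Proof.
  split.
  - intros [H1 H2] x eps Heps.
    destruct (proj1 (cont_eps _ x) (H1 x) (eps / 2)) as (d1 & Hd1 & D1); [lra|].
    destruct (proj1 (cont_eps _ x) (H2 x) (eps / 2)) as (d2 & Hd2 & D2); [lra|].
    exists (Rmin d1 d2); split; [now apply Rmin_glb_lt|]. intros y Hy.
    specialize (D1 y (Rlt_le_trans _ _ _ Hy (Rmin_l _ _))).
    specialize (D2 y (Rlt_le_trans _ _ _ Hy (Rmin_r _ _))).
    eapply Rle_lt_trans; [apply Cmod_le_abs|].
    change (Re (u y - u x)) with (Re (u y) - Re (u x)).
    change (Im (u y - u x)) with (Im (u y) - Im (u x)). lra.
  - intros H; split; intros x; apply cont_eps; intros eps Heps;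
      destruct (H x eps Heps) as (d & Hd & D); exists d; split; auto; intros y Hy;
      specialize (D y Hy); (eapply Rle_lt_trans; [|exact D]).
    + apply (re_le_Cmod (u y - u x)).
    + apply (im_le_Cmod (u y - u x)).
Qed.

Lemma ccont_cder (f : C -> C) (u : R -> C) :
  ccont u -> (forall t, exists l, cder f (u t) l) -> ccont (fun t => f (u t)).
Proof.
  intros Hu Hf. apply ccont_eps. intros x eps Heps.
  destruct (Hf x) as [l Hl].
  destruct (cder_continuous f (u x) l Hl eps Heps) as (d & Hd & D).
  destruct (proj1 (ccont_eps u) Hu x d Hd) as (d' & Hd' & D').
  exists d'; split; auto.
Qed.

Lemma ccont_hol (r : R) (f : C -> C) (u : R -> C) :
  hol r f -> ccont u -> (forall t, Cmod (u t) < r) -> ccont (fun t => f (u t)).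
Proof. intros Hf Hu H. apply ccont_cder; auto. Qed.

Lemma Cmod_polar (r t : R) : 0 <= r -> Cmod (polar r t) = r.
Proof.
  intros Hr. unfold Cmod, polar; simpl.
  replace (_ + _) with (r ^ 2 * ((sin t)² + (cos t)²)) by (unfold Rsqr; ring).
  rewrite sin2_cos2, Rmult_1_r. rewrite sqrt_pow2; auto.
Qed.

Lemma polar_scal (r t : R) : polar r t = (RtoC r * polar 1 t)%C.
Proof. unfold polar, RtoC, Cmult; simpl; f_equal; ring. Qed.

Lemma polar_conj (t : R) : (polar 1 t * Cconj (polar 1 t))%C = RtoC 1.
Proof.
  rewrite <- Cmod2_conj, Cmod_polar by lra. f_equal; ring.
Qed.

(** * Homotopy invariance and the Cauchy formula *)

(** The complex-valued version of [tot_diff]; real and imaginary parts of such maps are fed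
    separately to Goursat's lemma. *)
Definition ctd (F : R -> R -> C) (x y : R) (lx ly : C) : Prop :=
  forall eps, 0 < eps -> exists d, 0 < d /\
    forall u v, Rabs (u - x) < d -> Rabs (v - y) < d ->
      Cmod (F u v - F x y - (lx * RtoC (u - x) + ly * RtoC (v - y)))
      <= eps * (Rabs (u - x) + Rabs (v - y)).

Lemma ctd_Re (F : R -> R -> C) (x y : R) (lx ly : C) :
  ctd F x y lx ly -> tot_diff (fun u v => Re (F u v)) x y (Re lx) (Re ly).
Proof.
  intros H eps Heps. destruct (H eps Heps) as (d & Hd & D). exists d; split; auto.
  intros u v Hu Hv. eapply Rle_trans; [|apply (D u v Hu Hv)].
  eapply Rle_trans; [|apply re_le_Cmod]. apply Req_le. f_equal. unfold Re, Im; simpl. ring.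
Qed.

Lemma ctd_Im (F : R -> R -> C) (x y : R) (lx ly : C) :
  ctd F x y lx ly -> tot_diff (fun u v => Im (F u v)) x y (Im lx) (Im ly).
Proof.
  intros H eps Heps. destruct (H eps Heps) as (d & Hd & D). exists d; split; auto.
  intros u v Hu Hv. eapply Rle_trans; [|apply (D u v Hu Hv)].
  eapply Rle_trans; [|apply im_le_Cmod]. apply Req_le. f_equal. unfold Re, Im; simpl. ring.
Qed.

Lemma ctd_lipschitz (F : R -> R -> C) (x y : R) (lx ly : C) : ctd F x y lx ly ->
  exists A d, 0 < A /\ 0 < d /\ forall u v, Rabs (u - x) < d -> Rabs (v - y) < d ->
    Cmod (F u v - F x y) <= A * (Rabs (u - x) + Rabs (v - y)).
Proof.
  intros H. destruct (H 1 Rlt_0_1) as (d & Hd & D).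
  assert (H1 := Cmod_ge_0 lx). assert (H2 := Cmod_ge_0 ly).
  exists (Cmod lx + Cmod ly + 1), d; split; [lra|]; split; auto.
  intros u v Hu Hv. specialize (D u v Hu Hv).
  replace (F u v - F x y)%C with
    ((F u v - F x y - (lx * RtoC (u - x) + ly * RtoC (v - y)))
     + (lx * RtoC (u - x) + ly * RtoC (v - y)))%C by ring.
  eapply Rle_trans; [apply Cmod_triangle|].
  assert (T : Cmod (lx * RtoC (u - x) + ly * RtoC (v - y))
    <= Cmod lx * Rabs (u - x) + Cmod ly * Rabs (v - y)).
  { eapply Rle_trans; [apply Cmod_triangle|]. rewrite !Cmod_mult, !Cmod_R; lra. }
  generalize (Rabs_pos (u - x)) (Rabs_pos (v - y)). nra.
Qed.

Lemma ctd_comp (g : C -> C) (F : R -> R -> C) (x y : R) (l lx ly : C) :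
  cder g (F x y) l -> ctd F x y lx ly ->
  ctd (fun u v => g (F u v)) x y (l * lx)%C (l * ly)%C.
Proof.
  intros Hg HF eps Heps.
  destruct (ctd_lipschitz F x y lx ly HF) as (A & d0 & HA & Hd0 & D0).
  set (B := Cmod l + 1). assert (HB : 0 < B) by (unfold B; generalize (Cmod_ge_0 l); lra).
  destruct (Hg (eps / (2 * A))) as (d1 & Hd1 & D1); [apply Rdiv_lt_0_compat; lra|].
  destruct (HF (eps / (2 * B))) as (d2 & Hd2 & D2); [apply Rdiv_lt_0_compat; lra|].
  exists (Rmin (Rmin d0 d2) (d1 / (2 * A))); split.
  { repeat apply Rmin_glb_lt; auto. apply Rdiv_lt_0_compat; lra. }
  intros u v Hu Hv.
  assert (U1 := Rlt_le_trans _ _ _ Hu (Rmin_l _ _)).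
  assert (V1 := Rlt_le_trans _ _ _ Hv (Rmin_l _ _)).
  assert (U2 := Rlt_le_trans _ _ _ Hu (Rmin_r _ _)).
  assert (V2 := Rlt_le_trans _ _ _ Hv (Rmin_r _ _)).
  specialize (D0 u v (Rlt_le_trans _ _ _ U1 (Rmin_l _ _)) (Rlt_le_trans _ _ _ V1 (Rmin_l _ _))).
  specialize (D2 u v (Rlt_le_trans _ _ _ U1 (Rmin_r _ _)) (Rlt_le_trans _ _ _ V1 (Rmin_r _ _))).
  set (S := Rabs (u - x) + Rabs (v - y)) in *.
  assert (HAS : A * S < d1).
  { replace d1 with (A * (d1 / (2 * A) + d1 / (2 * A))) by (field; lra).
    apply Rmult_lt_compat_l; auto. unfold S; lra. }
  specialize (D1 (F u v) (Rle_lt_trans _ _ _ D0 HAS)).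
  replace (g (F u v) - g (F x y) - (l * lx * RtoC (u - x) + l * ly * RtoC (v - y)))%C with
    ((g (F u v) - g (F x y) - l * (F u v - F x y))
     + l * (F u v - F x y - (lx * RtoC (u - x) + ly * RtoC (v - y))))%C by ring.
  eapply Rle_trans; [apply Cmod_triangle|]. rewrite (Cmod_mult l).
  assert (T3 : eps / (2 * A) * Cmod (F u v - F x y) <= eps / 2 * S).
  { replace (eps / 2 * S) with (eps / (2 * A) * (A * S)) by (field; lra).
    apply Rmult_le_compat_l; auto. apply Rlt_le, Rdiv_lt_0_compat; lra. }
  assert (T4 : Cmod l * Cmod (F u v - F x y - (lx * RtoC (u - x) + ly * RtoC (v - y)))
     <= eps / 2 * S).
  { replace (eps / 2 * S) with (B * (eps / (2 * B) * S)) by (field; lra).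
    apply Rmult_le_compat; auto; try apply Cmod_ge_0. unfold B; lra. }
  lra.
Qed.

Lemma ctd_plus (F G : R -> R -> C) (x y : R) (lx ly mx my : C) :
  ctd F x y lx ly -> ctd G x y mx my ->
  ctd (fun u v => (F u v + G u v)%C) x y (lx + mx)%C (ly + my)%C.
Proof.
  intros HF HG eps Heps.
  destruct (HF (eps / 2)) as (d1 & Hd1 & D1); [lra|].
  destruct (HG (eps / 2)) as (d2 & Hd2 & D2); [lra|].
  exists (Rmin d1 d2); split; [now apply Rmin_glb_lt|]. intros u v Hu Hv.
  specialize (D1 u v (Rlt_le_trans _ _ _ Hu (Rmin_l _ _)) (Rlt_le_trans _ _ _ Hv (Rmin_l _ _))).
  specialize (D2 u v (Rlt_le_trans _ _ _ Hu (Rmin_r _ _)) (Rlt_le_trans _ _ _ Hv (Rmin_r _ _))).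
  replace (F u v + G u v - (F x y + G x y)
     - ((lx + mx) * RtoC (u - x) + (ly + my) * RtoC (v - y)))%C with
   ((F u v - F x y - (lx * RtoC (u - x) + ly * RtoC (v - y)))
    + (G u v - G x y - (mx * RtoC (u - x) + my * RtoC (v - y))))%C by ring.
  eapply Rle_trans; [apply Cmod_triangle|]. lra.
Qed.

Lemma ctd_ext (F G : R -> R -> C) (x y : R) (lx ly mx my : C) :
  (forall u v, F u v = G u v) -> lx = mx -> ly = my ->
  ctd F x y lx ly -> ctd G x y mx my.
Proof.
  intros E -> -> H eps Heps. destruct (H eps Heps) as (d & Hd & D).
  exists d; split; auto. intros u v Hu Hv. rewrite <- !E; auto.
Qed.

Lemma ctd_scal (c : C) (F : R -> R -> C) (x y : R) (lx ly : C) :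
  ctd F x y lx ly -> ctd (fun u v => (c * F u v)%C) x y (c * lx)%C (c * ly)%C.
Proof.
  intros H. apply (ctd_comp (fun z => (c * z)%C)); auto.
  apply cder_linear.
Qed.

(** By polarization from the squares, as in [cder_mult]. *)
Lemma ctd_mult (F G : R -> R -> C) (x y : R) (lx ly mx my : C) :
  ctd F x y lx ly -> ctd G x y mx my ->
  ctd (fun u v => (F u v * G u v)%C) x y
    (lx * G x y + F x y * mx)%C (ly * G x y + F x y * my)%C.
Proof.
  intros HF HG.
  assert (Hp := ctd_comp _ _ x y _ _ _ (cder_sqr _) (ctd_plus F G x y _ _ _ _ HF HG)).
  assert (Hf2 := ctd_comp _ _ x y _ _ _ (cder_sqr _) HF).
  assert (Hg2 := ctd_comp _ _ x y _ _ _ (cder_sqr _) HG).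
  assert (K := ctd_scal (/ 2) _ x y _ _ (ctd_plus _ _ x y _ _ _ _ Hp
     (ctd_scal (- (1)) _ x y _ _ (ctd_plus _ _ x y _ _ _ _ Hf2 Hg2)))).
  eapply ctd_ext; [| | |exact K]; intros; simpl; field; auto.
Qed.

Lemma ctd_const (c : C) (x y : R) : ctd (fun _ _ => c) x y 0 0.
Proof.
  intros eps Heps. exists 1; split; [lra|]. intros u v _ _.
  replace (c - c - (0 * RtoC (u - x) + 0 * RtoC (v - y)))%C with (RtoC 0) by ring.
  rewrite Cmod_0. generalize (Rabs_pos (u - x)) (Rabs_pos (v - y)); nra.
Qed.

Lemma ctd_fst (x y : R) : ctd (fun u _ => RtoC u) x y 1 0.
Proof.
  intros eps Heps. exists 1; split; [lra|]. intros u v _ _.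
  rewrite (RtoC_minus u x).
  replace (RtoC u - RtoC x - (1 * (RtoC u - RtoC x) + 0 * RtoC (v - y)))%C with (RtoC 0) by ring.
  rewrite Cmod_0. generalize (Rabs_pos (u - x)) (Rabs_pos (v - y)); nra.
Qed.

Lemma diff_eps (f : R -> R) (y l : R) : derivable_pt_lim f y l ->
  forall eps, 0 < eps -> exists d, 0 < d /\
   forall v, Rabs (v - y) < d -> Rabs (f v - f y - l * (v - y)) <= eps * Rabs (v - y).
Proof.
  intros H eps Heps. destruct (H eps Heps) as [d D]. exists d; split; [apply cond_pos|].
  intros v Hv. destruct (Req_dec v y) as [->|N].
  - rewrite !Rminus_diag, Rmult_0_r, Rminus_0_r, Rabs_R0. lra.
  - assert (N' : v - y <> 0) by lra. specialize (D (v - y) N' Hv).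
    replace (y + (v - y)) with v in D by ring.
    replace (f v - f y - l * (v - y)) with (((f v - f y) / (v - y) - l) * (v - y)) by (field; auto).
    rewrite Rabs_mult. apply Rmult_le_compat_r; [apply Rabs_pos|lra].
Qed.

Lemma ctd_polar (x y : R) : ctd (fun _ v => polar 1 v) x y 0 (Ci * polar 1 y)%C.
Proof.
  intros eps Heps.
  destruct (diff_eps cos y _ (derivable_pt_lim_cos y) (eps / 2)) as (d1 & Hd1 & D1); [lra|].
  destruct (diff_eps sin y _ (derivable_pt_lim_sin y) (eps / 2)) as (d2 & Hd2 & D2); [lra|].
  exists (Rmin d1 d2); split; [now apply Rmin_glb_lt|]. intros u v _ Hv.
  specialize (D1 v (Rlt_le_trans _ _ _ Hv (Rmin_l _ _))).
  specialize (D2 v (Rlt_le_trans _ _ _ Hv (Rmin_r _ _))).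
  eapply Rle_trans; [apply Cmod_le_abs|].
  replace (Re _) with (cos v - cos y - - sin y * (v - y)) by (simpl; ring).
  replace (Im _) with (sin v - sin y - cos y * (v - y)) by (simpl; ring).
  generalize (Rabs_pos (u - x)); nra.
Qed.

Section Homotopy.

Variables (g : C -> C) (w : C) (eta : R).

Let beta (t : R) : C := (RtoC eta + RtoC (1 - eta) * RtoC t)%C.
(** The circle of centre [(1 - t) w] and radius [eta + (1 - eta) t]: it moves from the small circle
    about [w] to the unit circle. [Phit] and [Phis] are its partial derivatives. *)
Let Phi (t s : R) : C := (w + (- w) * RtoC t + beta t * polar 1 s)%C.
Let Phit (s : R) : C := ((- w) + RtoC (1 - eta) * polar 1 s)%C.
Let Phis (t s : R) : C := (Ci * (beta t * polar 1 s))%C.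

Hypothesis Hg : forall t s, 0 <= t <= 1 -> exists l, cder g (Phi t s) l.

Let ctd_beta (x y : R) : ctd (fun t _ => beta t) x y (RtoC (1 - eta)) 0.
Proof.
  eapply ctd_ext; [| | |apply (ctd_plus (fun _ _ => RtoC eta) _ _ _ _ _ _ _
     (ctd_const (RtoC eta) x y) (ctd_scal (RtoC (1 - eta)) _ _ _ _ _ (ctd_fst x y)))];
    intros; unfold beta; simpl; ring.
Qed.

Let ctd_be (x y : R) : ctd (fun t s => (beta t * polar 1 s)%C) x y
  (RtoC (1 - eta) * polar 1 y)%C (Phis x y).
Proof.
  eapply ctd_ext; [| | |apply (ctd_mult _ _ _ _ _ _ _ _ (ctd_beta x y) (ctd_polar x y))];
    intros; unfold Phis; simpl; ring.
Qed.

Let ctd_Phi (x y : R) : ctd Phi x y (Phit y) (Phis x y).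
Proof.
  eapply ctd_ext; [| | |apply (ctd_plus _ _ _ _ _ _ _ _ (ctd_plus _ _ _ _ _ _ _ _
     (ctd_const w x y) (ctd_scal (- w) _ _ _ _ _ (ctd_fst x y))) (ctd_be x y))];
    intros; unfold Phi, Phit; simpl; ring.
Qed.

Let ctd_Phit (x y : R) : ctd (fun _ s => Phit s) x y 0 (Ci * (RtoC (1 - eta) * polar 1 y))%C.
Proof.
  eapply ctd_ext; [| | |apply (ctd_plus _ _ _ _ _ _ _ _ (ctd_const (- w) x y)
      (ctd_scal (RtoC (1 - eta)) _ _ _ _ _ (ctd_polar x y)))];
    intros; unfold Phit; simpl; ring.
Qed.

Let ctd_Phis (x y : R) : ctd Phis x y (Ci * (RtoC (1 - eta) * polar 1 y))%C (Ci * Phis x y)%C.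
Proof. apply ctd_scal, ctd_be. Qed.

Let period (x : R) : (g (Phi x 0) * Phit 0)%C = (g (Phi x (2 * PI)) * Phit (2 * PI))%C.
Proof.
  unfold Phi, Phit, polar. now rewrite cos_2PI, sin_2PI, cos_0, sin_0.
Qed.

(** The pullback of [g dz] under [Phi] has the coefficients [g(Phi) Phit] and [g(Phi) Phis]. It is
    closed because the mixed second derivatives of [Phi] agree, and it is [2 PI]-periodic in [s]. *)
Lemma cmean_homotopy :
  cmean (fun s => (g (Phi 1 s) * Phis 1 s)%C) = cmean (fun s => (g (Phi 0 s) * Phis 0 s)%C).
Proof.
  assert (H : forall x y, 0 <= x <= 1 -> exists px k qy,
    ctd (fun t s => (g (Phi t s) * Phit s)%C) x y px k /\
    ctd (fun t s => (g (Phi t s) * Phis t s)%C) x y k qy).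
  { intros x y Hx. destruct (Hg x y Hx) as [l Hl].
    assert (Hc := ctd_comp g Phi x y l _ _ Hl (ctd_Phi x y)).
    assert (H1 := ctd_mult _ _ _ _ _ _ _ _ Hc (ctd_Phit x y)).
    assert (H2 := ctd_mult _ _ _ _ _ _ _ _ Hc (ctd_Phis x y)).
    do 3 eexists; split; [exact H1|].
    eapply ctd_ext; [| | |exact H2]; [reflexivity| |reflexivity]. simpl; ring. }
  unfold cmean, rmean. f_equal; f_equal.
  - apply (closed_form_period (fun t s => Re (g (Phi t s) * Phit s)%C)
      (fun t s => Re (g (Phi t s) * Phis t s)%C)); [apply two_PI_pos| |].
    + intros x y Hx _. destruct (H x y Hx) as (px & k & qy & A & B).
      exists (Re px), (Re k), (Re qy). split; now apply ctd_Re.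
    + intros x _. now rewrite period.
  - apply (closed_form_period (fun t s => Im (g (Phi t s) * Phit s)%C)
      (fun t s => Im (g (Phi t s) * Phis t s)%C)); [apply two_PI_pos| |].
    + intros x y Hx _. destruct (H x y Hx) as (px & k & qy & A & B).
      exists (Im px), (Im k), (Im qy). split; now apply ctd_Im.
    + intros x _. now rewrite period.
Qed.

End Homotopy.

Lemma Cmod_minus_ge (a b : C) : Cmod a - Cmod b <= Cmod (a - b).
Proof.
  assert (H := Cmod_triangle (a - b) b).
  replace (a - b + b)%C with a in H by ring. lra.
Qed.

Lemma Cmod_1_minus_ge (a : C) : 1 - Cmod a <= Cmod (1 - a).
Proof. rewrite <- Cmod_1 at 1. apply Cmod_minus_ge. Qed.

Lemma Cmod_RtoC_pos (x : R) : 0 <= x -> Cmod (RtoC x) = x.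
Proof. intros. now rewrite Cmod_R, Rabs_pos_eq. Qed.

Lemma Cmod_unit (t : R) : Cmod (polar 1 t) = 1.
Proof. apply Cmod_polar; lra. Qed.

Lemma polar_neq_0 (t : R) : polar 1 t <> RtoC 0.
Proof. apply Cmod_gt_0. rewrite Cmod_unit; lra. Qed.

Lemma polar_conj_inv (t : R) : Cconj (polar 1 t) = (/ polar 1 t)%C.
Proof.
  assert (N := polar_neq_0 t).
  replace (Cconj (polar 1 t)) with (polar 1 t * Cconj (polar 1 t) / polar 1 t)%C
    by (field; auto).
  rewrite polar_conj. field; auto.
Qed.

Lemma kernel_ge (w : C) (t : R) : 1 - Cmod w <= Cmod (1 - w * Cconj (polar 1 t)).
Proof.
  eapply Rle_trans; [|apply Cmod_1_minus_ge].
  rewrite Cmod_mult, Cmod_conj, Cmod_unit. lra.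
Qed.

Lemma kernel_neq_0 (w : C) (t : R) :
  Cmod w < 1 -> (1 - w * Cconj (polar 1 t))%C <> RtoC 0.
Proof. intros H. apply Cmod_gt_0. generalize (kernel_ge w t). lra. Qed.

Lemma Ci_neq_0 : Ci <> RtoC 0.
Proof. apply Cmod_gt_0. rewrite Cmod_Ci; lra. Qed.

Lemma ccont_unit_hol (r : R) (f : C -> C) :
  1 < r -> hol r f -> ccont (fun t => f (polar 1 t)).
Proof.
  intros Hr Hf. apply (ccont_hol r); auto with cont.
  intros; rewrite Cmod_unit; lra.
Qed.

Lemma ccont_kernel (w : C) : ccont (fun t => (1 - w * Cconj (polar 1 t))%C).
Proof. auto with cont. Qed.
#[export] Hint Resolve ccont_kernel : cont.

(** On the circle [1 - w * conj u = (u - w) / u], so the mean is the Cauchy integral over the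
    circle. It is deformed to a circle of radius [eta] about [w], where continuity of [f] makes it
    as close to [f w] as desired. *)
Lemma Cauchy_formula (r : R) (f : C -> C) (w : C) :
  1 < r -> hol r f -> Cmod w < 1 ->
  cmean (fun t => (f (polar 1 t) / (1 - w * Cconj (polar 1 t)))%C) = f w.
Proof.
  intros Hr Hf Hw.
  set (g := fun z => (f z * / (z - w))%C).
  assert (H : forall eta, 0 < eta <= 1 - Cmod w ->
    cmean (fun t => (f (polar 1 t) / (1 - w * Cconj (polar 1 t)))%C)
    = cmean (fun t => f (w + RtoC eta * polar 1 t)%C)).
  { intros eta Heta.
    assert (K := cmean_homotopy g w eta). cbv beta zeta in K.
    (* The condition [eta <= 1 - |w|] keeps the moving circle in the closed unit disc and at
       distance at least [eta] from [w]. *)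
    assert (Hphi : forall t s, 0 <= t <= 1 ->
      let z := (w + - w * RtoC t + (RtoC eta + RtoC (1 - eta) * RtoC t) * polar 1 s)%C in
      Cmod z < r /\ (z - w)%C <> RtoC 0).
    { intros t s Ht z.
      assert (Hb : Cmod ((RtoC eta + RtoC (1 - eta) * RtoC t) * polar 1 s) = eta + (1 - eta) * t).
      { rewrite Cmod_mult, Cmod_unit, Rmult_1_r, <- RtoC_mult, <- RtoC_plus, Cmod_RtoC_pos; auto.
        generalize (Cmod_ge_0 w); nra. }
      split.
      - unfold z. eapply Rle_lt_trans; [apply Cmod_triangle|]. rewrite Hb.
        replace (w + - w * RtoC t)%C with (RtoC (1 - t) * w)%C by (rewrite RtoC_minus; ring).
        rewrite Cmod_mult, Cmod_RtoC_pos by lra. nra.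
      - apply Cmod_gt_0.
        replace (z - w)%C with ((RtoC eta + RtoC (1 - eta) * RtoC t) * polar 1 s - RtoC t * w)%C
          by (unfold z; ring).
        eapply Rlt_le_trans; [|apply Cmod_minus_ge]. rewrite Hb, Cmod_mult, Cmod_RtoC_pos by lra.
        generalize (Cmod_ge_0 w); nra. }
    rewrite (cmean_ext _ (fun t => (Ci * (f (polar 1 t) / (1 - w * Cconj (polar 1 t))))%C)) in K.
    2:{ intros t. unfold g. assert (N := polar_neq_0 t).
        assert (N2 := kernel_neq_0 w t Hw). rewrite polar_conj_inv in *.
        replace (w + - w * RtoC 1 + (RtoC eta + RtoC (1 - eta) * RtoC 1) * polar 1 t)%C
          with (polar 1 t) by (rewrite RtoC_minus; ring).
        replace ((RtoC eta + RtoC (1 - eta) * RtoC 1))%C with (RtoC 1) by (rewrite RtoC_minus; ring).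
        assert (N3 : (polar 1 t - w)%C <> RtoC 0).
        { intros E. apply N2. replace w with (polar 1 t - (polar 1 t - w))%C by ring.
          rewrite E. field; auto. }
        field; repeat split; auto. }
    rewrite (cmean_ext (fun s => (g _ * _)%C) (fun t => (Ci * f (w + RtoC eta * polar 1 t))%C)) in K.
    2:{ intros t. unfold g. assert (N := polar_neq_0 t).
        replace (w + - w * RtoC 0 + (RtoC eta + RtoC (1 - eta) * RtoC 0) * polar 1 t)%C
          with (w + RtoC eta * polar 1 t)%C by ring.
        replace ((RtoC eta + RtoC (1 - eta) * RtoC 0))%C with (RtoC eta) by ring.
        assert (RtoC eta <> RtoC 0) by (intros E; apply RtoC_inj in E; lra).
        field. replace (w + RtoC eta * polar 1 t - w)%C with (RtoC eta * polar 1 t)%C by ring.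
        now apply Cmult_neq_0. }
    assert (C1 : ccont (fun t => (f (polar 1 t) / (1 - w * Cconj (polar 1 t)))%C)).
    { apply ccont_div; auto with cont; [now apply (ccont_unit_hol r)|].
      intros; now apply kernel_neq_0. }
    assert (C2 : ccont (fun t => f (w + RtoC eta * polar 1 t)%C)).
    { apply (ccont_hol r); auto with cont. intros t.
      eapply Rle_lt_trans; [apply Cmod_triangle|]. rewrite Cmod_mult, Cmod_unit, Cmod_RtoC_pos; lra. }
    rewrite !cmean_scal in K by auto.
    assert (NI := Ci_neq_0).
    transitivity (/ Ci * (Ci * cmean (fun t => (f (polar 1 t) / (1 - w * Cconj (polar 1 t)))%C)))%C;
      [field; auto|].
    rewrite K; [field; auto|].
    intros t s Ht. destruct (Hphi t s Ht) as [A B]. cbv zeta in A, B.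
    destruct (Hf _ A) as [l Hl]. eexists. unfold g.
    apply cder_mult; [exact Hl|]. apply (cder_inv (fun z => (z - w)%C)); auto.
    apply (cder_plus (fun z => z) (fun _ => (- w)%C)); [apply cder_id|apply cder_const]. }
  set (I := cmean _) in *.
  destruct (Req_dec (Cmod (I - f w)) 0) as [E|E].
  { apply Cmod_eq_0 in E. replace I with ((I - f w) + f w)%C by ring. rewrite E; ring. }
  exfalso. assert (P : 0 < Cmod (I - f w)) by (generalize (Cmod_ge_0 (I - f w)); lra).
  destruct (Hf w) as [l Hl]; [lra|].
  destruct (cder_continuous f w l Hl (Cmod (I - f w) / 2)) as (d & Hd & D); [lra|].
  set (eta := Rmin (d / 2) (1 - Cmod w)).
  assert (He : 0 < eta) by (apply Rmin_glb_lt; lra).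
  assert (He1 : eta <= d / 2) by apply Rmin_l. assert (He2 : eta <= 1 - Cmod w) by apply Rmin_r.
  assert (C2 : ccont (fun t => f (w + RtoC eta * polar 1 t)%C)).
  { apply (ccont_hol r); auto with cont. intros t.
    eapply Rle_lt_trans; [apply Cmod_triangle|]. rewrite Cmod_mult, Cmod_unit, Cmod_RtoC_pos; lra. }
  assert (K : Cmod (I - f w) <= Cmod (I - f w) / 2); [|lra].
  rewrite (H eta) at 1 by lra. rewrite <- (cmean_const (f w)) at 1.
  rewrite <- cmean_minus by auto with cont.
  eapply Rle_trans; [apply Cmod_cmean_le; auto with cont|].
  apply rmean_le_const; auto with cont. intros t. apply Rlt_le, D.
  replace (w + RtoC eta * polar 1 t - w)%C with (RtoC eta * polar 1 t)%C by ring.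
  rewrite Cmod_mult, Cmod_unit, Cmod_RtoC_pos; lra.
Qed.

(** * The derivative as a Cauchy integral *)

(** The Cauchy formula differentiated in [w] under the integral sign. Size and continuity of the
    derivative are read off from this expression. *)
Definition dkernel_mean (f : C -> C) (w : C) : C :=
  cmean (fun t => (f (polar 1 t) * (Cconj (polar 1 t)
     / ((1 - w * Cconj (polar 1 t)) * (1 - w * Cconj (polar 1 t)))))%C).

Lemma ccont_dkernel (r : R) (f : C -> C) (w : C) : 1 < r -> hol r f -> Cmod w < 1 ->
  ccont (fun t => (f (polar 1 t) * (Cconj (polar 1 t)
     / ((1 - w * Cconj (polar 1 t)) * (1 - w * Cconj (polar 1 t)))))%C).
Proof.
  intros Hr Hf Hw. apply ccont_mult; [now apply (ccont_unit_hol r)|].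
  apply ccont_div; auto with cont.
  intros t. apply Cmult_neq_0; now apply kernel_neq_0.
Qed.

Lemma Cmod_div_le (a b : C) (x y : R) : Cmod a <= x -> 0 < y -> y <= Cmod b ->
  Cmod (a / b) <= x / y.
Proof.
  intros Ha Hy Hb. rewrite Cmod_div by (apply Cmod_gt_0; lra).
  unfold Rdiv. apply Rmult_le_compat; auto; try apply Cmod_ge_0.
  - apply Rlt_le, Rinv_0_lt_compat; lra.
  - now apply Rinv_le_contravar.
Qed.

Lemma Cmod_dkernel_mean_le (r e : R) (f : C -> C) (w : C) :
  1 < r -> hol r f -> Cmod w < 1 -> (forall t, Cmod (f (polar 1 t)) <= e) ->
  Cmod (dkernel_mean f w) <= e / (1 - Cmod w) ^ 2.
Proof.
  intros Hr Hf Hw He.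
  assert (Hc := ccont_dkernel r f w Hr Hf Hw).
  eapply Rle_trans; [apply Cmod_cmean_le; auto|].
  apply rmean_le_const; auto with cont. intros t. rewrite Cmod_mult.
  unfold Rdiv. apply Rmult_le_compat; auto; try apply Cmod_ge_0.
  replace (/ (1 - Cmod w) ^ 2) with (1 / (1 - Cmod w) ^ 2) by (field; lra).
  apply Cmod_div_le; [rewrite Cmod_conj, Cmod_unit; lra|apply pow_lt; lra|].
  rewrite Cmod_mult. assert (K := kernel_ge w t). nra.
Qed.

Lemma cmean_scal_bound (r c : R) (f : C -> C) (q : R -> C) :
  1 < r -> hol r f -> ccont q -> (forall t, Cmod (q t) <= c) ->
  Cmod (cmean (fun t => (f (polar 1 t) * q t)%C))
    <= c * rmean (fun t => Cmod (f (polar 1 t))).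
Proof.
  intros Hr Hf Hq H. assert (Hc := ccont_unit_hol r f Hr Hf).
  eapply Rle_trans; [apply Cmod_cmean_le; auto with cont|].
  rewrite <- rmean_scal by auto with cont. apply rmean_le; auto with cont.
  intros t. rewrite Cmod_mult, Rmult_comm. apply Rmult_le_compat_r; auto. apply Cmod_ge_0.
Qed.

Lemma near_in_disc (w y : C) : Cmod w < 1 -> Cmod (y - w) < (1 - Cmod w) / 2 ->
  (1 - Cmod w) / 2 <= 1 - Cmod y.
Proof.
  intros Hw Hy. assert (Cmod y <= Cmod w + Cmod (y - w)); [|lra].
  replace y with (w + (y - w))%C at 1 by ring. apply Cmod_triangle.
Qed.

(** The remainder is explicit: the kernel at [y] minus its linearization at [w] is [(y - w)^2 (conj
    u)^2 / ((1 - y conj u) (1 - w conj u)^2)]. *)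
Lemma Cauchy_derivative (r : R) (f : C -> C) (w : C) :
  1 < r -> hol r f -> Cmod w < 1 -> cder f w (dkernel_mean f w).
Proof.
  intros Hr Hf Hw eps Heps.
  (* For [|y - w| < a] each of the factors in the denominator has modulus at least [a]. *)
  remember ((1 - Cmod w) / 2) as a eqn:Ea. assert (Ha : 0 < a) by lra.
  set (M := rmean (fun t => Cmod (f (polar 1 t)))).
  assert (Hc := ccont_unit_hol r f Hr Hf).
  assert (HM : 0 <= M) by (apply rmean_ge_0; auto with cont; intros; apply Cmod_ge_0).
  set (K := M / (a * (a * a))).
  assert (P3 : 0 < a * (a * a)) by (repeat apply Rmult_lt_0_compat; auto).
  assert (HK : 0 <= K) by (apply Rmult_le_pos; [auto|apply Rlt_le, Rinv_0_lt_compat; auto]).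
  exists (Rmin a (eps / (K + 1))). split.
  { apply Rmin_glb_lt; auto. apply Rdiv_lt_0_compat; lra. }
  intros y Hy.
  assert (T1 := Rlt_le_trans _ _ _ Hy (Rmin_l _ _)).
  assert (T2 := Rlt_le_trans _ _ _ Hy (Rmin_r _ _)).
  assert (Hya : a <= 1 - Cmod y) by (rewrite Ea in T1 |- *; now apply near_in_disc).
  assert (Hy1 : Cmod y < 1) by lra.
  rewrite <- (Cauchy_formula r f y), <- (Cauchy_formula r f w) by auto.
  assert (C1 : forall v, Cmod v < 1 ->
    ccont (fun t => (f (polar 1 t) / (1 - v * Cconj (polar 1 t)))%C)).
  { intros v Hv. apply ccont_div; auto with cont. intros; now apply kernel_neq_0. }
  assert (C2 := ccont_dkernel r f w Hr Hf Hw).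
  unfold dkernel_mean. rewrite (Cmult_comm (cmean _)).
  rewrite <- cmean_scal, <- !cmean_minus by auto with cont.
  rewrite (cmean_ext _ (fun t => (f (polar 1 t) * ((y - w) * (y - w) * (Cconj (polar 1 t) * Cconj (polar 1 t))
     / ((1 - y * Cconj (polar 1 t)) * ((1 - w * Cconj (polar 1 t)) * (1 - w * Cconj (polar 1 t))))))%C)).
  2:{ intros t. assert (N1 := kernel_neq_0 y t Hy1). assert (N2 := kernel_neq_0 w t Hw).
      field; auto. }
  eapply Rle_trans.
  - apply (cmean_scal_bound r (Cmod (y - w) * Cmod (y - w) / (a * (a * a)))); auto.
    + apply ccont_div; auto with cont. intros t. repeat apply Cmult_neq_0; now apply kernel_neq_0.
    + intros t. apply Cmod_div_le; auto.
      * rewrite !Cmod_mult, !Cmod_conj, !Cmod_unit. lra.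
      * rewrite !Cmod_mult. assert (Q1 := kernel_ge y t). assert (Q2 := kernel_ge w t).
        repeat (apply Rmult_le_compat; try (apply Rmult_le_pos); try lra).
  - fold M. replace (Cmod (y - w) * Cmod (y - w) / (a * (a * a)) * M)
      with (K * Cmod (y - w) * Cmod (y - w)) by (unfold K; field; lra).
    apply Rmult_le_compat_r; [apply Cmod_ge_0|].
    assert (Cmod (y - w) * (K + 1) <= eps).
    { apply (Rmult_le_reg_r (/ (K + 1))); [apply Rinv_0_lt_compat; lra|].
      rewrite Rmult_assoc, Rinv_r by lra. unfold Rdiv in T2; lra. }
    generalize (Cmod_ge_0 (y - w)). lra.
Qed.

Lemma dkernel_mean_continuous (r : R) (f : C -> C) (w : C) (eps : R) :
  1 < r -> hol r f -> Cmod w < 1 -> 0 < eps ->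
  exists d, 0 < d /\ forall y, Cmod (y - w) < d ->
    Cmod (dkernel_mean f y - dkernel_mean f w) < eps.
Proof.
  intros Hr Hf Hw Heps.
  remember ((1 - Cmod w) / 2) as a eqn:Ea. assert (Ha : 0 < a) by lra.
  set (M := rmean (fun t => Cmod (f (polar 1 t)))).
  assert (Hc := ccont_unit_hol r f Hr Hf).
  assert (HM : 0 <= M) by (apply rmean_ge_0; auto with cont; intros; apply Cmod_ge_0).
  assert (P4 : 0 < (a * a) * (a * a)) by (repeat apply Rmult_lt_0_compat; auto).
  set (K := 4 * M / ((a * a) * (a * a))).
  assert (HK : 0 <= K) by (apply Rmult_le_pos; [lra|apply Rlt_le, Rinv_0_lt_compat; auto]).
  exists (Rmin a (eps / (K + 1))). split.
  { apply Rmin_glb_lt; auto. apply Rdiv_lt_0_compat; lra. }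
  intros y Hy.
  assert (T1 := Rlt_le_trans _ _ _ Hy (Rmin_l _ _)).
  assert (T2 := Rlt_le_trans _ _ _ Hy (Rmin_r _ _)).
  assert (Hya : a <= 1 - Cmod y) by (rewrite Ea in T1 |- *; now apply near_in_disc).
  assert (Hy1 : Cmod y < 1) by lra.
  assert (C1 := ccont_dkernel r f y Hr Hf Hy1).
  assert (C2 := ccont_dkernel r f w Hr Hf Hw).
  unfold dkernel_mean. rewrite <- cmean_minus by auto.
  rewrite (cmean_ext _ (fun t => (f (polar 1 t) * (((y - w) * (Cconj (polar 1 t) * Cconj (polar 1 t))
     * (2 - (y + w) * Cconj (polar 1 t)))
     / (((1 - y * Cconj (polar 1 t)) * (1 - y * Cconj (polar 1 t)))
        * ((1 - w * Cconj (polar 1 t)) * (1 - w * Cconj (polar 1 t))))))%C)).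
  2:{ intros t. assert (N1 := kernel_neq_0 y t Hy1). assert (N2 := kernel_neq_0 w t Hw).
      field; auto. }
  eapply Rle_lt_trans.
  - apply (cmean_scal_bound r (Cmod (y - w) * 4 / ((a * a) * (a * a)))); auto.
    + apply ccont_div; auto 10 with cont. intros t. repeat apply Cmult_neq_0; now apply kernel_neq_0.
    + intros t. apply Cmod_div_le; auto.
      * rewrite !Cmod_mult, !Cmod_conj, !Cmod_unit. rewrite !Rmult_1_r.
        apply Rmult_le_compat_l; [apply Cmod_ge_0|].
        eapply Rle_trans; [apply Cmod_triangle|].
        rewrite Cmod_opp, Cmod_mult, Cmod_conj, Cmod_unit, Cmod_RtoC_pos by lra.
        assert (Q := Cmod_triangle y w). lra.
      * rewrite !Cmod_mult. assert (Q1 := kernel_ge y t). assert (Q2 := kernel_ge w t).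
        repeat (apply Rmult_le_compat; try (apply Rmult_le_pos); try lra).
  - fold M. replace (Cmod (y - w) * 4 / (a * a * (a * a)) * M)
      with (K * Cmod (y - w)) by (unfold K; field; lra).
    assert (Cmod (y - w) * (K + 1) < eps).
    { apply (Rmult_lt_reg_r (/ (K + 1))); [apply Rinv_0_lt_compat; lra|].
      rewrite Rmult_assoc, Rinv_r by lra. unfold Rdiv in T2; lra. }
    generalize (Cmod_ge_0 (y - w)). lra.
Qed.

Lemma ccont_dkernel_mean (r : R) (f : C -> C) (u : R -> C) :
  1 < r -> hol r f -> ccont u -> (forall t, Cmod (u t) < 1) ->
  ccont (fun t => dkernel_mean f (u t)).
Proof.
  intros Hr Hf Hu H. apply ccont_eps. intros x eps Heps.
  destruct (dkernel_mean_continuous r f (u x) eps) as (d & Hd & D); auto.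
  destruct (proj1 (ccont_eps u) Hu x d Hd) as (d' & Hd' & D').
  exists d'; split; auto.
Qed.

Lemma cder_C_derive (f : C -> C) (z : C) :
  holomorphic_on_disc f -> Cmod z < 1 -> cder f z (C_derive f z).
Proof.
  intros Hf Hz. destruct (Hf z Hz) as [l Hl].
  rewrite (is_C_derive_unique f z l Hl). now apply is_derive_cder.
Qed.

Lemma holomorphic_hol (f : C -> C) : holomorphic_on_disc f -> hol 1 f.
Proof. intros Hf z Hz. eexists; now apply cder_C_derive. Qed.

Lemma C_derive_dkernel_mean (a : R) (f : C -> C) (w : C) :
  0 < a < 1 -> holomorphic_on_disc f -> Cmod w < 1 ->
  dkernel_mean (fun z => f (RtoC a * z)%C) w = (C_derive f (RtoC a * w) * RtoC a)%C.
Proof.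
  intros Ha Hf Hw.
  apply (cder_unique (fun z => f (RtoC a * z)%C) w).
  - apply (Cauchy_derivative (1 / a)); auto.
    + apply (Rmult_lt_reg_r a); [lra|]. replace (1 / a * a) with 1 by (field; lra). lra.
    + apply hol_scale; [lra|]. now apply holomorphic_hol.
  - apply (cder_comp f (fun z => (RtoC a * z)%C)); [|apply cder_linear].
    apply cder_C_derive; auto. rewrite Cmod_mult, Cmod_RtoC_pos by lra.
    generalize (Cmod_ge_0 w); nra.
Qed.

Lemma inv_gt_1 (a : R) : 0 < a < 1 -> 1 < 1 / a.
Proof.
  intros Ha. apply (Rmult_lt_reg_r a); [lra|].
  replace (1 / a * a) with 1 by (field; lra). lra.
Qed.

(** Needed for the integrals of [f'] over circles. Continuity is not part of holomorphy here; it
    comes from the Cauchy integral on an intermediate circle of radius [a]. *)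
Lemma ccont_C_derive (f : C -> C) (r : R) :
  holomorphic_on_disc f -> 0 < r < 1 -> ccont (fun t => C_derive f (polar r t)).
Proof.
  intros Hf Hr. set (a := (1 + r) / 2). assert (Ha : r < a < 1) by (unfold a; lra).
  assert (Hra : 0 < r / a < 1).
  { split; [apply Rdiv_lt_0_compat; lra|]. apply (Rmult_lt_reg_r a); [lra|].
    replace (r / a * a) with r by (field; lra). lra. }
  assert (Na : RtoC a <> RtoC 0) by (intros E; apply RtoC_inj in E; lra).
  apply (ccont_ext (fun t => (dkernel_mean (fun z => f (RtoC a * z)%C) (polar (r / a) t) * / RtoC a)%C)).
  - intros t. rewrite C_derive_dkernel_mean; auto; try lra.
    + replace (RtoC a * polar (r / a) t)%C with (polar r t).
      * field; auto.
      * rewrite (polar_scal r), (polar_scal (r / a)), RtoC_div by lra. field; auto.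
    + rewrite Cmod_polar; lra.
  - apply ccont_mult; auto with cont.
    apply (ccont_dkernel_mean (1 / a)); auto with cont.
    + apply inv_gt_1; lra.
    + apply hol_scale; [lra|]. now apply holomorphic_hol.
    + intros t. rewrite Cmod_polar; lra.
Qed.

(** * The Carleson embedding *)

(** The comparison is not strict, so [k = j] takes part: [x j / (1 + x j) = 1 - / (1 + x j)] makes
    the weighted sum telescope. Ties only decrease it. *)
Definition tail_weight (r x : nat -> R) (N j : nat) : R :=
  rprod (fun k => if Rle_dec (r j) (r k) then / (1 + x k) else 1) N.

(* Inserting the index [N] multiplies by [y = 1 / (1 + x N)] the terms with [r j <= r N] and adds
   the term [(1 - y) * tail_weight]; quantifying over the threshold [tau] closes the induction. *)
Lemma tail_weight_sum_threshold (r x : nat -> R) (N : nat) :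
  (forall k, 0 <= x k) -> forall tau,
  rsum (fun j => if Rlt_dec tau (r j) then x j * tail_weight r x N j else 0) N
  + rprod (fun k => if Rlt_dec tau (r k) then / (1 + x k) else 1) N <= 1.
Proof.
  intros Hx. induction N as [|N IH]; intros tau; [simpl; lra|].
  assert (Hy : forall k, 0 < / (1 + x k) <= 1).
  { intros k. generalize (Hx k); intros. split; [apply Rinv_0_lt_compat; lra|].
    rewrite <- Rinv_1. apply Rinv_le_contravar; lra. }
  assert (HxN : x N * / (1 + x N) = 1 - / (1 + x N)) by (generalize (Hx N); intros; field; lra).
  assert (HyN := Hy N).
  set (U := fun s => rsum (fun j => if Rlt_dec s (r j) then x j * tail_weight r x N j else 0) N) in *.
  set (W := fun s => rprod (fun k => if Rlt_dec s (r k) then / (1 + x k) else 1) N) in *.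
  assert (IHt := IH tau). assert (IHn := IH (r N)).
  cbn [rsum rprod]. set (y := / (1 + x N)) in *.
  change (rprod (fun k => if Rlt_dec tau (r k) then / (1 + x k) else 1) N) with (W tau).
  change (U tau + W tau <= 1) in IHt. change (U (r N) + W (r N) <= 1) in IHn.
  assert (E : forall j, tail_weight r x (S N) j
     = tail_weight r x N j * (if Rle_dec (r j) (r N) then y else 1)) by reflexivity.
  destruct (Rlt_dec tau (r N)) as [H|H].
  - rewrite (rsum_ext _ (fun j =>
      y * (if Rlt_dec tau (r j) then x j * tail_weight r x N j else 0)
      + (1 - y) * (if Rlt_dec (r N) (r j) then x j * tail_weight r x N j else 0))).
    2:{ intros j _. rewrite E.
        repeat (destruct Rlt_dec || destruct Rle_dec); try lra; try ring. }
    rewrite rsum_plus, !rsum_scal. fold (U tau) (U (r N)).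
    rewrite E. destruct (Rle_dec (r N) (r N)) as [_|]; [|lra].
    assert (HW : tail_weight r x N N <= W (r N)).
    { apply rprod_le. intros k _. generalize (Hy k).
      repeat (destruct Rlt_dec || destruct Rle_dec); lra. }
    replace (x N * (tail_weight r x N N * y)) with ((1 - y) * tail_weight r x N N)
      by (rewrite <- HxN; ring).
    nra.
  - rewrite (rsum_ext _ (fun j => if Rlt_dec tau (r j) then x j * tail_weight r x N j else 0)).
    2:{ intros j _. rewrite E.
        repeat (destruct Rlt_dec || destruct Rle_dec); try lra; try ring. }
    fold (U tau). lra.
Qed.

Lemma tail_weight_sum_le (r x : nat -> R) (N : nat) :
  (forall k, 0 <= x k) -> (forall k, 0 <= r k) ->
  rsum (fun j => x j * tail_weight r x N j) N <= 1.
Proof.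
  (* The threshold -1 lies below every [r j], so no term is discarded. *)
  intros Hx Hr. assert (H := tail_weight_sum_threshold r x N Hx (-1)).
  rewrite (rsum_ext _ (fun j => x j * tail_weight r x N j)) in H.
  2:{ intros j _. destruct Rlt_dec; auto. generalize (Hr j); lra. }
  assert (0 <= rprod (fun k => if Rlt_dec (-1) (r k) then / (1 + x k) else 1) N); [|lra].
  apply rprod_ge_0. intros k _. destruct Rlt_dec; [|lra].
  apply Rlt_le, Rinv_0_lt_compat. generalize (Hx k); lra.
Qed.

(** The Cayley transform maps the disc to the right half-plane; for [a = conj z * e^(it)] this real
    part is the Poisson kernel. *)
Lemma Re_cayley (a : C) : Cmod a < 1 ->
  Re ((1 + a) / (1 - a))%C = (1 - Cmod a ^ 2) / Cmod (1 - a) ^ 2.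
Proof.
  intros Ha. rewrite !Cmod_sqr. destruct a as [x y]; simpl.
  assert (H : (1 - x) ^ 2 + y ^ 2 <> 0).
  { intros E. assert (x = 1) by nra. assert (y = 0) by nra. subst.
    unfold Cmod in Ha; simpl in Ha. replace (1 * (1 * 1) + 0 * (0 * 1)) with 1 in Ha by ring.
    rewrite sqrt_1 in Ha. lra. }
  field. replace ((1 - x) * (1 - x) + (0 - y) * (0 - y)) with ((1 - x) ^ 2 + y ^ 2) by ring.
  repeat split; auto; contradict H; rewrite <- H; ring.
Qed.

Lemma Cmod_1_plus_sqr (q : C) : Cmod (1 + q) ^ 2 = 1 + 2 * Re q + Cmod q ^ 2.
Proof. rewrite !Cmod_sqr. destruct q; simpl; ring. Qed.

Lemma one_minus_Cconj_mult_sqr (a b : C) :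
  Cmod (1 - Cconj a * b) ^ 2 - Cmod (a - b) ^ 2 = (1 - Cmod a ^ 2) * (1 - Cmod b ^ 2).
Proof. rewrite !Cmod_sqr. destruct a, b; simpl; ring. Qed.

Lemma rprod_single (c : R) (j N : nat) : (j < N)%nat ->
  rprod (fun k => if Nat.eq_dec k j then c else 1) N = c.
Proof.
  intros Hj. assert (H : forall M, (M <= j)%nat ->
    rprod (fun k => if Nat.eq_dec k j then c else 1) M = 1).
  { induction M as [|M IH]; intros HM; simpl; auto.
    rewrite IH by lia. destruct Nat.eq_dec; [lia|ring]. }
  induction Hj as [|N Hj IH]; simpl.
  - rewrite H by lia. destruct Nat.eq_dec; [ring|lia].
  - rewrite IH. destruct Nat.eq_dec; [lia|ring].
Qed.

(** Finitely many kernels are holomorphic on a common disc larger than the unit disc. The radius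
    [2 / (1 + |z N|)] lies between 1 and [1 / |z N|] and makes sense for [z N = 0] as well. *)
Lemma exists_radius (z : nat -> C) (N : nat) : (forall k, Cmod (z k) < 1) ->
  exists r, 1 < r /\ forall k, (k < N)%nat -> r * Cmod (z k) <= 1.
Proof.
  intros Hz. induction N as [|N [r [Hr IH]]].
  - exists 2; split; [lra|]. intros; lia.
  - set (s := 2 / (1 + Cmod (z N))).
    assert (P := Cmod_ge_0 (z N)). assert (P1 := Hz N).
    assert (Hs : 1 < s).
    { apply (Rmult_lt_reg_r (1 + Cmod (z N))); [lra|]. unfold s.
      replace (2 / (1 + Cmod (z N)) * (1 + Cmod (z N))) with 2 by (field; lra). lra. }
    assert (Hs1 : s * Cmod (z N) <= 1).
    { apply (Rmult_le_reg_r (1 + Cmod (z N))); [lra|]. unfold s.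
      replace (2 / (1 + Cmod (z N)) * Cmod (z N) * (1 + Cmod (z N)))
        with (2 * Cmod (z N)) by (field; lra). lra. }
    exists (Rmin r s). split; [now apply Rmin_glb_lt|]. intros k Hk.
    destruct (Nat.eq_dec k N) as [->|].
    + eapply Rle_trans; [|exact Hs1]. apply Rmult_le_compat_r; auto. apply Rmin_r.
    + eapply Rle_trans; [|apply (IH k); lia]. apply Rmult_le_compat_r; [apply Cmod_ge_0|apply Rmin_l].
Qed.

(** * Pseudohyperbolic distance and Szego kernels *)

Definition pseudo_dist (a b : C) : R := Cmod ((a - b) / (RtoC 1 - Cconj a * b))%C.

Definition separation (z : nat -> C) (n N : nat) : R :=
  rprod (fun k => if Nat.eq_dec k n then 1 else pseudo_dist (z k) (z n)) N.

(** The reproducing kernel of H2 at [a], whose squared norm is [/ defect a] ([kernel_norm]). *)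
Definition kernel (a w : C) : C := (/ (1 - Cconj a * w))%C.

Definition defect (a : C) : R := 1 - Cmod a ^ 2.

Lemma defect_pos (a : C) : Cmod a < 1 -> 0 < defect a <= 1.
Proof.
  intros H. unfold defect. assert (P := Cmod_ge_0 a). split; nra.
Qed.

Lemma Cmod_conj_mult_lt (a w : C) (r : R) :
  0 < r -> r * Cmod a <= 1 -> Cmod w < r -> Cmod (Cconj a * w) < 1.
Proof.
  intros Hr Ha Hw. rewrite Cmod_mult, Cmod_conj.
  assert (P := Cmod_ge_0 a).
  destruct (Req_dec (Cmod a) 0) as [->|]; nra.
Qed.

Lemma one_minus_neq_0 (a : C) : Cmod a < 1 -> (1 - a)%C <> RtoC 0.
Proof. intros H. apply Cmod_gt_0. generalize (Cmod_1_minus_ge a); lra. Qed.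

Lemma hol_one_minus (r : R) (a : C) : hol r (fun w => (1 - Cconj a * w)%C).
Proof.
  apply hol_minus; [apply hol_const|]. apply hol_mult; [apply hol_const|apply hol_id].
Qed.

Lemma hol_kernel (r : R) (a : C) : 0 < r -> r * Cmod a <= 1 -> hol r (kernel a).
Proof.
  intros Hr Ha. apply hol_inv; [|apply hol_one_minus].
  intros w Hw. apply one_minus_neq_0. now apply (Cmod_conj_mult_lt a w r).
Qed.

Lemma Cconj_kernel (a w : C) : (1 - Cconj a * w)%C <> RtoC 0 ->
  Cconj (kernel a w) = (/ (1 - a * Cconj w))%C.
Proof.
  intros H. unfold kernel. rewrite Cinv_conj by auto.
  rewrite Cminus_conj, Cmult_conj, Cconj_conj. f_equal. f_equal.
  unfold Cconj; simpl. unfold RtoC. f_equal; ring.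
Qed.

Lemma one_minus_conj_polar (a : C) (t : R) : Cmod a < 1 ->
  (1 - Cconj a * polar 1 t)%C <> RtoC 0.
Proof.
  intros H. apply one_minus_neq_0. rewrite Cmod_mult, Cmod_conj, Cmod_unit. lra.
Qed.

Lemma ccont_kernel_unit (a : C) : Cmod a < 1 -> ccont (fun t => kernel a (polar 1 t)).
Proof.
  intros H. apply ccont_inv; auto with cont. intros; now apply one_minus_conj_polar.
Qed.
#[export] Hint Resolve ccont_kernel_unit : cont.

Lemma reproducing (r : R) (f : C -> C) (a : C) : 1 < r -> hol r f -> Cmod a < 1 ->
  cmean (fun t => (f (polar 1 t) * Cconj (kernel a (polar 1 t)))%C) = f a.
Proof.
  intros Hr Hf Ha. rewrite <- (Cauchy_formula r f a) by auto.
  apply cmean_ext. intros t. rewrite Cconj_kernel; [reflexivity|].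
  now apply one_minus_conj_polar.
Qed.

Lemma kernel_diag (a : C) : Cmod a < 1 -> kernel a a = RtoC (/ defect a).
Proof.
  intros Ha. unfold kernel. replace (1 - Cconj a * a)%C with (RtoC (defect a)).
  - rewrite RtoC_inv; auto. generalize (defect_pos a Ha); lra.
  - unfold defect. rewrite RtoC_minus, Cmod2_conj. ring.
Qed.

Lemma cmean_RtoC (f : R -> R) : cmean (fun t => RtoC (f t)) = RtoC (rmean f).
Proof. unfold cmean, RtoC; simpl. f_equal. apply rmean_const. Qed.

Lemma kernel_norm (a : C) : Cmod a < 1 ->
  rmean (fun t => Cmod (kernel a (polar 1 t)) ^ 2) = / defect a.
Proof.
  intros Ha. apply RtoC_inj. rewrite <- cmean_RtoC, <- kernel_diag by auto.
  assert (exists r, 1 < r /\ r * Cmod a <= 1) as (r & Hr & H).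
  { destruct (exists_radius (fun _ => a) 1) as (r & Hr & H); auto.
    exists r; split; auto. apply (H O); lia. }
  rewrite <- (reproducing r (kernel a) a) at 1; auto.
  - apply cmean_ext. intros; apply Cmod2_conj.
  - apply hol_kernel; auto; lra.
Qed.

Lemma pseudo_dist_le_1 (a b : C) : Cmod a < 1 -> Cmod b < 1 -> pseudo_dist a b <= 1.
Proof.
  intros Ha Hb. assert (I := one_minus_Cconj_mult_sqr a b).
  assert (Da := defect_pos _ Ha). assert (Db := defect_pos _ Hb).
  fold (defect a) (defect b) in I.
  assert (P : 0 < Cmod (1 - Cconj a * b)).
  { assert (H := Cmod_1_minus_ge (Cconj a * b)). rewrite Cmod_mult, Cmod_conj in H.
    generalize (Cmod_ge_0 a) (Cmod_ge_0 b). nra. }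
  unfold pseudo_dist. rewrite Cmod_div by now apply Cmod_gt_0.
  apply (Rmult_le_reg_r (Cmod (1 - Cconj a * b))); auto.
  unfold Rdiv. rewrite Rmult_assoc, Rinv_l by lra.
  generalize (Cmod_ge_0 (a - b)). nra.
Qed.

Section CarlesonEmbedding.

Variables (z : nat -> C) (N : nat) (delta : R).
Hypothesis Hz : forall k, Cmod (z k) < 1.
Hypothesis Hdelta : 0 < delta.
Hypothesis Hsep : forall n, (n < N)%nat -> delta <= separation z n N.

Let q (k : nat) (w : C) : C :=
  (RtoC (defect (z k) / 2) * ((1 + Cconj (z k) * w) / (1 - Cconj (z k) * w)))%C.

(* Only [Re (q k)] matters on the circle, where [2 * Re (q k)] is the weight [x k] below; at [z j] the
   remaining term [|q k|^2] is harmless because [defect (z k) <= defect (z j)] for the factors used. *)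
Let Phi (j : nat) (w : C) : C :=
  cprod (fun k => if Rle_dec (Cmod (z j)) (Cmod (z k)) then (/ (1 + q k w))%C else RtoC 1) N.

Let x (k : nat) (t : R) : R := defect (z k) ^ 2 * Cmod (kernel (z k) (polar 1 t)) ^ 2.

Let Re_q (k : nat) (w : C) : Cmod (Cconj (z k) * w) < 1 ->
  2 * Re (q k w) = defect (z k) * (1 - Cmod (Cconj (z k) * w) ^ 2) / Cmod (1 - Cconj (z k) * w) ^ 2.
Proof.
  intros H. unfold q. set (c := ((1 + _) / _)%C).
  replace (Re (RtoC (defect (z k) / 2) * c)) with (defect (z k) / 2 * Re c) by (simpl; unfold Re; ring).
  unfold c. rewrite Re_cayley by auto. field.
  assert (P := Cmod_1_minus_ge (Cconj (z k) * w)). lra.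
Qed.

Let Re_q_ge_0 (k : nat) (w : C) : Cmod (Cconj (z k) * w) < 1 -> 0 <= Re (q k w).
Proof.
  intros H. assert (E := Re_q k w H).
  assert (0 <= defect (z k) * (1 - Cmod (Cconj (z k) * w) ^ 2) / Cmod (1 - Cconj (z k) * w) ^ 2); [|lra].
  assert (P1 := defect_pos (z k) (Hz k)). assert (P2 := defect_pos _ H). unfold defect in P2.
  assert (P := Cmod_1_minus_ge (Cconj (z k) * w)).
  apply Rmult_le_pos; [apply Rmult_le_pos; lra|].
  apply Rlt_le, Rinv_0_lt_compat, pow_lt. lra.
Qed.

Let one_plus_q_ge (k : nat) (w : C) : Cmod (Cconj (z k) * w) < 1 -> 1 <= Cmod (1 + q k w).
Proof.
  intros H. assert (E := Cmod_1_plus_sqr (q k w)). assert (P := Re_q_ge_0 k w H).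
  assert (P3 := Cmod_ge_0 (1 + q k w)). nra.
Qed.

Let one_plus_q_neq_0 (k : nat) (w : C) : Cmod (Cconj (z k) * w) < 1 -> (1 + q k w)%C <> RtoC 0.
Proof. intros H. apply Cmod_gt_0. generalize (one_plus_q_ge k w H); lra. Qed.

Let hol_Phi (r : R) (j : nat) : 0 < r -> (forall k, (k < N)%nat -> r * Cmod (z k) <= 1) ->
  hol r (Phi j).
Proof.
  intros Hr H. unfold Phi.
  apply (hol_cprod r (fun k w => if Rle_dec (Cmod (z j)) (Cmod (z k)) then (/ (1 + q k w))%C else RtoC 1)).
  intros k Hk. destruct Rle_dec; [|apply hol_const].
  assert (Hlt : forall w, Cmod w < r -> Cmod (Cconj (z k) * w) < 1)
    by (intros; apply (Cmod_conj_mult_lt (z k) w r); auto).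
  apply hol_inv; [intros; apply one_plus_q_neq_0; auto|].
  apply hol_plus; [apply hol_const|]. unfold q.
  apply hol_mult; [apply hol_const|]. apply hol_mult.
  - apply hol_plus; [apply hol_const|]. apply hol_mult; [apply hol_const|apply hol_id].
  - apply hol_inv; [|apply hol_one_minus]. intros; apply one_minus_neq_0; auto.
Qed.

(** On the circle [|1 + q|^2 = 1 + 2 Re q + |q|^2 >= 1 + x]; dropping [|q|^2] goes in the right
    direction. *)
Let Phi_unit (j : nat) (t : R) :
  Cmod (Phi j (polar 1 t)) ^ 2 <= tail_weight (fun k => Cmod (z k)) (fun k => x k t) N j.
Proof.
  unfold Phi, tail_weight. rewrite Cmod_cprod.
  replace (rprod _ N ^ 2) with (rprod (fun k => Cmod (if Rle_dec (Cmod (z j)) (Cmod (z k))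
     then (/ (1 + q k (polar 1 t)))%C else RtoC 1) *
     Cmod (if Rle_dec (Cmod (z j)) (Cmod (z k)) then (/ (1 + q k (polar 1 t)))%C else RtoC 1)) N)
     by (rewrite rprod_mult; ring).
  apply rprod_le. intros k _. destruct Rle_dec; [|rewrite Cmod_1; lra].
  assert (H : Cmod (Cconj (z k) * polar 1 t) < 1) by (rewrite Cmod_mult, Cmod_conj, Cmod_unit, Rmult_1_r; auto).
  assert (P := one_plus_q_ge k _ H).
  rewrite Cmod_inv by auto. rewrite <- Rinv_mult. split.
  { apply Rlt_le, Rinv_0_lt_compat. nra. }
  assert (E : x k t = 2 * Re (q k (polar 1 t))).
  { rewrite Re_q by auto. unfold x, kernel. rewrite Cmod_inv by now apply one_minus_conj_polar.
    rewrite Cmod_mult, Cmod_conj, Cmod_unit, Rmult_1_r. fold (defect (z k)). field.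
    apply Rgt_not_eq, Cmod_gt_0, one_minus_conj_polar, Hz. }
  assert (Px : 0 <= x k t) by (rewrite E; generalize (Re_q_ge_0 k _ H); lra).
  apply Rinv_le_contravar; [lra|]. rewrite E.
  assert (E2 := Cmod_1_plus_sqr (q k (polar 1 t))).
  assert (P2 := pow2_ge_0 (Cmod (q k (polar 1 t)))). lra.
Qed.

(** With [gam = 1 - pseudo_dist^2], the ordering of the moduli yields [2 Re q <= 2 gam] and
    [|q|^2 <= gam], hence [|1 + q|^2 <= 1 + 3 gam]. The exponent 3 is what absorbs [3 gam] to first
    order. *)
Let factor_bound (j k : nat) : k <> j -> Cmod (z j) <= Cmod (z k) ->
  pseudo_dist (z k) (z j) ^ 3 <= Cmod (/ (1 + q k (z j))).
Proof.
  intros Hkj Hle. assert (Hzk := Hz k). assert (Hzj := Hz j).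
  assert (Pj := Cmod_ge_0 (z j)).
  assert (H : Cmod (Cconj (z k) * z j) < 1) by (rewrite Cmod_mult, Cmod_conj; nra).
  assert (P := one_plus_q_ge k _ H).
  rewrite Cmod_inv by now apply one_plus_q_neq_0.
  assert (Dk := defect_pos _ Hzk). assert (Dj := defect_pos _ Hzj).
  assert (I := one_minus_Cconj_mult_sqr (z k) (z j)). fold (defect (z k)) (defect (z j)) in I.
  assert (PA : 0 < Cmod (1 - Cconj (z k) * z j)).
  { generalize (Cmod_1_minus_ge (Cconj (z k) * z j)); lra. }
  set (A := Cmod (1 - Cconj (z k) * z j)) in *.
  set (gam := defect (z k) * defect (z j) / A ^ 2).
  assert (PA2 : 0 < A ^ 2) by (apply pow_lt; auto).
  assert (Ed : pseudo_dist (z k) (z j) ^ 2 = 1 - gam).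
  { unfold pseudo_dist. rewrite Cmod_div by (apply Cmod_gt_0; auto). fold A.
    unfold gam. rewrite <- I. field. lra. }
  assert (Pg : 0 <= gam).
  { unfold gam. apply Rmult_le_pos; [nra|]. now apply Rlt_le, Rinv_0_lt_compat. }
  assert (Hd : defect (z k) <= defect (z j)) by (unfold defect; nra).
  assert (R1 : 2 * Re (q k (z j)) <= 2 * gam).
  { rewrite Re_q by auto. fold A. unfold gam, Rdiv. rewrite <- Rmult_assoc.
    apply Rmult_le_compat_r; [now apply Rlt_le, Rinv_0_lt_compat|].
    assert (1 - Cmod (Cconj (z k) * z j) ^ 2 <= 2 * defect (z j)); [|nra].
    rewrite Cmod_mult, Cmod_conj, Rpow_mult_distr. unfold defect in *. nra. }
  assert (R2 : Cmod (q k (z j)) ^ 2 <= gam).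
  { unfold q. rewrite Cmod_mult, Cmod_RtoC_pos by lra.
    rewrite Cmod_div by (apply Cmod_gt_0; auto). fold A.
    assert (Q : Cmod (1 + Cconj (z k) * z j) <= 2).
    { eapply Rle_trans; [apply Cmod_triangle|]. rewrite Cmod_1; lra. }
    assert (Q0 := Cmod_ge_0 (1 + Cconj (z k) * z j)).
    replace ((defect (z k) / 2 * (Cmod (1 + Cconj (z k) * z j) / A)) ^ 2) with
     (defect (z k) ^ 2 * (Cmod (1 + Cconj (z k) * z j) ^ 2 / 4) * / A ^ 2) by (field; lra).
    unfold gam, Rdiv. apply Rmult_le_compat_r; [now apply Rlt_le, Rinv_0_lt_compat|].
    assert (Cmod (1 + Cconj (z k) * z j) ^ 2 * / 4 <= 1) by nra.
    nra. }
  assert (E := Cmod_1_plus_sqr (q k (z j))).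
  set (B := Cmod (1 + q k (z j))) in *.
  set (D := pseudo_dist (z k) (z j)) in *.
  assert (K : (D ^ 3 * B) ^ 2 <= 1 ^ 2).
  { replace ((D ^ 3 * B) ^ 2) with ((D ^ 2) ^ 3 * B ^ 2) by ring. rewrite Ed.
    (* The expansion is [1 - gam^2 (3 gam^2 - 8 gam + 6)], and completing the square shows that the
       quadratic is positive. *)
    assert ((1 - gam) ^ 3 * (1 + 3 * gam) <= 1).
    { replace ((1 - gam) ^ 3 * (1 + 3 * gam)) with
       (1 - gam ^ 2 * (3 * (gam - 4 / 3) ^ 2 + 2 / 3)) by field.
      assert (0 <= (gam - 4 / 3) ^ 2) by apply pow2_ge_0. nra. }
    nra. }
  assert (K2 : D ^ 3 * B <= 1).
  { apply Rsqr_incr_0_var; [|lra]. rewrite !Rsqr_pow2. exact K. }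
  apply (Rmult_le_reg_r B); [lra|]. rewrite Rinv_l by lra. exact K2.
Qed.

(** The factor [k = j] is at least 1/2 because [|q j (z j)| <= 1]. Every other factor, including
    those replaced by 1, is at least the cube of the pseudohyperbolic distance, whence the cube of
    [separation]. *)
Let Phi_diag (j : nat) : (j < N)%nat -> delta ^ 3 / 2 <= Cmod (Phi j (z j)).
Proof.
  intros Hj. unfold Phi. rewrite Cmod_cprod.
  apply Rle_trans with (rprod (fun k => (if Nat.eq_dec k j then / 2 else 1)
    * ((if Nat.eq_dec k j then 1 else pseudo_dist (z k) (z j))
    * ((if Nat.eq_dec k j then 1 else pseudo_dist (z k) (z j))
    * (if Nat.eq_dec k j then 1 else pseudo_dist (z k) (z j))))) N).
  - rewrite !rprod_mult, rprod_single by auto. fold (separation z j N).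
    assert (H := Hsep j Hj).
    assert (delta ^ 3 <= separation z j N ^ 3) by (apply pow_incr; lra). simpl in *; lra.
  - apply rprod_le. intros k Hk.
    assert (P : 0 <= pseudo_dist (z k) (z j)) by apply Cmod_ge_0.
    assert (P1 := pseudo_dist_le_1 (z k) (z j) (Hz k) (Hz j)).
    destruct (Nat.eq_dec k j) as [->|Hkj].
    + split; [lra|]. destruct Rle_dec as [_|]; [|lra].
      assert (Hj1 := Hz j). assert (Pj := Cmod_ge_0 (z j)).
      assert (H : Cmod (Cconj (z j) * z j) < 1) by (rewrite Cmod_mult, Cmod_conj; nra).
      assert (P2 := one_plus_q_ge j (z j) H).
      rewrite Cmod_inv by now apply one_plus_q_neq_0.
      rewrite !Rmult_1_r. apply Rinv_le_contravar; [lra|].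
      eapply Rle_trans; [apply Cmod_triangle|]. rewrite Cmod_1.
      assert (Cmod (q j (z j)) <= 1); [|lra]. unfold q.
      assert (D := defect_pos _ Hj1).
      assert (E : (1 - Cconj (z j) * z j)%C = RtoC (defect (z j))).
      { unfold defect. rewrite RtoC_minus, Cmod2_conj. ring. }
      rewrite E, Cmod_mult, Cmod_RtoC_pos, Cmod_div, (Cmod_RtoC_pos (defect (z j))) by
        (try lra; intros E0; apply RtoC_inj in E0; lra).
      assert (Cmod (1 + Cconj (z j) * z j) <= 2).
      { eapply Rle_trans; [apply Cmod_triangle|]. rewrite Cmod_1; lra. }
      replace (defect (z j) / 2 * (Cmod (1 + Cconj (z j) * z j) / defect (z j)))
        with (Cmod (1 + Cconj (z j) * z j) / 2) by (field; lra). lra.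
    + split.
      * rewrite Rmult_1_l. repeat apply Rmult_le_pos; auto.
      * destruct Rle_dec as [Hle|_].
        -- eapply Rle_trans; [|apply (factor_bound j k); auto]. simpl; lra.
        -- rewrite Cmod_1, Rmult_1_l. generalize (pow_incr _ 1 3 (conj P P1)); simpl; lra.
Qed.

(** For each [j] the function [f Phi_j kernel(z j)] is evaluated at [z j] by reproduction and
    Cauchy-Schwarz. Summation under the mean then meets the pointwise bound of [tail_weight_sum_le].
    The constant is the inverse square of [delta^3 / 2]. *)
Lemma Carleson_embedding (r : R) (f : C -> C) : 1 < r -> hol r f ->
  rsum (fun j => defect (z j) * Cmod (f (z j)) ^ 2) N
  <= 4 / delta ^ 6 * rmean (fun t => Cmod (f (polar 1 t)) ^ 2).
Proof.
  intros Hr Hf.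
  destruct (exists_radius z N Hz) as (s & Hs & Hsz).
  set (rho := Rmin r s). assert (Hrho : 1 < rho) by now apply Rmin_glb_lt.
  assert (Hf' : hol rho f) by (apply (hol_le r); auto; apply Rmin_l).
  assert (Hrz : forall k, (k < N)%nat -> rho * Cmod (z k) <= 1).
  { intros k Hk. eapply Rle_trans; [|apply (Hsz k Hk)].
    apply Rmult_le_compat_r; [apply Cmod_ge_0|apply Rmin_r]. }
  assert (HPhi : forall j, hol rho (Phi j)) by (intros; apply hol_Phi; auto; lra).
  assert (HK : forall j, (j < N)%nat -> hol rho (kernel (z j)))
    by (intros; apply hol_kernel; auto; lra).
  assert (Cf := ccont_unit_hol rho f Hrho Hf').
  assert (CP := fun j => ccont_unit_hol rho _ Hrho (HPhi j)).
  assert (Pd : 0 < delta ^ 6) by now apply pow_lt.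
  assert (Px : forall k t, 0 <= x k t).
  { intros. unfold x. apply Rmult_le_pos; apply pow2_ge_0. }
  assert (Cx : forall k, rcont (x k)).
  { intros k. unfold x. apply rcont_mult; auto with cont. }
  apply (Rmult_le_reg_l (delta ^ 6 / 4)); [lra|].
  replace (delta ^ 6 / 4 * (4 / delta ^ 6 * rmean (fun t => Cmod (f (polar 1 t)) ^ 2)))
    with (rmean (fun t => Cmod (f (polar 1 t)) ^ 2)) by (field; lra).
  rewrite <- rsum_scal.
  apply Rle_trans with (rsum (fun j => rmean (fun t =>
    Cmod (f (polar 1 t)) ^ 2 * (x j t * Cmod (Phi j (polar 1 t)) ^ 2))) N).
  - apply rsum_le. intros j Hj.
    assert (D := defect_pos _ (Hz j)).
    set (F := fun w => (f w * Phi j w * kernel (z j) w)%C).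
    assert (HF : hol rho F) by (unfold F; repeat apply hol_mult; auto).
    assert (CK := ccont_kernel_unit (z j) (Hz j)).
    assert (CS := Cmod_cmean_mult_le (fun t => F (polar 1 t)) (fun t => Cconj (kernel (z j) (polar 1 t)))).
    cbv beta in CS.
    rewrite (reproducing rho F (z j)) in CS by auto.
    rewrite (rmean_ext (fun t => Cmod (Cconj _) ^ 2) (fun t => Cmod (kernel (z j) (polar 1 t)) ^ 2)) in CS
      by (intros; now rewrite Cmod_conj).
    rewrite kernel_norm in CS by auto.
    specialize (CS (ccont_unit_hol rho F Hrho HF) (ccont_conj _ CK)).
    unfold F in CS at 1. rewrite kernel_diag, !Cmod_mult, Cmod_RtoC_pos in CS
      by (auto; apply Rlt_le, Rinv_0_lt_compat; lra).
    assert (E : rmean (fun t => Cmod (f (polar 1 t)) ^ 2 * (x j t * Cmod (Phi j (polar 1 t)) ^ 2))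
      = defect (z j) ^ 2 * rmean (fun t => Cmod (F (polar 1 t)) ^ 2)).
    { rewrite <- rmean_scal.
      - apply rmean_ext. intros t. unfold F, x. rewrite !Cmod_mult. ring.
      - assert (CF := ccont_unit_hol rho F Hrho HF). auto with cont. }
    rewrite E. set (I := rmean (fun t => Cmod (F (polar 1 t)) ^ 2)) in *.
    assert (HI : Cmod (f (z j)) ^ 2 * Cmod (Phi j (z j)) ^ 2 <= defect (z j) * I).
    { apply (Rmult_le_reg_r (/ defect (z j) ^ 2)); [apply Rinv_0_lt_compat, pow_lt; lra|].
      replace (defect (z j) * I * / defect (z j) ^ 2) with (I * / defect (z j)) by (field; lra).
      eapply Rle_trans; [|exact CS]. apply Req_le. field. lra. }
    assert (HP : delta ^ 6 / 4 <= Cmod (Phi j (z j)) ^ 2).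
    { replace (delta ^ 6 / 4) with ((delta ^ 3 / 2) ^ 2) by field.
      apply pow_incr. split; [|now apply Phi_diag].
      assert (0 < delta ^ 3) by now apply pow_lt. lra. }
    assert (Q : 0 <= Cmod (f (z j)) ^ 2) by apply pow2_ge_0.
    replace (delta ^ 6 / 4 * (defect (z j) * Cmod (f (z j)) ^ 2))
      with (defect (z j) * (Cmod (f (z j)) ^ 2 * (delta ^ 6 / 4))) by ring.
    replace (defect (z j) ^ 2 * I) with (defect (z j) * (defect (z j) * I)) by ring.
    apply Rmult_le_compat_l; [lra|]. eapply Rle_trans; [|exact HI].
    now apply Rmult_le_compat_l.
  - assert (CC : forall j, rcont (fun t => Cmod (f (polar 1 t)) ^ 2 * (x j t * Cmod (Phi j (polar 1 t)) ^ 2))).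
    { intros j. specialize (CP j). specialize (Cx j).
      apply rcont_mult; [auto with cont|]. apply rcont_mult; auto with cont. }
    rewrite <- (rmean_rsum (fun j t => Cmod (f (polar 1 t)) ^ 2 * (x j t * Cmod (Phi j (polar 1 t)) ^ 2)))
      by auto.
    apply rmean_le; auto with cont.
    + apply (rcont_rsum (fun j t => Cmod (f (polar 1 t)) ^ 2 * (x j t * Cmod (Phi j (polar 1 t)) ^ 2))).
      auto.
    + intros t. rewrite rsum_scal. rewrite <- (Rmult_1_r (Cmod (f (polar 1 t)) ^ 2)) at 2.
      apply Rmult_le_compat_l; [apply pow2_ge_0|].
      eapply Rle_trans; [|apply (tail_weight_sum_le (fun k => Cmod (z k)) (fun k => x k t) N)].
      * apply rsum_le. intros j _. apply Rmult_le_compat_l; auto.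
      * auto.
      * intros; apply Cmod_ge_0.
Qed.

(** Duality: with [f] the sum of [defect (z n) * m n * kernel (z n)], the sum [S] equals the pairing
    of [G] with [f], so [S^2 <= |G|^2 |f|^2]. Moreover [|f|^2] is a pairing of the [m n] with the
    values [f (z n)], so the embedding gives [|f|^2 <= K S]. [G] need not be holomorphic, which
    matters because it will be a conjugate. *)
Lemma Bessel_kernels (G : R -> C) : ccont G ->
  rsum (fun n => defect (z n) * Cmod (cmean (fun t => (G t * Cconj (kernel (z n) (polar 1 t)))%C)) ^ 2) N
  <= 4 / delta ^ 6 * rmean (fun t => Cmod (G t) ^ 2).
Proof.
  intros CG.
  set (m := fun n => cmean (fun t => (G t * Cconj (kernel (z n) (polar 1 t)))%C)).
  set (S := rsum (fun n => defect (z n) * Cmod (m n) ^ 2) N).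
  set (f := fun w => csum (fun n => ((RtoC (defect (z n)) * m n) * kernel (z n) w)%C) N).
  destruct (exists_radius z N Hz) as (r & Hr & Hrz).
  assert (Hf : hol r f).
  { apply (hol_csum r (fun n w => ((RtoC (defect (z n)) * m n) * kernel (z n) w)%C)).
    intros k Hk. apply hol_mult; [apply hol_const|]. apply hol_kernel; auto; lra. }
  assert (Cf := ccont_unit_hol r f Hr Hf).
  assert (CK : forall n, ccont (fun t => kernel (z n) (polar 1 t))) by (intros; now apply ccont_kernel_unit).
  assert (HS : 0 <= S).
  { apply rsum_ge_0. intros k _. apply Rmult_le_pos; [|apply pow2_ge_0].
    generalize (defect_pos _ (Hz k)); lra. }
  assert (pairing : forall H : R -> C, ccont H ->
    cmean (fun t => (H t * Cconj (f (polar 1 t)))%C)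
    = csum (fun n => (RtoC (defect (z n)) * Cconj (m n)
        * cmean (fun t => (H t * Cconj (kernel (z n) (polar 1 t)))%C))%C) N).
  { intros H CH.
    rewrite (cmean_ext _ (fun t => csum (fun n => ((RtoC (defect (z n)) * Cconj (m n))
       * (H t * Cconj (kernel (z n) (polar 1 t))))%C) N)).
    - rewrite (cmean_csum (fun n t => ((RtoC (defect (z n)) * Cconj (m n))
       * (H t * Cconj (kernel (z n) (polar 1 t))))%C)).
      + apply csum_ext. intros n _. specialize (CK n). rewrite cmean_scal; auto with cont.
      + intros n _. specialize (CK n). auto with cont.
    - intros t. unfold f. rewrite <- csum_conj, <- csum_scal. apply csum_ext. intros n _.
      rewrite !Cmult_conj. replace (Cconj (RtoC (defect (z n)))) with (RtoC (defect (z n))); [ring|].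
      unfold Cconj, RtoC; simpl; f_equal; ring. }
  set (A := rmean (fun t => Cmod (f (polar 1 t)) ^ 2)).
  set (B := rmean (fun t => Cmod (G t) ^ 2)).
  assert (HA : 0 <= A) by (apply rmean_ge_0; [auto with cont|intros; apply pow2_ge_0]).
  assert (HB : 0 <= B) by (apply rmean_ge_0; [auto with cont|intros; apply pow2_ge_0]).
  assert (Pd : 0 < delta ^ 6) by now apply pow_lt.
  set (K := 4 / delta ^ 6). assert (HK : 0 < K) by (apply Rdiv_lt_0_compat; lra).
  assert (E1 : cmean (fun t => (G t * Cconj (f (polar 1 t)))%C) = RtoC S).
  { rewrite pairing by auto. unfold S. rewrite <- csum_RtoC. apply csum_ext. intros n _.
    fold (m n). rewrite RtoC_mult, Cmod2_conj. ring. }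
  assert (I1 : S ^ 2 <= B * A).
  { rewrite <- (Cmod_RtoC_pos S HS), <- E1.
    eapply Rle_trans; [apply (Cmod_cmean_mult_le G (fun t => Cconj (f (polar 1 t)))); auto with cont|].
    apply Rmult_le_compat_l; auto. apply Req_le, rmean_ext. intros; now rewrite Cmod_conj. }
  assert (E2 : RtoC A = csum (fun n => (RtoC (defect (z n)) * Cconj (m n) * f (z n))%C) N).
  { unfold A. rewrite <- cmean_RtoC.
    rewrite (cmean_ext _ (fun t => (f (polar 1 t) * Cconj (f (polar 1 t)))%C)) by (intros; apply Cmod2_conj).
    rewrite pairing by auto. apply csum_ext. intros n _. now rewrite (reproducing r f (z n)). }
  assert (I2 : A ^ 2 <= S * (K * A)).
  { rewrite <- (Cmod_RtoC_pos A HA) at 1. rewrite E2.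
    apply Rle_trans with (rsum (fun n => (sqrt (defect (z n)) * Cmod (m n))
        * (sqrt (defect (z n)) * Cmod (f (z n)))) N ^ 2).
    - apply pow_incr. split; [apply Cmod_ge_0|]. eapply Rle_trans; [apply Cmod_csum_le|].
      apply rsum_le. intros n _. rewrite !Cmod_mult, Cmod_conj.
      assert (D := defect_pos _ (Hz n)). rewrite Cmod_RtoC_pos by lra.
      apply Req_le. rewrite <- (sqrt_sqrt (defect (z n))) at 1 by lra. ring.
    - eapply Rle_trans; [apply rsum_CauchySchwarz|].
      assert (W : forall n (c : R), (sqrt (defect (z n)) * c) ^ 2 = defect (z n) * c ^ 2).
      { intros n c. rewrite Rpow_mult_distr, <- Rsqr_pow2, Rsqr_sqrt; [reflexivity|].
        generalize (defect_pos _ (Hz n)); lra. }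
      rewrite (rsum_ext _ (fun n => defect (z n) * Cmod (m n) ^ 2)) by auto.
      rewrite (rsum_ext (fun n => (_ * Cmod (f _)) ^ 2) (fun n => defect (z n) * Cmod (f (z n)) ^ 2)) by auto.
      apply Rmult_le_compat_l; auto. now apply (Carleson_embedding r). }
  change (S <= K * B).
  destruct (Req_dec S 0) as [E|NS]; [rewrite E; apply Rmult_le_pos; lra|].
  assert (A <= S * K).
  { destruct (Req_dec A 0) as [->|NA]; [nra|]. apply (Rmult_le_reg_r A); nra. }
  apply (Rmult_le_reg_r S); [lra|]. nra.
Qed.

End CarlesonEmbedding.

(** * Finite Blaschke products *)

Lemma Cconj_neq_0 (a : C) : a <> RtoC 0 -> Cconj a <> RtoC 0.
Proof. intros H. apply Cmod_gt_0. rewrite Cmod_conj. now apply Cmod_gt_0. Qed.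

Lemma blaschke_partial_cprod (z : nat -> C) (N : nat) (w : C) :
  blaschke_partial z N w = cprod (fun n => blaschke_factor (z n) w) N.
Proof. induction N; simpl; auto. now rewrite IHN. Qed.

Lemma cprod_ext (u v : nat -> C) (n : nat) :
  (forall k, (k < n)%nat -> u k = v k) -> cprod u n = cprod v n.
Proof. induction n; intros H; simpl; auto. rewrite IHn, H; auto. Qed.

Definition residue (z : nat -> C) (N n : nat) : C :=
  ((RtoC (Cmod (z n)) / z n * (z n - / Cconj (z n)))
   * cprod (fun k => if Nat.eq_dec k n then RtoC 1
                     else blaschke_factor (z k) (/ Cconj (z n))) N)%C.

(* [w = 1 / conj (z n)] is the reflected point at which [blaschke_factor (z n)] has its pole;
   [residue z N n] is the coefficient of that pole. *)
Lemma blaschke_partial_fractions (z : nat -> C) (N : nat) :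
  (forall n, z n <> RtoC 0) ->
  (forall k n, (k < N)%nat -> (n < N)%nat -> k <> n -> z k <> z n) ->
  exists c0 : C, forall w,
    (forall n, (n < N)%nat -> (1 - Cconj (z n) * w)%C <> RtoC 0) ->
    blaschke_partial z N w = (c0 + csum (fun n => residue z N n * kernel (z n) w) N)%C.
Proof.
  intros H0. induction N as [|N IH]; intros Hd.
  { exists (RtoC 1). intros w _. simpl. ring. }
  destruct IH as [c0 IH]; [intros; apply Hd; lia|].
  assert (Nc : forall n, Cconj (z n) <> RtoC 0) by (intros; apply Cconj_neq_0; auto).
  assert (Hcc : forall n, (n < N)%nat -> Cconj (z n) <> Cconj (z N)).
  { intros n Hn E. apply (Hd n N); try lia.
    rewrite <- (Cconj_conj (z n)), E. apply Cconj_conj. }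
  assert (Hinv : forall n, (n < N)%nat -> (1 - Cconj (z n) * / Cconj (z N))%C <> RtoC 0).
  { intros n Hn E. apply (Hcc n Hn).
    replace (Cconj (z n)) with (Cconj (z N) - (1 - Cconj (z n) * / Cconj (z N)) * Cconj (z N))%C
      by (field; auto).
    rewrite E. ring. }
  set (e := (RtoC (Cmod (z N)) / (z N * Cconj (z N)))%C).
  set (D := (RtoC (Cmod (z N)) / z N * (z N - / Cconj (z N)))%C).
  (* Value at infinity plus simple pole. Multiplying it into the fractions already obtained creates
     products of two distinct poles, which are split again. *)
  assert (Hb : forall w, (1 - Cconj (z N) * w)%C <> RtoC 0 ->
    blaschke_factor (z N) w = (e + D * / (1 - Cconj (z N) * w))%C).
  { intros w Hw. unfold blaschke_factor, e, D. field. auto. }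
  exists (c0 * e)%C. intros w Hw.
  simpl blaschke_partial. simpl csum.
  assert (EN : residue z (S N) N = (D * blaschke_partial z N (/ Cconj (z N)))%C).
  { unfold residue. fold D. simpl. destruct Nat.eq_dec; [|lia]. rewrite Cmult_1_r.
    f_equal. rewrite blaschke_partial_cprod. apply cprod_ext.
    intros k Hk. destruct Nat.eq_dec; [lia|reflexivity]. }
  rewrite EN, !IH by auto. rewrite Hb by auto.
  rewrite (csum_ext (fun n => (residue z (S N) n * kernel (z n) w)%C)
    (fun n => ((e + D * / (1 - Cconj (z N) * w)) * (residue z N n * kernel (z n) w)
      + (- (D * / (1 - Cconj (z N) * w))) * (residue z N n * kernel (z n) (/ Cconj (z N))))%C)).
  - rewrite csum_plus, !csum_scal. change (kernel (z N) w) with (/ (1 - Cconj (z N) * w))%C. ring.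
  - intros n Hn.
    assert (E : residue z (S N) n
      = (residue z N n * blaschke_factor (z N) (/ Cconj (z n)))%C).
    { unfold residue. simpl. destruct (Nat.eq_dec N n); [lia|ring]. }
    assert (Nn : (1 - Cconj (z N) * / Cconj (z n))%C <> RtoC 0).
    { intros E0. apply (Hcc n Hn).
      replace (Cconj (z N)) with (Cconj (z n) - (1 - Cconj (z N) * / Cconj (z n)) * Cconj (z n))%C
        by (field; auto).
      rewrite E0. ring. }
    rewrite E, Hb by auto. unfold kernel.
    assert (N1 : (Cconj (z n) - Cconj (z N))%C <> RtoC 0).
    { intros E0. apply (Hcc n Hn).
      replace (Cconj (z n)) with ((Cconj (z n) - Cconj (z N)) + Cconj (z N))%C by ring.
      rewrite E0. ring. }
    assert (N2 : (Cconj (z N) - Cconj (z n))%C <> RtoC 0).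
    { intros E0. apply N1. replace (Cconj (z n) - Cconj (z N))%C
        with (- (Cconj (z N) - Cconj (z n)))%C by ring. rewrite E0. ring. }
    field. repeat split; auto.
Qed.

(** Schwarz reflection: the values of a Blaschke factor at [b] and at [1 / conj b] have product 1 up
    to conjugation of one of them. *)
Lemma Cmod_blaschke_reflected (a b : C) :
  0 < Cmod a < 1 -> 0 < Cmod b < 1 -> a <> b ->
  Cmod (blaschke_factor a (/ Cconj b)) = / pseudo_dist a b.
Proof.
  intros Ha Hb Hab.
  assert (Na : a <> RtoC 0) by (apply Cmod_gt_0; lra).
  assert (Nb : b <> RtoC 0) by (apply Cmod_gt_0; lra).
  assert (Ncb := Cconj_neq_0 _ Nb).
  assert (N1 : (a - b)%C <> RtoC 0).
  { intros E. apply Hab. replace a with ((a - b) + b)%C by ring. rewrite E; ring. }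
  assert (N2 : (1 - Cconj a * b)%C <> RtoC 0).
  { apply one_minus_neq_0. rewrite Cmod_mult, Cmod_conj. nra. }
  assert (N3 := Cconj_neq_0 _ N1). rewrite Cminus_conj in N3.
  assert (N4 : (Cconj b - Cconj a)%C <> RtoC 0).
  { intros E. apply N3. replace (Cconj a - Cconj b)%C with (- (Cconj b - Cconj a))%C by ring.
    rewrite E. ring. }
  unfold blaschke_factor, pseudo_dist.
  replace ((a - / Cconj b) / (1 - Cconj a * / Cconj b))%C
    with (- (1 - a * Cconj b) / - (Cconj a - Cconj b))%C.
  2:{ field. repeat split; auto. }
  assert (E1 : Cmod (1 - a * Cconj b) = Cmod (1 - Cconj a * b)).
  { rewrite <- Cmod_conj, Cminus_conj, Cmult_conj, Cconj_conj. f_equal. f_equal.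
    unfold Cconj, RtoC; simpl; f_equal; ring. }
  rewrite Cmod_mult, !Cmod_div, !Cmod_opp, E1, <- Cminus_conj, Cmod_conj, Cmod_RtoC_pos; auto; try lra.
  - field. repeat split; apply Rgt_not_eq, Cmod_gt_0; auto.
  - apply Cmod_gt_0. rewrite Cmod_opp. now apply Cmod_gt_0.
Qed.

Lemma pseudo_dist_same (a : C) : pseudo_dist a a = 0.
Proof.
  unfold pseudo_dist. replace ((a - a) / (1 - Cconj a * a))%C with (RtoC 0).
  - apply Cmod_0.
  - unfold Cdiv. ring.
Qed.

(** A repeated point contributes a factor 0. Simple poles in the partial fractions rest on this. *)
Lemma separation_neq (z : nat -> C) (n N : nat) : 0 < separation z n N ->
  forall k, (k < N)%nat -> k <> n -> z k <> z n.
Proof.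
  intros H k Hk Hkn E.
  assert (separation z n N = 0); [|lra]. clear H.
  unfold separation. induction N as [|N IH]; [lia|]. simpl.
  destruct (Nat.eq_dec k N) as [->|].
  - destruct Nat.eq_dec; [lia|]. rewrite E, pseudo_dist_same. ring.
  - rewrite IH by lia. ring.
Qed.

(** The lower bound for [separation] becomes an upper bound for the residues; this adds [delta^2] to
    the [delta^6] of the embedding. *)
Lemma Cmod_residue (z : nat -> C) (N n : nat) :
  (forall k, 0 < Cmod (z k) < 1) -> 0 < separation z n N ->
  Cmod (residue z N n * Cconj (z n)) = defect (z n) / separation z n N.
Proof.
  intros Hz Hs. assert (Hn := Hz n). assert (N0 : z n <> RtoC 0) by (apply Cmod_gt_0; lra).
  assert (Nc := Cconj_neq_0 _ N0).
  unfold residue. rewrite Cmod_mult, (Cmod_mult _ (cprod _ _)), Cmod_cprod, (Cmod_mult (_ / _)).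
  rewrite Cmod_div, Cmod_RtoC_pos by (auto; lra).
  assert (E : Cmod (z n - / Cconj (z n)) * Cmod (Cconj (z n)) = defect (z n)).
  { rewrite <- Cmod_mult.
    replace ((z n - / Cconj (z n)) * Cconj (z n))%C with (- (RtoC (defect (z n))))%C.
    - rewrite Cmod_opp, Cmod_RtoC_pos; auto. generalize (defect_pos (z n)); lra.
    - unfold defect. rewrite RtoC_minus, Cmod2_conj. field; auto. }
  assert (E2 : rprod (fun k => Cmod (if Nat.eq_dec k n then RtoC 1
      else blaschke_factor (z k) (/ Cconj (z n)))) N = / separation z n N).
  { assert (Hne := separation_neq z n N Hs). clear Hs E.
    unfold separation. induction N as [|N IH]; simpl; [now rewrite Rinv_1|].
    rewrite IH by (intros; apply Hne; auto).
    rewrite Rinv_mult. f_equal. destruct Nat.eq_dec; [now rewrite Cmod_1, Rinv_1|].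
    apply Cmod_blaschke_reflected; auto. }
  rewrite E2, <- E. field. split; [lra|]. apply Rgt_not_eq; lra.
Qed.

Lemma Cmod_blaschke_factor_unit (a : C) (t : R) : 0 < Cmod a < 1 ->
  Cmod (blaschke_factor a (polar 1 t)) = 1.
Proof.
  intros Ha. assert (N0 : a <> RtoC 0) by (apply Cmod_gt_0; lra).
  assert (N1 := one_minus_conj_polar a t (proj2 Ha)).
  assert (P1 : 0 < Cmod (1 - Cconj a * polar 1 t)) by now apply Cmod_gt_0.
  assert (I := one_minus_Cconj_mult_sqr a (polar 1 t)). rewrite Cmod_unit in I.
  assert (E : Cmod (a - polar 1 t) = Cmod (1 - Cconj a * polar 1 t)).
  { assert (P2 := Cmod_ge_0 (a - polar 1 t)). apply Rsqr_inj; try lra. rewrite !Rsqr_pow2. lra. }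
  unfold blaschke_factor. rewrite Cmod_mult, !Cmod_div, E, Cmod_RtoC_pos; auto; try lra.
  field. split; [|lra]. lra.
Qed.

Lemma Cmod_blaschke_partial_unit (z : nat -> C) (N : nat) (t : R) :
  (forall k, 0 < Cmod (z k) < 1) -> Cmod (blaschke_partial z N (polar 1 t)) = 1.
Proof.
  intros Hz. induction N; simpl; [apply Cmod_1|].
  rewrite Cmod_mult, IHN, Cmod_blaschke_factor_unit; auto. ring.
Qed.

Lemma hol_blaschke_factor (r : R) (a : C) : 0 < r -> r * Cmod a <= 1 -> hol r (blaschke_factor a).
Proof.
  intros Hr Ha. unfold blaschke_factor.
  apply hol_mult; [apply hol_const|]. apply hol_mult.
  - apply hol_minus; [apply hol_const|apply hol_id].
  - now apply hol_kernel.
Qed.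

Lemma hol_blaschke_partial (r : R) (z : nat -> C) (N : nat) :
  0 < r -> (forall k, (k < N)%nat -> r * Cmod (z k) <= 1) -> hol r (blaschke_partial z N).
Proof.
  intros Hr H. apply (hol_ext r (fun w => cprod (fun n => blaschke_factor (z n) w) N)).
  - intros; symmetry; apply blaschke_partial_cprod.
  - apply hol_cprod. intros; apply hol_blaschke_factor; auto.
Qed.

Lemma ccont_blaschke_unit (z : nat -> C) (N : nat) :
  (forall k, 0 < Cmod (z k) < 1) -> ccont (fun t => blaschke_partial z N (polar 1 t)).
Proof.
  intros Hz. destruct (exists_radius z N) as (r & Hr & H); [intros; apply Hz|].
  apply (ccont_unit_hol r); auto. apply hol_blaschke_partial; auto; lra.
Qed.

(* The function obtained by subtracting the projection onto [B_N H2] is a combination of the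
   kernels at [z 0, ..., z (N-1)]; multiplication by [conj B_N] exchanges the system dual to the kernels
   with the complex conjugates of the kernels, so its Bessel bound is [Bessel_kernels]. *)
Lemma kernel_expansion (z : nat -> C) (N : nat) (delta r : R) (f : C -> C) :
  (forall k, 0 < Cmod (z k) < 1) -> 0 < delta ->
  (forall n, (n < N)%nat -> delta <= separation z n N) ->
  1 < r -> hol r f ->
  exists kappa : nat -> C,
    rsum (fun n => Cmod (kappa n) ^ 2 / defect (z n)) N
      <= 4 / delta ^ 8 * rmean (fun t => Cmod (f (polar 1 t)) ^ 2) /\
    forall w, Cmod w < 1 ->
      (f w - blaschke_partial z N w * cmean (fun t =>
         (f (polar 1 t) * Cconj (blaschke_partial z N (polar 1 t))
           / (1 - w * Cconj (polar 1 t)))%C)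
       = csum (fun n => kappa n * kernel (z n) w) N)%C.
Proof.
  intros Hz Hdelta Hsep Hr Hf.
  assert (Hz1 : forall k, Cmod (z k) < 1) by (intros; apply Hz).
  assert (Cf := ccont_unit_hol r f Hr Hf).
  assert (CB := ccont_blaschke_unit z N Hz).
  assert (CK : forall n, ccont (fun t => kernel (z n) (polar 1 t))) by (intros; now apply ccont_kernel_unit).
  (* The extra [polar 1 t] comes from [1 / (1 - w * conj u) = u / (u - w)] on the circle; the
     [u - w] cancels in the divided difference of [B_N]. *)
  set (H := fun t => (f (polar 1 t) * Cconj (blaschke_partial z N (polar 1 t)) * polar 1 t)%C).
  assert (CH : ccont H) by (unfold H; auto with cont).
  set (mu := fun n => cmean (fun t => (H t * kernel (z n) (polar 1 t))%C)).
  exists (fun n => (residue z N n * Cconj (z n) * mu n)%C). split.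
  - assert (CG : ccont (fun t => Cconj (H t))) by auto with cont.
    assert (K := Bessel_kernels z N delta Hz1 Hdelta Hsep _ CG).
    rewrite (rmean_ext _ (fun t => Cmod (f (polar 1 t)) ^ 2)) in K.
    2:{ intros t. unfold H. rewrite Cmod_conj, !Cmod_mult, Cmod_conj, Cmod_unit,
          Cmod_blaschke_partial_unit by auto. ring. }
    apply Rle_trans with (/ delta ^ 2 * rsum (fun n => defect (z n) * Cmod (cmean (fun t =>
        (Cconj (H t) * Cconj (kernel (z n) (polar 1 t)))%C)) ^ 2) N).
    + rewrite <- rsum_scal. apply rsum_le. intros n Hn.
      assert (Em : Cmod (cmean (fun t => (Cconj (H t) * Cconj (kernel (z n) (polar 1 t)))%C)) = Cmod (mu n)).
      { specialize (CK n). rewrite <- (Cmod_conj (mu n)). unfold mu. rewrite <- cmean_conj by auto with cont.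
        f_equal. apply cmean_ext. intros; now rewrite Cmult_conj. }
      rewrite Em. assert (S := Hsep n Hn). assert (D := defect_pos _ (Hz1 n)).
      rewrite Cmod_mult, Cmod_residue by (auto; lra).
      replace ((defect (z n) / separation z n N * Cmod (mu n)) ^ 2 / defect (z n))
        with (/ separation z n N ^ 2 * (defect (z n) * Cmod (mu n) ^ 2)) by (field; lra).
      apply Rmult_le_compat_r.
      * apply Rmult_le_pos; [lra|apply pow2_ge_0].
      * apply Rinv_le_contravar; [now apply pow_lt|]. apply pow_incr; lra.
    + assert (P : 0 < / delta ^ 2) by now apply Rinv_0_lt_compat, pow_lt.
      apply (Rmult_le_compat_l (/ delta ^ 2)) in K; [|lra].
      eapply Rle_trans; [exact K|]. apply Req_le. field. lra.
  - intros w Hw.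
    assert (Hne : forall n, z n <> RtoC 0) by (intros n; apply Cmod_gt_0, Hz).
    assert (Hdist : forall k n, (k < N)%nat -> (n < N)%nat -> k <> n -> z k <> z n).
    { intros k n Hk Hn Hkn. apply (separation_neq z n N); auto.
      eapply Rlt_le_trans; [|now apply Hsep]. auto. }
    destruct (blaschke_partial_fractions z N Hne Hdist) as [c0 Hpf].
    assert (N1 : forall t, (1 - w * Cconj (polar 1 t))%C <> RtoC 0) by (intros; now apply kernel_neq_0).
    assert (C1 : ccont (fun t => (f (polar 1 t) * Cconj (blaschke_partial z N (polar 1 t))
         / (1 - w * Cconj (polar 1 t)))%C)) by (apply ccont_div; auto with cont).
    assert (C2 : ccont (fun t => (f (polar 1 t) / (1 - w * Cconj (polar 1 t)))%C))
      by (apply ccont_div; auto with cont).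
    rewrite <- (Cauchy_formula r f w) by auto.
    rewrite <- cmean_scal, <- cmean_minus by auto with cont.
    rewrite (cmean_ext _ (fun t => csum (fun n => ((residue z N n * Cconj (z n) * kernel (z n) w)
       * (H t * kernel (z n) (polar 1 t)))%C) N)).
    + rewrite (cmean_csum (fun n t => ((residue z N n * Cconj (z n) * kernel (z n) w)
       * (H t * kernel (z n) (polar 1 t)))%C)).
      * apply csum_ext. intros n _. specialize (CK n). rewrite cmean_scal by auto with cont.
        fold (mu n). ring.
      * intros n _. specialize (CK n). auto with cont.
    + intros t. set (B := blaschke_partial z N (polar 1 t)).
      assert (EB : (B * Cconj B)%C = RtoC 1).
      { rewrite <- Cmod2_conj. unfold B. rewrite Cmod_blaschke_partial_unit by auto. f_equal; ring. }
      replace (f (polar 1 t) / (1 - w * Cconj (polar 1 t)) - blaschke_partial z N w *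
         (f (polar 1 t) * Cconj B / (1 - w * Cconj (polar 1 t))))%C with
        (f (polar 1 t) * Cconj B * ((B - blaschke_partial z N w) / (1 - w * Cconj (polar 1 t))))%C.
      2:{ transitivity (f (polar 1 t) * (B * Cconj B - Cconj B * blaschke_partial z N w)
            / (1 - w * Cconj (polar 1 t)))%C; [|rewrite EB]; field; auto. }
      assert (Hw1 : forall n, (1 - Cconj (z n) * w)%C <> RtoC 0).
      { intros n. apply one_minus_neq_0. rewrite Cmod_mult, Cmod_conj.
        generalize (Hz n) (Cmod_ge_0 w). nra. }
      assert (Hu1 : forall n, (1 - Cconj (z n) * polar 1 t)%C <> RtoC 0)
        by (intros; now apply one_minus_conj_polar).
      unfold B at 2. rewrite !Hpf by auto.
      (* A difference of kernel values factors: [kernel a u - kernel a w = (u - w) * conj a * kernel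
         a u * kernel a w]. The constant [c0] drops out. *)
      replace (c0 + csum (fun n => residue z N n * kernel (z n) (polar 1 t)) N
        - (c0 + csum (fun n => residue z N n * kernel (z n) w) N))%C with
       (csum (fun n => (polar 1 t - w) * (residue z N n * Cconj (z n) * kernel (z n) w * kernel (z n) (polar 1 t))) N)%C.
      * rewrite csum_scal.
        replace ((polar 1 t - w) * csum (fun n => residue z N n * Cconj (z n) * kernel (z n) w * kernel (z n) (polar 1 t)) N
            / (1 - w * Cconj (polar 1 t)))%C with
          (polar 1 t * csum (fun n => residue z N n * Cconj (z n) * kernel (z n) w * kernel (z n) (polar 1 t)) N)%C.
        -- rewrite Cmult_assoc. rewrite <- csum_scal.
           apply csum_ext. intros n _. unfold H. unfold B. ring.
        -- assert (E : (polar 1 t * (1 - w * Cconj (polar 1 t)) = polar 1 t - w)%C).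
           { replace (polar 1 t * (1 - w * Cconj (polar 1 t)))%C
               with (polar 1 t - w * (polar 1 t * Cconj (polar 1 t)))%C by ring.
             rewrite polar_conj. ring. }
           rewrite <- E. field; auto.
      * rewrite (csum_ext (fun n => ((polar 1 t - w) * (residue z N n * Cconj (z n) * kernel (z n) w * kernel (z n) (polar 1 t)))%C)
           (fun n => (residue z N n * kernel (z n) (polar 1 t)
             + (- (1)) * (residue z N n * kernel (z n) w))%C)).
        -- rewrite csum_plus, csum_scal. ring.
        -- intros n _. unfold kernel. field. split; auto.
Qed.

(** * Hardy space means and the infinite Blaschke product *)

Lemma at_left_1_iff (P : R -> Prop) :
  at_left 1 P <-> exists d, 0 < d /\ forall r, 1 - d < r < 1 -> P r.
Proof.
  split.
  - intros [d H]. exists d. split; [apply cond_pos|]. intros r Hr. apply H; [|lra].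
    unfold ball; simpl; unfold AbsRing_ball, abs, minus, plus, opp; simpl.
    apply Rabs_def1; lra.
  - intros (d & Hd & H). exists (mkposreal d Hd). intros r Hr Hr1. apply H.
    unfold ball in Hr; simpl in Hr; unfold AbsRing_ball, abs, minus, plus, opp in Hr; simpl in Hr.
    apply Rabs_def2 in Hr. lra.
Qed.

Lemma cder_is_derive (f : C -> C) (z l : C) :
  cder f z l -> is_derive (K := C_AbsRing) (V := C_NormedModule) f z l.
Proof.
  intros H. split.
  - apply is_linear_scal_l.
  - intros x Hx eps.
    assert (E : z = x) by (apply (is_filter_lim_locally_unique (V := AbsRing_NormedModule C_AbsRing) z x Hx)). subst x.
    destruct (H eps (cond_pos eps)) as (d & Hd & D).
    exists (mkposreal d Hd). intros y Hy.
    change (Cmod ((f y - f z) - (y - z) * l) <= eps * Cmod (y - z)).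
    rewrite (Cmult_comm (y - z)%C). apply D. exact Hy.
Qed.

Lemma hol_holomorphic (f : C -> C) : hol 1 f -> holomorphic_on_disc f.
Proof. intros H z Hz. destruct (H z Hz) as [l Hl]. exists l. now apply cder_is_derive. Qed.

Lemma hol_pow (r : R) (k : nat) : hol r (fun w => Cpow w k).
Proof.
  induction k as [|k IH]; simpl; [apply hol_const|]. apply hol_mult; auto. apply hol_id.
Qed.

Lemma circle_mean2_eq (f : C -> C) (r : R) : ccont (fun t => f (polar r t)) ->
  circle_mean2 f r = sqrt (rmean (fun t => Cmod (f (polar r t)) ^ 2)).
Proof.
  intros Hf. unfold circle_mean2, rmean. f_equal.
  rewrite <- (Rmult_1_l (RInt _ 0 (2 * PI) / _)).
  rewrite (RInt_ext _ (fun t => scal (/ (2 * PI)) (Cmod (f (polar r t)) ^ 2))).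
  - rewrite (RInt_scal (V := R_CompleteNormedModule)).
    + unfold scal; simpl; unfold mult; simpl. field. apply PI_neq0.
    + apply rcont_ex_RInt. auto with cont.
  - intros t _. unfold scal; simpl; unfold mult; simpl. field. apply PI_neq0.
Qed.

Lemma is_RInt_rmean (g h : R -> R) : rcont g -> (forall t, h t = g t / (2 * PI)) ->
  is_RInt (V := R_NormedModule) h 0 (2 * PI) (rmean g).
Proof.
  intros Hg Hh. apply (is_RInt_ext (V := R_NormedModule) (fun t => scal (/ (2 * PI)) (g t))).
  - intros t _. rewrite Hh. unfold scal; simpl; unfold mult; simpl. unfold Rdiv; ring.
  - assert (E : rmean g = scal (/ (2 * PI)) (RInt g 0 (2 * PI))).
    { unfold scal; simpl; unfold mult; simpl. unfold rmean, Rdiv; ring. }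
    rewrite E. apply (is_RInt_scal (V := R_NormedModule) g).
    apply (RInt_correct (V := R_CompleteNormedModule)). now apply rcont_ex_RInt.
Qed.

Lemma circle_inner_eq (f g : C -> C) (r : R) :
  ccont (fun t => f (polar r t)) -> ccont (fun t => g (polar r t)) ->
  circle_inner f g r = cmean (fun t => (f (polar r t) * Cconj (g (polar r t)))%C).
Proof.
  intros Hf Hg. unfold circle_inner.
  assert (P := two_PI_pos).
  set (u := fun t => (f (polar r t) * Cconj (g (polar r t)))%C).
  assert (Cu : ccont u) by (unfold u; auto with cont).
  assert (E : forall t, (u t / RtoC (2 * PI))%C = (Re (u t) / (2 * PI), Im (u t) / (2 * PI))).
  { intros t. unfold Cdiv. rewrite <- RtoC_inv by lra. destruct (u t) as [x y].
    unfold Cmult, RtoC; simpl. f_equal; unfold Rdiv; ring. }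
  apply (is_RInt_unique (V := C_R_CompleteNormedModule)).
  apply (is_RInt_fct_extend_pair (U := R_NormedModule) (V := R_NormedModule)).
  - apply is_RInt_rmean; [now apply rcont_Re|].
    intros t. change (f (polar r t) * Cconj (g (polar r t)))%C with (u t). now rewrite E.
  - apply is_RInt_rmean; [now apply rcont_Im|].
    intros t. change (f (polar r t) * Cconj (g (polar r t)))%C with (u t). now rewrite E.
Qed.

Lemma ccont_circle (f : C -> C) (r : R) : hol 1 f -> 0 < r < 1 -> ccont (fun t => f (polar r t)).
Proof.
  intros Hf Hr. apply (ccont_hol 1); auto with cont. intros; rewrite Cmod_polar; lra.
Qed.

(** Orthogonality to B H2 will be tested against the monomials only. *)
Lemma H2_pow (k : nat) : H2 (fun w => Cpow w k).
Proof.
  split; [apply hol_holomorphic, hol_pow|].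
  exists 1. apply (filterlim_ext_loc (fun r => r ^ k)).
  - apply at_left_1_iff. exists 1; split; [lra|]. intros r Hr.
    rewrite circle_mean2_eq by (apply ccont_pow; auto with cont).
    rewrite (rmean_ext _ (fun _ => (r ^ k) ^ 2)).
    + rewrite rmean_const, sqrt_pow2; auto. apply pow_le; lra.
    + intros t. rewrite Cmod_pow, Cmod_polar; lra.
  - replace (locally 1) with (locally (1 ^ k)) by (f_equal; apply pow1).
    eapply filterlim_filter_le_1; [apply filter_le_within|].
    apply (rcont_pow (fun r => r) k). intros t. apply continuous_id.
Qed.

(** [H2_norm] is a [lim] of a filter and means nothing until the filter is known to be Cauchy; the
    limit provided by [H2] ensures this. *)
Lemma H2_norm_limit (f : C -> C) (eps : R) : H2 f -> 0 < eps ->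
  exists d, 0 < d /\ forall r, 1 - d < r < 1 -> Rabs (circle_mean2 f r - H2_norm f) < eps.
Proof.
  intros [_ [l Hl]] Heps. apply at_left_1_iff.
  assert (K := complete_cauchy (T := R_CompleteSpace) (filtermap (circle_mean2 f) (at_left 1))).
  assert (PF : ProperFilter (filtermap (circle_mean2 f) (at_left 1))).
  { apply filtermap_proper_filter. apply at_left_proper_filter. }
  refine (K PF _ (mkposreal eps Heps)).
  intros e. exists l. apply Hl. apply locally_ball.
Qed.

Lemma Cmod_blaschke_factor (a w : C) : 0 < Cmod a < 1 ->
  Cmod (blaschke_factor a w) = pseudo_dist a w.
Proof.
  intros Ha. unfold blaschke_factor, pseudo_dist.
  assert (a <> RtoC 0) by (apply Cmod_gt_0; lra).
  rewrite Cmod_mult, Cmod_div, Cmod_RtoC_pos by (auto; lra). field; lra.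
Qed.

Lemma Cmod_blaschke_factor_le_1 (a w : C) : 0 < Cmod a < 1 -> Cmod w < 1 ->
  Cmod (blaschke_factor a w) <= 1.
Proof. intros Ha Hw. rewrite Cmod_blaschke_factor by auto. apply pseudo_dist_le_1; lra. Qed.

(** The normalization [|a| / a] makes [1 - |a|] a factor of the difference: [1 - b = (1 - |a|) (a +
    |a| w) / (a (1 - conj a * w))]. Convergence of the product follows from that of the series of
    [1 - |z n|]. *)
Lemma blaschke_factor_defect (a w : C) (s : R) : 0 < Cmod a < 1 -> Cmod w <= s -> s < 1 ->
  Cmod (1 - blaschke_factor a w) <= (1 - Cmod a) * (2 / (1 - s)).
Proof.
  intros Ha Hw Hs.
  assert (N0 : a <> RtoC 0) by (apply Cmod_gt_0; lra).
  assert (W0 := Cmod_ge_0 w).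
  assert (Pw : Cmod (Cconj a * w) <= s).
  { rewrite Cmod_mult, Cmod_conj. nra. }
  assert (N1 : (1 - Cconj a * w)%C <> RtoC 0) by (apply one_minus_neq_0; lra).
  assert (Ma : (RtoC (Cmod a) * RtoC (Cmod a) = a * Cconj a)%C).
  { rewrite <- Cmod2_conj, <- RtoC_mult. f_equal; ring. }
  assert (E : (1 - blaschke_factor a w)%C
    = (RtoC (1 - Cmod a) * ((a + RtoC (Cmod a) * w) / (a * (1 - Cconj a * w))))%C).
  { unfold blaschke_factor. rewrite RtoC_minus.
    transitivity ((a * (1 - Cconj a * w) - RtoC (Cmod a) * (a - w)) / (a * (1 - Cconj a * w)))%C;
      [field; auto|].
    replace (a * (1 - Cconj a * w) - RtoC (Cmod a) * (a - w))%C with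
      ((1 - RtoC (Cmod a)) * (a + RtoC (Cmod a) * w))%C; [field; auto|].
    transitivity (a - a * RtoC (Cmod a) + RtoC (Cmod a) * w - (RtoC (Cmod a) * RtoC (Cmod a)) * w)%C; [ring|].
    rewrite Ma. ring. }
  rewrite E, Cmod_mult, Cmod_RtoC_pos by lra. apply Rmult_le_compat_l; [lra|].
  rewrite Cmod_div by now apply Cmult_neq_0. rewrite Cmod_mult.
  assert (P1 := Cmod_1_minus_ge (Cconj a * w)).
  apply (Rmult_le_reg_r (Cmod a * Cmod (1 - Cconj a * w))); [apply Rmult_lt_0_compat; lra|].
  unfold Rdiv at 1. rewrite Rmult_assoc, Rinv_l, Rmult_1_r
    by (apply Rgt_not_eq, Rmult_lt_0_compat; lra).
  assert (Cmod (a + RtoC (Cmod a) * w) <= 2 * Cmod a).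
  { eapply Rle_trans; [apply Cmod_triangle|]. rewrite Cmod_mult, Cmod_RtoC_pos by lra. nra. }
  assert (1 <= / (1 - s) * Cmod (1 - Cconj a * w)).
  { apply (Rmult_le_reg_l (1 - s)); [lra|]. rewrite <- Rmult_assoc, Rinv_r by lra. lra. }
  replace (2 / (1 - s) * (Cmod a * Cmod (1 - Cconj a * w)))
    with (2 * Cmod a * (/ (1 - s) * Cmod (1 - Cconj a * w))) by (unfold Rdiv; ring).
  nra.
Qed.

Lemma rsum_sum_n (u : nat -> R) (N : nat) : rsum u (S N) = sum_n u N.
Proof.
  induction N as [|N IH].
  - rewrite sum_O. simpl. ring.
  - rewrite sum_Sn, <- IH. reflexivity.
Qed.

Lemma rsum_le_Series (u : nat -> R) (N : nat) : (forall n, 0 <= u n) -> ex_series u ->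
  rsum u N <= Series u.
Proof.
  intros Hu Hs. destruct (Rle_lt_dec (rsum u N) (Series u)) as [|H]; auto.
  exfalso. apply Series_correct in Hs.
  assert (Hp : 0 < rsum u N - Series u) by lra.
  assert (Hs' := proj1 (filterlim_locally _ _) Hs (mkposreal _ Hp)).
  destruct Hs' as [M HM]. specialize (HM (M + N)%nat ltac:(lia)).
  rewrite <- rsum_sum_n in HM.
  unfold ball in HM; simpl pos in HM; simpl in HM; unfold AbsRing_ball, abs, minus, plus, opp in HM; simpl in HM.
  apply Rabs_def2 in HM.
  assert (HM' : rsum u (S (M + N)) - Series u < rsum u N - Series u) by exact (proj1 HM).
  assert (mono : forall m, rsum u N <= rsum u (m + N)).
  { induction m as [|m IH]; simpl; [lra|]. generalize (Hu (m + N)%nat). lra. }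
  assert (mono' : rsum u N <= rsum u (S (M + N))) by apply (mono (S M)). lra.
Qed.

Section InfiniteBlaschke.

Variable z : nat -> C.
Hypothesis Hz : blaschke_sequence z.

Let Hz1 (n : nat) : 0 < Cmod (z n) < 1.
Proof. apply Hz. Qed.

Definition tail_product (N m : nat) (w : C) : C :=
  cprod (fun k => blaschke_factor (z (N + k)) w) m.

Let partial_split (N m : nat) (w : C) :
  blaschke_partial z (N + m) w = (blaschke_partial z N w * tail_product N m w)%C.
Proof.
  unfold tail_product. induction m as [|m IH]; simpl.
  - rewrite Nat.add_0_r. ring.
  - rewrite Nat.add_succ_r. simpl. rewrite IH. ring.
Qed.

Let tail_le_1 (N m : nat) (w : C) : Cmod w < 1 -> Cmod (tail_product N m w) <= 1.
Proof.
  intros Hw. unfold tail_product. induction m as [|m IH]; simpl; [rewrite Cmod_1; lra|].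
  rewrite Cmod_mult. assert (H := Cmod_blaschke_factor_le_1 (z (N + m)) w (Hz1 _) Hw).
  generalize (Cmod_ge_0 (cprod (fun k => blaschke_factor (z (N + k)) w) m))
    (Cmod_ge_0 (blaschke_factor (z (N + m)) w)). nra.
Qed.

Lemma Cmod_blaschke_partial_le_1 (N : nat) (w : C) : Cmod w < 1 -> Cmod (blaschke_partial z N w) <= 1.
Proof.
  intros Hw. assert (E := partial_split 0 N w). simpl in E. rewrite Cmult_1_l in E.
  rewrite E. now apply tail_le_1.
Qed.

Let tail (N : nat) : R := Series (fun n => 1 - Cmod (z n)) - rsum (fun n => 1 - Cmod (z n)) N.

Let tail_lim (eps : R) : 0 < eps -> exists N, forall n, (N <= n)%nat -> tail n < eps.
Proof.
  intros Heps. destruct Hz as [_ Hs]. apply Series_correct in Hs.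
  assert (Hs' := proj1 (filterlim_locally _ _) Hs (mkposreal eps Heps)).
  destruct Hs' as [N HN]. exists (S N). intros n Hn. destruct n as [|n]; [lia|].
  specialize (HN n ltac:(lia)). unfold tail. rewrite rsum_sum_n.
  unfold ball in HN; simpl in HN; unfold AbsRing_ball, abs, minus, plus, opp in HN; simpl in HN.
  apply Rabs_def2 in HN.
  assert (HN' : - eps < sum_n (fun k => 1 - Cmod (z k)) n - Series (fun k => 1 - Cmod (z k)))
    by exact (proj2 HN).
  lra.
Qed.

Let rsum_split (N m : nat) :
  rsum (fun n => 1 - Cmod (z n)) (N + m)
  = rsum (fun n => 1 - Cmod (z n)) N + rsum (fun k => 1 - Cmod (z (N + k))) m.
Proof.
  induction m as [|m IH]; simpl; [rewrite Nat.add_0_r; ring|].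
  rewrite Nat.add_succ_r. simpl. rewrite IH. ring.
Qed.

Let partial_le_series (N : nat) :
  rsum (fun n => 1 - Cmod (z n)) N <= Series (fun n => 1 - Cmod (z n)).
Proof. apply rsum_le_Series; [|apply Hz]. intros n. generalize (Hz1 n); lra. Qed.

Let tail_sum (N m : nat) : rsum (fun k => 1 - Cmod (z (N + k))) m <= tail N.
Proof.
  unfold tail. generalize (rsum_split N m) (partial_le_series (N + m)). lra.
Qed.

Let tail_ge_0 (N : nat) : 0 <= tail N.
Proof. apply (tail_sum N 0). Qed.

Let one_minus_tail (N m : nat) (w : C) (s : R) : Cmod w <= s -> s < 1 ->
  Cmod (1 - tail_product N m w) <= tail N * (2 / (1 - s)).
Proof.
  intros Hw Hs. assert (P : 0 < 2 / (1 - s)) by (apply Rdiv_lt_0_compat; lra).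
  apply Rle_trans with (rsum (fun k => 1 - Cmod (z (N + k))) m * (2 / (1 - s))).
  2:{ apply Rmult_le_compat_r; [lra|apply tail_sum]. }
  induction m as [|m IH].
  - simpl. unfold tail_product; simpl. replace (1 - 1)%C with (RtoC 0) by ring. rewrite Cmod_0; lra.
  - assert (H := blaschke_factor_defect (z (N + m)) w s (Hz1 _) Hw Hs).
    assert (H1 := tail_le_1 N m w ltac:(lra)).
    change (tail_product N (S m) w) with (tail_product N m w * blaschke_factor (z (N + m)) w)%C.
    replace (1 - tail_product N m w * blaschke_factor (z (N + m)) w)%C with
      ((1 - tail_product N m w) + tail_product N m w * (1 - blaschke_factor (z (N + m)) w))%C by ring.
    eapply Rle_trans; [apply Cmod_triangle|]. rewrite Cmod_mult. simpl rsum.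
    generalize (Cmod_ge_0 (tail_product N m w)) (Cmod_ge_0 (1 - blaschke_factor (z (N + m)) w)). nra.
Qed.

Let partial_diff (N m : nat) (w : C) : Cmod w < 1 ->
  Cmod (blaschke_partial z (N + m) w - blaschke_partial z N w) <= Cmod (1 - tail_product N m w).
Proof.
  intros Hw. rewrite partial_split.
  replace (blaschke_partial z N w * tail_product N m w - blaschke_partial z N w)%C
    with (blaschke_partial z N w * - (1 - tail_product N m w))%C by ring.
  rewrite Cmod_mult, Cmod_opp. assert (H := Cmod_blaschke_partial_le_1 N w Hw).
  generalize (Cmod_ge_0 (1 - tail_product N m w)). nra.
Qed.

Let partial_cauchy (N m : nat) (w : C) (s : R) : Cmod w <= s -> s < 1 ->
  Cmod (blaschke_partial z (N + m) w - blaschke_partial z N w) <= tail N * (2 / (1 - s)).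
Proof.
  intros Hw Hs. eapply Rle_trans; [apply partial_diff; lra|]. now apply one_minus_tail.
Qed.

Let blaschke_lim (w : C) (eps : R) : Cmod w < 1 -> 0 < eps ->
  exists N, forall n, (N <= n)%nat -> Cmod (blaschke_partial z n w - blaschke z w) < eps.
Proof.
  intros Hw Heps.
  assert (K := complete_cauchy (T := C_CompleteNormedModule)
     (filtermap (fun N => blaschke_partial z N w) eventually)).
  assert (PF : ProperFilter (filtermap (fun N => blaschke_partial z N w) eventually)).
  { apply filtermap_proper_filter. apply eventually_filter. }
  (* The limit is controlled coordinate by coordinate, and the modulus is at most the sum of the two
     errors. *)
  assert (Heps2 : 0 < eps / 2) by lra.
  assert (Hc : cauchy (T := C_CompleteNormedModule) (filtermap (fun N => blaschke_partial z N w) eventually)).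
  { intros e. assert (P : 0 < 2 / (1 - Cmod w)) by (apply Rdiv_lt_0_compat; lra).
    destruct (tail_lim (e / (2 / (1 - Cmod w)))) as [N HN].
    { apply Rdiv_lt_0_compat; auto. apply cond_pos. }
    exists (blaschke_partial z N w). exists N. intros n Hn.
    apply (C_NormedModule_mixin_compat1 (blaschke_partial z N w) (blaschke_partial z n w) e).
    replace n with (N + (n - N))%nat by lia.
    eapply Rle_lt_trans; [apply (partial_cauchy N (n - N) w (Cmod w)); lra|].
    specialize (HN N (Nat.le_refl N)).
    apply (Rmult_lt_compat_r (2 / (1 - Cmod w))) in HN; auto.
    replace (e / (2 / (1 - Cmod w)) * (2 / (1 - Cmod w))) with (pos e) in HN; auto.
    field. lra. }
  specialize (K PF Hc (mkposreal (eps / 2) Heps2)).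
  destruct K as [N HN]. exists N. intros n Hn. specialize (HN n Hn).
  eapply Rle_lt_trans; [apply Cmod_le_abs|].
  destruct HN as [H1 H2].
  unfold ball in H1, H2; simpl in H1, H2; unfold AbsRing_ball, abs, minus, plus, opp in H1, H2; simpl in H1, H2.
  change (Rabs (fst (blaschke_partial z n w) + - fst (blaschke z w)) < eps / 2) in H1.
  change (Rabs (snd (blaschke_partial z n w) + - snd (blaschke z w)) < eps / 2) in H2.
  assert (H1' : Rabs (Re (blaschke_partial z n w - blaschke z w)) < eps / 2) by exact H1.
  assert (H2' : Rabs (Im (blaschke_partial z n w - blaschke z w)) < eps / 2) by exact H2.
  lra.
Qed.

Let blaschke_partial_approx (N : nat) (w : C) (s : R) : Cmod w <= s -> s < 1 ->
  Cmod (blaschke z w - blaschke_partial z N w) <= tail N * (2 / (1 - s)).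
Proof.
  intros Hw Hs. apply Rle_plus_epsilon. intros eps Heps.
  destruct (blaschke_lim w eps) as [M HM]; [lra|auto|].
  specialize (HM (N + M)%nat ltac:(lia)).
  replace (blaschke z w - blaschke_partial z N w)%C with
   (- (blaschke_partial z (N + M) w - blaschke z w)
     + (blaschke_partial z (N + M) w - blaschke_partial z N w))%C by ring.
  eapply Rle_trans; [apply Cmod_triangle|]. rewrite Cmod_opp.
  generalize (partial_cauchy N M w s Hw Hs). lra.
Qed.

Let hol_partial (N : nat) : hol 1 (blaschke_partial z N).
Proof.
  apply hol_blaschke_partial; [lra|]. intros k _. generalize (Hz1 k); lra.
Qed.

Let tail_small (s eps : R) : s < 1 -> 0 < eps ->
  exists N, forall n, (N <= n)%nat -> tail n * (2 / (1 - s)) < eps.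
Proof.
  intros Hs Heps. assert (P : 0 < 2 / (1 - s)) by (apply Rdiv_lt_0_compat; lra).
  destruct (tail_lim (eps / (2 / (1 - s)))) as [N HN]; [now apply Rdiv_lt_0_compat|].
  exists N. intros n Hn. specialize (HN n Hn).
  apply (Rmult_lt_compat_r (2 / (1 - s))) in HN; auto.
  replace (eps / (2 / (1 - s)) * (2 / (1 - s))) with eps in HN; auto. field. lra.
Qed.

(** Uniform approximation by the partial products on each circle. Continuity there is all that the
    pairings with [B] require. *)
Lemma ccont_blaschke_circle (r : R) : 0 < r < 1 -> ccont (fun t => blaschke z (polar r t)).
Proof.
  intros Hr. apply ccont_eps. intros x eps Heps.
  destruct (tail_small r (eps / 3)) as [N HN]; [lra|lra|].
  specialize (HN N (Nat.le_refl N)).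
  assert (A : forall t, Cmod (blaschke z (polar r t) - blaschke_partial z N (polar r t)) < eps / 3).
  { intros t. eapply Rle_lt_trans; [apply (blaschke_partial_approx N _ r); [rewrite Cmod_polar|]; lra|exact HN]. }
  destruct (proj1 (ccont_eps _) (ccont_circle _ r (hol_partial N) Hr) x (eps / 3)) as (d & Hd & D); [lra|].
  exists d; split; auto. intros y Hy. specialize (D y Hy).
  replace (blaschke z (polar r y) - blaschke z (polar r x))%C with
   ((blaschke z (polar r y) - blaschke_partial z N (polar r y))
    + ((blaschke_partial z N (polar r y) - blaschke_partial z N (polar r x))
    + - (blaschke z (polar r x) - blaschke_partial z N (polar r x))))%C by ring.
  eapply Rle_lt_trans; [apply Cmod_triangle|].
  assert (T := Cmod_triangle (blaschke_partial z N (polar r y) - blaschke_partial z N (polar r x))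
    (- (blaschke z (polar r x) - blaschke_partial z N (polar r x)))).
  rewrite Cmod_opp in T. generalize (A x) (A y). lra.
Qed.

(* The mean of [|1 - T|^2] over a circle is at most that of [2 - 2 Re T], i.e. [2 - 2 T(0)]. *)
Let partial_mean (N m : nat) (r : R) : 0 < r < 1 ->
  rmean (fun t => Cmod (blaschke_partial z (N + m) (polar r t) - blaschke_partial z N (polar r t)) ^ 2)
  <= 2 * tail N.
Proof.
  intros Hr.
  assert (HT : hol 1 (tail_product N m)).
  { apply (hol_cprod 1 (fun k w => blaschke_factor (z (N + k)) w)). intros k _.
    apply hol_blaschke_factor; [lra|]. generalize (Hz1 (N + k)); lra. }
  assert (CT := ccont_circle _ r HT Hr).
  assert (C1 := ccont_circle _ r (hol_partial (N + m)) Hr).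
  assert (C2 := ccont_circle _ r (hol_partial N) Hr).
  apply Rle_trans with (rmean (fun t => 2 + (-2) * Re (tail_product N m (polar r t)))).
  - apply rmean_le; auto 10 with cont.
    intros t. assert (Hp : Cmod (polar r t) < 1) by (rewrite Cmod_polar; lra).
    assert (D := partial_diff N m _ Hp). assert (T := tail_le_1 N m _ Hp).
    assert (D0 := Cmod_ge_0 (blaschke_partial z (N + m) (polar r t) - blaschke_partial z N (polar r t))).
    apply Rle_trans with (Cmod (1 - tail_product N m (polar r t)) ^ 2); [apply pow_incr; lra|].
    set (T0 := tail_product N m (polar r t)) in *.
    assert (T1 := Cmod_ge_0 T0).
    replace (1 - T0)%C with (1 + - T0)%C by ring. rewrite Cmod_1_plus_sqr, Cmod_opp.
    change (Re (- T0)) with (- Re T0). nra.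
  - rewrite rmean_plus, rmean_const, rmean_scal; auto with cont.
    assert (HT0 : cmean (fun t => tail_product N m (polar r t)) = tail_product N m 0).
    { assert (K := Cauchy_formula (1 / r) (fun w => tail_product N m (RtoC r * w)) 0).
      cbv beta in K. replace (RtoC r * 0)%C with (RtoC 0) in K by ring.
      rewrite <- K.
      - apply cmean_ext. intros t. rewrite <- polar_scal. field.
      - apply inv_gt_1; lra.
      - apply hol_scale; auto; lra.
      - rewrite Cmod_0; lra. }
    assert (E : rmean (fun t => Re (tail_product N m (polar r t))) = Re (tail_product N m 0)).
    { rewrite <- HT0. reflexivity. }
    rewrite E.
    assert (V : forall k, blaschke_factor (z k) 0 = RtoC (Cmod (z k))).
    { intros k. unfold blaschke_factor. assert (z k <> RtoC 0) by (apply Cmod_gt_0, Hz1).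
      field. auto. }
    assert (E1 : tail_product N m 0 = RtoC (rprod (fun k => Cmod (z (N + k))) m)).
    { unfold tail_product. clear -V. induction m as [|m IH]; simpl; auto.
      rewrite IH, V, <- RtoC_mult. reflexivity. }
    rewrite E1. simpl.
    (* The inequality of Weierstrass: a product of numbers in [(0, 1)] is at least 1 minus the sum
       of their distances to 1. *)
    assert (Q : 1 - rsum (fun k => 1 - Cmod (z (N + k))) m <= rprod (fun k => Cmod (z (N + k))) m <= 1).
    { clear - Hz1. induction m as [|m IH]; simpl; [lra|].
      assert (H := Hz1 (N + m)). set (p := rprod _ _) in *. set (s := rsum _ _) in *.
      assert (0 <= p) by (apply rprod_ge_0; intros; apply Cmod_ge_0). nra. }
    generalize (tail_sum N m). lra.
Qed.

(** The uniform distance between [B] and a partial product is only controlled by a bound that blows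
    up as [r] tends to 1, whereas this mean-square bound is independent of [r]: it allows [N] to be
    fixed before the radius. *)
Lemma pairing_partial_diff (N : nat) (r : R) (u v : R -> C) : 0 < r < 1 ->
  ccont u -> ccont v -> (forall t, Cmod (v t) <= 1) ->
  Cmod (cmean (fun t => (u t * (Cconj (blaschke_partial z N (polar r t) - blaschke z (polar r t)) * v t))%C))
  <= sqrt (rmean (fun t => Cmod (u t) ^ 2)) * sqrt (2 * tail N).
Proof.
  intros Hr Cu Cv Hv. apply Rle_plus_epsilon. intros eps Heps.
  set (A := rmean (fun t => Cmod (u t) ^ 2)).
  assert (HA : 0 <= A) by (apply rmean_ge_0; [auto with cont|intros; apply pow2_ge_0]).
  set (M := rmean (fun t => Cmod (u t))).
  assert (HM : 0 <= M) by (apply rmean_ge_0; [auto with cont|intros; apply Cmod_ge_0]).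
  (* At the given radius a longer partial product replaces [B] up to [eps]; the mean-square estimate
     then compares two finite products. *)
  destruct (tail_small r (eps / (M + 1))) as [n0 Hn0]; [lra|apply Rdiv_lt_0_compat; lra|].
  specialize (Hn0 (N + n0)%nat ltac:(lia)). set (m := n0) in *.
  assert (CB := ccont_blaschke_circle r Hr).
  assert (C1 := ccont_circle _ r (hol_partial (N + m)) Hr).
  assert (C2 := ccont_circle _ r (hol_partial N) Hr).
  rewrite (cmean_ext _ (fun t =>
    ((u t * (Cconj (- (blaschke_partial z (N + m) (polar r t) - blaschke_partial z N (polar r t))) * v t))
    + (u t * (Cconj (blaschke_partial z (N + m) (polar r t) - blaschke z (polar r t)) * v t)))%C)).
  2:{ intros t. rewrite Copp_conj, !Cminus_conj. ring. }
  rewrite cmean_plus by auto 10 with cont.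
  eapply Rle_trans; [apply Cmod_triangle|]. apply Rplus_le_compat.
  - apply Rsqr_incr_0_var; [|apply Rmult_le_pos; apply sqrt_pos].
    rewrite Rsqr_mult, !Rsqr_sqrt, Rsqr_pow2 by (auto; generalize (tail_ge_0 N); lra).
    eapply Rle_trans; [apply (Cmod_cmean_mult_le u (fun t => (Cconj (- (blaschke_partial z (N + m) (polar r t) - blaschke_partial z N (polar r t))) * v t)%C)); auto 10 with cont|].
    apply Rmult_le_compat_l; auto.
    eapply Rle_trans; [|apply (partial_mean N m r Hr)].
    apply rmean_le; auto 10 with cont.
    intros t. apply pow_incr. split; [apply Cmod_ge_0|].
    rewrite Cmod_mult, Cmod_conj, Cmod_opp.
    generalize (Hv t) (Cmod_ge_0 (v t))
      (Cmod_ge_0 (blaschke_partial z (N + m) (polar r t) - blaschke_partial z N (polar r t))). nra.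
  - eapply Rle_trans; [apply Cmod_cmean_le; auto 10 with cont|].
    apply Rle_trans with (rmean (fun t => eps / (M + 1) * Cmod (u t))).
    + apply rmean_le; auto 10 with cont. intros t. rewrite !Cmod_mult, Cmod_conj, Rmult_comm.
      apply Rmult_le_compat_r; [apply Cmod_ge_0|].
      assert (Hp : Cmod (polar r t) <= r) by (rewrite Cmod_polar; lra).
      assert (B := blaschke_partial_approx (N + m) (polar r t) r Hp (proj2 Hr)).
      rewrite <- Cmod_opp in B.
      replace (- (blaschke z (polar r t) - blaschke_partial z (N + m) (polar r t)))%C
        with (blaschke_partial z (N + m) (polar r t) - blaschke z (polar r t))%C in B by ring.
      generalize (Hv t) (Cmod_ge_0 (v t))
       (Cmod_ge_0 (blaschke_partial z (N + m) (polar r t) - blaschke z (polar r t))). nra.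
    + rewrite rmean_scal by auto with cont. fold M.
      assert (eps / (M + 1) * (M + 1) = eps) by (field; lra). nra.
Qed.

Lemma blaschke_tail_limit (eps : R) : 0 < eps -> exists N, sqrt (2 * tail N) < eps.
Proof.
  intros Heps. destruct (tail_lim (eps ^ 2 / 2)) as [N HN].
  { apply Rdiv_lt_0_compat; [|lra]. now apply pow_lt. }
  exists N. specialize (HN N (Nat.le_refl N)).
  rewrite <- (sqrt_pow2 eps) by lra. apply sqrt_lt_1_alt.
  generalize (tail_ge_0 N). lra.
Qed.

(** [L] grows with [N] but not with the angle, and it is only used once [N] has been fixed. *)
Lemma blaschke_partial_radial (N : nat) : exists L, 0 <= L /\ forall r t, 0 <= r <= 1 ->
  Cmod (blaschke_partial z N (polar 1 t) - blaschke_partial z N (polar r t)) <= L * (1 - r).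
Proof.
  induction N as [|N (L & HL & IH)].
  - exists 0; split; [lra|]. intros r t Hr. simpl. replace (1 - 1)%C with (RtoC 0) by ring.
    rewrite Cmod_0; lra.
  - set (a := z N). assert (Ha := Hz1 N). fold a in Ha.
    assert (N0 : a <> RtoC 0) by (apply Cmod_gt_0; lra).
    assert (D := defect_pos a (proj2 Ha)).
    set (l := 1 / ((1 - Cmod a) * (1 - Cmod a))).
    assert (Hl : 0 <= l) by (apply Rlt_le, Rdiv_lt_0_compat; [lra|]; apply Rmult_lt_0_compat; lra).
    exists (L + l). split; [lra|]. intros r t Hr. simpl. fold a.
    assert (Hker : forall s, 0 <= s <= 1 -> 1 - Cmod a <= Cmod (1 - Cconj a * polar s t)).
    { intros s Hs. eapply Rle_trans; [|apply Cmod_1_minus_ge].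
      rewrite Cmod_mult, Cmod_conj, Cmod_polar by lra. nra. }
    assert (H1 := Hker 1 ltac:(lra)). assert (H2 := Hker r Hr).
    assert (N1 : (1 - Cconj a * polar 1 t)%C <> RtoC 0) by (apply Cmod_gt_0; lra).
    assert (N2 : (1 - Cconj a * polar r t)%C <> RtoC 0) by (apply Cmod_gt_0; lra).
    assert (Hb : Cmod (blaschke_factor a (polar 1 t) - blaschke_factor a (polar r t)) <= l * (1 - r)).
    { assert (Ed : RtoC (defect a) = (1 - a * Cconj a)%C).
      { unfold defect. rewrite RtoC_minus, Cmod2_conj. reflexivity. }
      replace (blaschke_factor a (polar 1 t) - blaschke_factor a (polar r t))%C with
       (RtoC (Cmod a) / a * (- RtoC (defect a) * (polar 1 t - polar r t)
          / ((1 - Cconj a * polar 1 t) * (1 - Cconj a * polar r t))))%C.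
      2:{ rewrite Ed. unfold blaschke_factor. field. auto. }
      rewrite (polar_scal r). replace (polar 1 t - RtoC r * polar 1 t)%C with (RtoC (1 - r) * polar 1 t)%C
        by (rewrite RtoC_minus; ring).
      rewrite <- (polar_scal r).
      rewrite Cmod_mult, Cmod_div, Cmod_RtoC_pos by (auto; lra).
      replace (Cmod a / Cmod a) with 1 by (field; lra). rewrite Rmult_1_l.
      replace (l * (1 - r)) with ((1 - r) / ((1 - Cmod a) * (1 - Cmod a))) by (unfold l; field; lra).
      apply Cmod_div_le.
      - rewrite !Cmod_mult, Cmod_opp, Cmod_unit, !Cmod_RtoC_pos by lra. nra.
      - apply Rmult_lt_0_compat; lra.
      - rewrite Cmod_mult. apply Rmult_le_compat; lra. }
    assert (IHr := IH r t Hr).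
    assert (M1 : Cmod (blaschke_factor a (polar 1 t)) = 1) by now apply Cmod_blaschke_factor_unit.
    assert (M2 : Cmod (blaschke_partial z N (polar r t)) <= 1).
    { destruct (Req_dec r 1) as [->|].
      - rewrite Cmod_blaschke_partial_unit; auto; lra.
      - apply Cmod_blaschke_partial_le_1. rewrite Cmod_polar; lra. }
    set (B1 := blaschke_partial z N (polar 1 t)) in *. set (B2 := blaschke_partial z N (polar r t)) in *.
    set (b1 := blaschke_factor a (polar 1 t)) in *. set (b2 := blaschke_factor a (polar r t)) in *.
    replace (B1 * b1 - B2 * b2)%C with ((B1 - B2) * b1 + B2 * (b1 - b2))%C by ring.
    eapply Rle_trans; [apply Cmod_triangle|]. rewrite !Cmod_mult, M1.
    generalize (Cmod_ge_0 (b1 - b2)) (Cmod_ge_0 B2). nra.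
Qed.

End InfiniteBlaschke.

(** * Orthogonality to B H2 and the projection error *)

Lemma H2_orthogonal_eps (f g : C -> C) (eps : R) : H2_orthogonal f g -> 0 < eps ->
  exists d, 0 < d /\ forall r, 1 - d < r < 1 -> Cmod (circle_inner f g r) < eps.
Proof.
  intros H Heps. apply at_left_1_iff.
  assert (Heps2 : 0 < eps / 2) by lra.
  assert (K := proj1 (filterlim_locally (U := C_UniformSpace) _ _) H (mkposreal (eps / 2) Heps2)).
  refine (filter_imp _ _ _ K). intros r [H1 H2].
  assert (H1' : Rabs (Re (circle_inner f g r) - 0) < eps / 2) by exact H1.
  assert (H2' : Rabs (Im (circle_inner f g r) - 0) < eps / 2) by exact H2.
  rewrite Rminus_0_r in H1', H2'. eapply Rle_lt_trans; [apply Cmod_le_abs|]. lra.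
Qed.

Lemma orthogonal_moments_eps (z : nat -> C) (f : C -> C) (K : nat) (eps : R) :
  model_space z f -> 0 < eps ->
  exists d, 0 < d /\ forall r, 1 - d < r < 1 -> forall k, (k < K)%nat ->
    Cmod (circle_inner f (fun w => (blaschke z w * Cpow w k)%C) r) < eps.
Proof.
  intros [_ Hf] Heps. induction K as [|K (d & Hd & IH)].
  - exists 1; split; [lra|]. intros; lia.
  - destruct (H2_orthogonal_eps _ _ eps (Hf _ (H2_pow K)) Heps) as (d' & Hd' & H).
    exists (Rmin d d'); split; [now apply Rmin_glb_lt|]. intros r Hr k Hk.
    assert (H1 := Rmin_l d d'). assert (H2 := Rmin_r d d').
    destruct (Nat.eq_dec k K) as [->|]; [apply H; lra|]. apply IH; [lra|lia].
Qed.

Lemma geometric_expansion (x : C) (K : nat) : (1 - x)%C <> RtoC 0 ->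
  (/ (1 - x))%C = (csum (fun k => Cpow x k) K + Cpow x K / (1 - x))%C.
Proof.
  intros H. induction K as [|K IH]; simpl.
  - field; auto.
  - rewrite IH. field. auto.
Qed.

Lemma rmean_Cmod_le (u : R -> C) : ccont u ->
  rmean (fun t => Cmod (u t)) <= sqrt (rmean (fun t => Cmod (u t) ^ 2)).
Proof.
  intros Cu.
  assert (H := rmean_CauchySchwarz (fun t => Cmod (u t)) (fun _ => 1)
     (rcont_Cmod u Cu) (rcont_const 1)).
  cbv beta in H.
  rewrite (rmean_ext (fun _ => 1 ^ 2) (fun _ => 1)), rmean_const, Rmult_1_r in H by (intros; ring).
  rewrite (rmean_ext (fun t => Cmod (u t) * 1) (fun t => Cmod (u t))) in H by (intros; ring).
  rewrite <- (sqrt_pow2 (rmean (fun t => Cmod (u t)))).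
  - now apply sqrt_le_1_alt.
  - apply rmean_ge_0; auto with cont. intros; apply Cmod_ge_0.
Qed.

Lemma rsum_const (c : R) (n : nat) : rsum (fun _ => c) n = INR n * c.
Proof.
  induction n as [|n IH]; [simpl; ring|]. rewrite S_INR. simpl rsum. rewrite IH. ring.
Qed.

(* The pairings of [f(rho .)] with [B_N z^k] tend to those of [f] with [B z^k], which vanish; the
   geometric series makes finitely many [k] suffice, uniformly in [w]. *)
Lemma projection_error_small (z : nat -> C) (f : C -> C) (r1 eps : R) :
  blaschke_sequence z -> model_space z f -> 0 <= r1 < 1 -> 0 < eps ->
  exists N d, 0 < d /\ forall rho, 1 - d < rho < 1 -> forall w, Cmod w <= r1 ->
    Cmod (cmean (fun t => (f (RtoC rho * polar 1 t) * Cconj (blaschke_partial z N (polar 1 t))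
      / (1 - w * Cconj (polar 1 t)))%C)) <= eps.
Proof.
  intros Hz Hf Hr1 Heps.
  assert (Hz1 : forall n, 0 < Cmod (z n) < 1) by apply Hz.
  assert (Hf2 : H2 f) by apply Hf.
  assert (Hol := holomorphic_hol f (proj1 Hf2)).
  set (A := Rabs (H2_norm f) + 1).
  assert (HA : 0 < A) by (unfold A; generalize (Rabs_pos (H2_norm f)); lra).
  destruct (H2_norm_limit f 1 Hf2 Rlt_0_1) as (d1 & Hd1 & D1).
  destruct (pow_lt_1_zero r1) with (y := eps * (1 - r1) / (4 * A)) as [K HK].
  { rewrite Rabs_pos_eq; lra. }
  { apply Rdiv_lt_0_compat; [|lra]. apply Rmult_lt_0_compat; lra. }
  specialize (HK K (Nat.le_refl K)).
  assert (HK' : A * (r1 ^ K / (1 - r1)) <= eps / 4).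
  { apply (Rle_lt_trans _ _ _ (Rle_abs _)) in HK.
    apply (Rmult_lt_compat_r (A / (1 - r1))) in HK; [|apply Rdiv_lt_0_compat; lra].
    replace (eps * (1 - r1) / (4 * A) * (A / (1 - r1))) with (eps / 4) in HK by (field; lra).
    apply Rlt_le. eapply Rle_lt_trans; [|exact HK]. apply Req_le. field. lra. }
  assert (PK := pos_INR K).
  (* Each of the [K] moments will cost [3 * e0], together at most [3 / 4 * eps]; the remainder of
     the geometric series takes the last quarter. *)
  set (e0 := eps / (4 * (INR K + 1))).
  assert (He0 : 0 < e0) by (apply Rdiv_lt_0_compat; lra).
  destruct (blaschke_tail_limit z Hz (e0 / A)) as [N HN]; [now apply Rdiv_lt_0_compat|].
  destruct (blaschke_partial_radial z Hz N) as (L & HL & HL').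
  (* The inner product at radius [rho] carries a factor [rho^k]. As [rho > 1 / 2], removing it costs
     at most [2^K]. *)
  destruct (orthogonal_moments_eps z f K (e0 / 2 ^ K) Hf) as (d2 & Hd2 & D2).
  { apply Rdiv_lt_0_compat; auto. apply pow_lt; lra. }
  set (d3 := e0 / (A * (L + 1))).
  assert (Hd3 : 0 < d3) by (apply Rdiv_lt_0_compat; auto; apply Rmult_lt_0_compat; lra).
  exists N, (Rmin (Rmin d1 d2) (Rmin d3 (1 / 2))). split.
  { repeat apply Rmin_glb_lt; lra. }
  intros rho Hrho w Hw.
  assert (M1 := Rmin_l (Rmin d1 d2) (Rmin d3 (1 / 2))). assert (M2 := Rmin_r (Rmin d1 d2) (Rmin d3 (1 / 2))).
  assert (M3 := Rmin_l d1 d2). assert (M4 := Rmin_r d1 d2).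
  assert (M5 := Rmin_l d3 (1 / 2)). assert (M6 := Rmin_r d3 (1 / 2)).
  assert (Hr : 0 < rho < 1) by lra.
  set (F := fun t => f (polar rho t)).
  assert (CF : ccont F) by (apply ccont_circle; auto).
  assert (CB := ccont_blaschke_unit z N Hz1).
  assert (CBr := ccont_blaschke_circle z Hz rho Hr).
  assert (CNr : ccont (fun t => blaschke_partial z N (polar rho t))).
  { apply ccont_circle; auto. apply hol_blaschke_partial; [lra|].
    intros k _. generalize (Hz1 k); lra. }
  set (m := sqrt (rmean (fun t => Cmod (F t) ^ 2))).
  assert (Hm : m <= A).
  { specialize (D1 rho ltac:(lra)). rewrite circle_mean2_eq in D1 by exact CF. fold (F) m in D1.
    apply Rabs_def2 in D1. unfold A. generalize (Rle_abs (H2_norm f)). unfold m, F. unfold m, F in D1. lra. }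
  assert (HmF := rmean_Cmod_le F CF). fold m in HmF.
  set (H := fun t => (F t * Cconj (blaschke_partial z N (polar 1 t)))%C).
  assert (CH : ccont H) by (unfold H; auto with cont).
  assert (EH : forall t, Cmod (H t) = Cmod (F t)).
  { intros t. unfold H. rewrite Cmod_mult, Cmod_conj, Cmod_blaschke_partial_unit by auto. ring. }
  assert (Nw : forall t, (1 - w * Cconj (polar 1 t))%C <> RtoC 0).
  { intros; apply kernel_neq_0; lra. }
  rewrite (cmean_ext _ (fun t => (csum (fun k => (Cpow w k * (H t * Cpow (Cconj (polar 1 t)) k))%C) K
    + Cpow w K * (H t * (Cpow (Cconj (polar 1 t)) K / (1 - w * Cconj (polar 1 t)))))%C)).
  2:{ intros t. rewrite <- polar_scal. fold (F t). fold (H t). unfold Cdiv at 1.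
      rewrite (geometric_expansion _ K) by auto.
      rewrite (csum_ext (fun k => (Cpow w k * _)%C) (fun k => (H t * Cpow (w * Cconj (polar 1 t)) k)%C)).
      - rewrite csum_scal, Cpow_mult_l. change (csum (Cpow (w * Cconj (polar 1 t))) K)
          with (csum (fun k => Cpow (w * Cconj (polar 1 t)) k) K).
        field. auto.
      - intros k _. rewrite Cpow_mult_l. ring. }
  assert (Ck : forall k, ccont (fun t => (Cpow w k * (H t * Cpow (Cconj (polar 1 t)) k))%C))
    by auto 10 with cont.
  assert (CK : ccont (fun t => (Cpow (Cconj (polar 1 t)) K / (1 - w * Cconj (polar 1 t)))%C)).
  { apply ccont_div; auto with cont. }
  rewrite cmean_plus; [|apply (ccont_csum (fun k t => (Cpow w k * (H t * Cpow (Cconj (polar 1 t)) k))%C)); auto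
     |auto with cont].
  rewrite (cmean_csum (fun k t => (Cpow w k * (H t * Cpow (Cconj (polar 1 t)) k))%C)) by auto.
  rewrite cmean_scal by auto with cont.
  assert (W0 := Cmod_ge_0 w).
  eapply Rle_trans; [apply Cmod_triangle|].
  assert (T2 : Cmod (Cpow w K * cmean (fun t => (H t * (Cpow (Cconj (polar 1 t)) K / (1 - w * Cconj (polar 1 t))))%C))
    <= eps / 4).
  { eapply Rle_trans; [|exact HK']. rewrite Cmod_mult, Cmod_pow.
    replace (A * (r1 ^ K / (1 - r1))) with (r1 ^ K * (/ (1 - r1) * A)) by (field; lra).
    apply Rmult_le_compat; [now apply pow_le|apply Cmod_ge_0|now apply pow_incr|].
    eapply Rle_trans; [apply Cmod_cmean_le; auto with cont|].
    apply Rle_trans with (rmean (fun t => / (1 - r1) * Cmod (F t))).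
    - apply rmean_le; auto with cont. intros t. rewrite Cmod_mult, EH, Rmult_comm.
      apply Rmult_le_compat_r; [apply Cmod_ge_0|].
      replace (/ (1 - r1)) with (1 / (1 - r1)) by (field; lra).
      apply Cmod_div_le; [|lra|].
      + rewrite Cmod_pow, Cmod_conj, Cmod_unit, pow1. lra.
      + generalize (kernel_ge w t); lra.
    - rewrite rmean_scal by auto with cont. apply Rmult_le_compat_l; [|lra].
      apply Rlt_le, Rinv_0_lt_compat; lra. }
  assert (T1 : Cmod (csum (fun k => cmean (fun t => (Cpow w k * (H t * Cpow (Cconj (polar 1 t)) k))%C)) K)
     <= INR K * (3 * e0)).
  { eapply Rle_trans; [apply Cmod_csum_le|]. rewrite <- rsum_const. apply rsum_le. intros k Hk.
    rewrite cmean_scal by auto 10 with cont.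
    rewrite Cmod_mult, Cmod_pow.
    apply Rle_trans with (1 * Cmod (cmean (fun t => (H t * Cpow (Cconj (polar 1 t)) k)%C))).
    { apply Rmult_le_compat_r; [apply Cmod_ge_0|]. rewrite <- (pow1 k). apply pow_incr; lra. }
    rewrite Rmult_1_l.
    set (v := fun t => Cpow (Cconj (polar 1 t)) k).
    assert (Cv : ccont v) by (unfold v; auto with cont).
    assert (Ev : forall t, Cmod (v t) = 1).
    { intros t. unfold v. rewrite Cmod_pow, Cmod_conj, Cmod_unit, pow1. reflexivity. }
    (* From [B_N] on the unit circle to [B_N] at radius [rho], then to [B] at radius [rho]: one
       error for the radius, one for the truncation, and the true moment. *)
    rewrite (cmean_ext _ (fun t =>
      (F t * (Cconj (blaschke_partial z N (polar 1 t) - blaschke_partial z N (polar rho t)) * v t)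
      + (F t * (Cconj (blaschke_partial z N (polar rho t) - blaschke z (polar rho t)) * v t)
      + F t * (Cconj (blaschke z (polar rho t)) * v t)))%C)).
    2:{ intros t. unfold H. fold (v t). rewrite !Cminus_conj. ring. }
    rewrite !cmean_plus by auto 10 with cont.
    eapply Rle_trans; [apply Cmod_triangle|].
    replace (3 * e0) with (e0 + (e0 + e0)) by ring.
    apply Rplus_le_compat; [|eapply Rle_trans; [apply Cmod_triangle|]; apply Rplus_le_compat].
    - eapply Rle_trans; [apply Cmod_cmean_le; auto 10 with cont|].
      apply Rle_trans with (rmean (fun t => L * (1 - rho) * Cmod (F t))).
      + apply rmean_le; auto 10 with cont. intros t. rewrite !Cmod_mult, Cmod_conj, Ev, Rmult_1_r, Rmult_comm.
        apply Rmult_le_compat_r; [apply Cmod_ge_0|]. apply HL'; lra.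
      + rewrite rmean_scal by auto with cont.
        assert (Hd : (1 - rho) * (A * (L + 1)) <= e0).
        { apply Rle_trans with (d3 * (A * (L + 1))).
          - apply Rmult_le_compat_r; [|lra]. apply Rlt_le, Rmult_lt_0_compat; lra.
          - unfold d3. apply Req_le. field. lra. }
        assert (Q : rmean (fun t => Cmod (F t)) * (L * (1 - rho)) <= A * (L * (1 - rho))).
        { apply Rmult_le_compat_r; [|lra]. apply Rmult_le_pos; lra. }
        assert (0 <= A * (1 - rho)) by (apply Rmult_le_pos; lra). nra.
    - eapply Rle_trans; [apply pairing_partial_diff; auto; intros; rewrite Ev; lra|]. fold m.
      apply Rle_trans with (A * (e0 / A)).
      + apply Rmult_le_compat; auto; try apply sqrt_pos. lra.
      + apply Req_le. field. lra.
    - assert (Ci := D2 rho ltac:(lra) k Hk).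
      rewrite circle_inner_eq in Ci; [|exact CF|auto with cont].
      rewrite (cmean_ext _ (fun t => (RtoC (rho ^ k) * (F t * (Cconj (blaschke z (polar rho t)) * v t)))%C)) in Ci.
      2:{ intros t.
          assert (E : Cconj (Cpow (polar rho t) k) = (RtoC (rho ^ k) * v t)%C).
          { unfold v. rewrite Cpow_conj, (polar_scal rho t), Cmult_conj, Cpow_mult_l, RtoC_pow.
            do 2 f_equal. unfold Cconj, RtoC; simpl; f_equal; ring. }
          rewrite Cmult_conj, E. unfold F. ring. }
      rewrite cmean_scal, Cmod_mult in Ci by auto 10 with cont.
      rewrite Cmod_RtoC_pos in Ci by (apply pow_le; lra).
      set (c := Cmod _) in *. assert (Hc : 0 <= c) by apply Cmod_ge_0.
      assert (P2 : 0 < 2 ^ K) by (apply pow_lt; lra).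
      assert (Hp : 1 <= rho ^ k * 2 ^ K).
      { apply Rle_trans with ((rho * 2) ^ k).
        - rewrite <- (pow1 k). apply pow_incr; lra.
        - rewrite Rpow_mult_distr. apply Rmult_le_compat_l; [apply pow_le; lra|].
          apply Rle_pow; [lra|lia]. }
      apply (Rmult_lt_compat_r (2 ^ K)) in Ci; auto.
      replace (e0 / 2 ^ K * 2 ^ K) with e0 in Ci by (field; lra). nra. }
  assert (INR K * (3 * e0) <= 3 * (eps / 4)).
  { assert (E : (INR K + 1) * e0 = eps / 4) by (unfold e0; field; lra). lra. }
  lra.
Qed.

(** * Powers and an integral estimate *)

Lemma rpow_Rpower (x a : R) : 0 < x -> rpow x a = Rpower x a.
Proof. intros. unfold rpow. destruct Rlt_dec; [reflexivity|lra]. Qed.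

Lemma rpow_0 (x a : R) : x <= 0 -> rpow x a = 0.
Proof. intros. unfold rpow. destruct Rlt_dec; [lra|reflexivity]. Qed.

Lemma Rpower_pos (x a : R) : 0 < Rpower x a.
Proof. apply exp_pos. Qed.

Lemma rpow_ge_0 (x a : R) : 0 <= rpow x a.
Proof. unfold rpow. destruct Rlt_dec; [apply Rlt_le, Rpower_pos|lra]. Qed.

Lemma rpow_le (x y a : R) : 0 < a -> x <= y -> rpow x a <= rpow y a.
Proof.
  intros Ha H. unfold rpow at 1. destruct Rlt_dec as [Hx|]; [|apply rpow_ge_0].
  rewrite rpow_Rpower by lra. apply Rle_Rpower_l; lra.
Qed.

Lemma rpow_mult (x y a : R) : 0 <= x -> 0 <= y -> rpow (x * y) a = rpow x a * rpow y a.
Proof.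
  intros Hx Hy.
  destruct (Req_dec x 0) as [->|]; [rewrite Rmult_0_l, !(rpow_0 0) by lra; ring|].
  destruct (Req_dec y 0) as [->|]; [rewrite Rmult_0_r, !(rpow_0 0) by lra; ring|].
  rewrite !rpow_Rpower by (try apply Rmult_lt_0_compat; lra).
  symmetry. apply Rpower_mult_distr; lra.
Qed.

Lemma Rpower_ge_base (u a : R) : 0 < u <= 1 -> a <= 1 -> u <= Rpower u a.
Proof.
  intros Hu Ha. rewrite <- (Rpower_1 u) at 1 by lra. unfold Rpower.
  assert (ln u <= 0) by (rewrite <- ln_1; apply ln_le; lra).
  destruct (Req_dec (1 * ln u) (a * ln u)) as [->|]; [lra|].
  apply Rlt_le, exp_increasing. nra.
Qed.

(** Scaling to [x + y = 1] reduces this to [u <= u^a] for [0 < u <= 1]. *)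
Lemma rpow_plus (x y a : R) : 0 <= x -> 0 <= y -> a <= 1 ->
  rpow (x + y) a <= rpow x a + rpow y a.
Proof.
  intros Hx Hy Ha.
  destruct (Req_dec x 0) as [->|]; [rewrite Rplus_0_l; generalize (rpow_ge_0 0 a); lra|].
  destruct (Req_dec y 0) as [->|]; [rewrite Rplus_0_r; generalize (rpow_ge_0 0 a); lra|].
  rewrite !rpow_Rpower by lra.
  assert (E : forall u, 0 < u -> Rpower u a = Rpower (x + y) a * Rpower (u / (x + y)) a).
  { intros u Hu. rewrite Rpower_mult_distr; [f_equal; field; lra|lra|apply Rdiv_lt_0_compat; lra]. }
  rewrite (E x), (E y) by lra.
  assert (G : forall u, 0 < u <= x + y -> u / (x + y) <= Rpower (u / (x + y)) a).
  { intros u Hu. apply Rpower_ge_base; auto. split; [apply Rdiv_lt_0_compat; lra|].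
    apply (Rmult_le_reg_r (x + y)); [lra|]. unfold Rdiv. rewrite Rmult_assoc, Rinv_l; lra. }
  assert (G1 := G x ltac:(lra)). assert (G2 := G y ltac:(lra)).
  assert (x / (x + y) + y / (x + y) = 1) by (field; lra).
  assert (P := Rpower_pos (x + y) a). nra.
Qed.

Lemma rpow_rsum (u : nat -> R) (a : R) (n : nat) : 0 < a <= 1 -> (forall k, 0 <= u k) ->
  rpow (rsum u n) a <= rsum (fun k => rpow (u k) a) n.
Proof.
  intros Ha Hu. induction n as [|n IH]; simpl; [rewrite rpow_0; lra|].
  eapply Rle_trans; [apply rpow_plus|]; auto; try lra. apply rsum_ge_0; auto.
Qed.

Lemma rpow_inv (x a : R) : 0 <= x -> 0 < a -> rpow (rpow x a) (1 / a) = x.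
Proof.
  intros Hx Ha. destruct (Req_dec x 0) as [->|].
  - rewrite (rpow_0 0) by lra. apply rpow_0; lra.
  - rewrite (rpow_Rpower x), rpow_Rpower by (try apply Rpower_pos; lra).
    rewrite Rpower_mult. replace (a * (1 / a)) with 1 by (field; lra). apply Rpower_1; lra.
Qed.

Lemma Rpower_continuous (x a : R) : 0 < x -> continuous (fun y => Rpower y a) x.
Proof.
  intros Hx. apply (ex_derive_continuous (fun y => Rpower y a)).
  exists (a * Rpower x (a - 1)). apply is_derive_Reals. now apply derivable_pt_lim_power.
Qed.

(** At 0 the convention [rpow 0 a = 0] is essential. The derivative may vanish on the circle, so its
    power would otherwise be discontinuous there. *)
Lemma rcont_rpow (a : R) : 0 < a -> rcont (fun x => rpow x a).
Proof.
  intros Ha x. destruct (Rtotal_order x 0) as [H|[->|H]].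
  - apply cont_eps. intros eps Heps. exists (- x). split; [lra|]. intros y Hy.
    apply Rabs_def2 in Hy. rewrite !rpow_0, Rminus_diag, Rabs_R0; lra.
  - apply cont_eps. intros eps Heps. exists (Rpower eps (1 / a)). split; [apply Rpower_pos|].
    intros y Hy. rewrite (rpow_0 0), Rminus_0_r in * by lra.
    rewrite Rabs_pos_eq by apply rpow_ge_0.
    destruct (Rle_lt_dec y 0) as [Hy0|Hy0]; [rewrite rpow_0; lra|].
    rewrite Rabs_pos_eq in Hy by lra. rewrite rpow_Rpower by auto.
    replace eps with (Rpower (Rpower eps (1 / a)) a).
    + apply Rlt_Rpower_l; lra.
    + rewrite Rpower_mult. replace (1 / a * a) with 1 by (field; lra). now apply Rpower_1.
  - apply (continuous_ext_loc _ (fun y => Rpower y a)).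
    + exists (mkposreal x H). intros y Hy.
      unfold ball in Hy; simpl in Hy; unfold AbsRing_ball, abs, minus, plus, opp in Hy; simpl in Hy.
      apply Rabs_def2 in Hy. symmetry. apply rpow_Rpower. lra.
    + now apply Rpower_continuous.
Qed.

(** The exponential lies above its tangent at [m], the weighted mean of [ln x] and [ln y]; in the
    weighted sum the linear terms cancel. *)
Lemma Young (x y a : R) : 0 < x -> 0 < y -> 0 <= a <= 1 ->
  Rpower x a * Rpower y (1 - a) <= a * x + (1 - a) * y.
Proof.
  intros Hx Hy Ha. unfold Rpower. rewrite <- exp_plus.
  set (m := a * ln x + (1 - a) * ln y).
  assert (G : forall u, 0 < u -> exp m * (1 + (ln u - m)) <= u).
  { intros u Hu. rewrite <- (exp_ln u Hu) at 2.
    replace (ln u) with (m + (ln u - m)) at 2 by ring. rewrite exp_plus.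
    apply Rmult_le_compat_l; [apply Rlt_le, exp_pos|]. apply exp_ineq1_le. }
  assert (G1 := G x Hx). assert (G2 := G y Hy).
  apply Rle_trans with (a * (exp m * (1 + (ln x - m))) + (1 - a) * (exp m * (1 + (ln y - m)))).
  - apply Req_le. unfold m at 3 5. ring.
  - apply Rplus_le_compat; apply Rmult_le_compat_l; lra.
Qed.

(** Young's inequality is applied termwise to [c n ^ 2 / A ^ 2] and [v n / V]. Summed, the weights
    [s / 2] and [1 - s / 2] add up to 1. *)
Lemma Hoelder_rsum (c v : nat -> R) (N : nat) (A V s : R) :
  0 < s < 2 -> 0 < A -> 0 < V -> (forall n, 0 <= c n) -> (forall n, 0 < v n) ->
  rsum (fun n => c n ^ 2) N <= A ^ 2 -> rsum v N <= V ->
  rsum (fun n => rpow (c n) s * Rpower (v n) (1 - s / 2)) N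
  <= Rpower A s * Rpower V (1 - s / 2).
Proof.
  intros Hs HA HV Hc Hv HcA HvV.
  set (W := Rpower A s * Rpower V (1 - s / 2)).
  assert (HW : 0 < W) by (apply Rmult_lt_0_compat; apply Rpower_pos).
  assert (PA : 0 < A ^ 2) by now apply pow_lt.
  apply Rle_trans with (rsum (fun n => W * s / 2 / A ^ 2 * c n ^ 2 + W * (1 - s / 2) / V * v n) N).
  - apply rsum_le. intros n _.
    destruct (Req_dec (c n) 0) as [E|E].
    { rewrite E, rpow_0, Rmult_0_l by lra.
      assert (0 <= W * (1 - s / 2) / V * v n); [|lra].
      apply Rmult_le_pos; [|apply Rlt_le, Hv]. apply Rlt_le, Rdiv_lt_0_compat; auto.
      apply Rmult_lt_0_compat; lra. }
    assert (Hcn : 0 < c n) by (generalize (Hc n); lra).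
    assert (Y := Young (c n ^ 2 / A ^ 2) (v n / V) (s / 2)).
    assert (P1 : 0 < c n ^ 2 / A ^ 2) by (apply Rdiv_lt_0_compat; auto; now apply pow_lt).
    assert (P2 : 0 < v n / V) by now apply Rdiv_lt_0_compat.
    specialize (Y P1 P2 ltac:(lra)).
    assert (E1 : rpow (c n) s = Rpower A s * Rpower (c n ^ 2 / A ^ 2) (s / 2)).
    { rewrite rpow_Rpower by auto.
      replace (c n ^ 2 / A ^ 2) with ((c n / A) ^ 2) by (field; lra).
      assert (P3 : 0 < c n / A) by now apply Rdiv_lt_0_compat.
      rewrite <- (Rpower_pow 2) by auto. rewrite Rpower_mult.
      replace (INR 2 * (s / 2)) with s by (simpl; field).
      rewrite Rpower_mult_distr by auto. f_equal. field; lra. }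
    assert (E2 : Rpower (v n) (1 - s / 2) = Rpower V (1 - s / 2) * Rpower (v n / V) (1 - s / 2)).
    { rewrite Rpower_mult_distr by auto. f_equal. field; lra. }
    rewrite E1, E2.
    replace (Rpower A s * Rpower (c n ^ 2 / A ^ 2) (s / 2) * (Rpower V (1 - s / 2) * Rpower (v n / V) (1 - s / 2)))
      with (W * (Rpower (c n ^ 2 / A ^ 2) (s / 2) * Rpower (v n / V) (1 - s / 2))) by (unfold W; ring).
    apply (Rmult_le_compat_l W) in Y; [|lra]. eapply Rle_trans; [exact Y|].
    apply Req_le. field. lra.
  - rewrite rsum_plus, !rsum_scal.
    assert (Q1 : W * s / 2 / A ^ 2 * rsum (fun n => c n ^ 2) N <= W * s / 2 / A ^ 2 * A ^ 2).
    { apply Rmult_le_compat_l; auto. apply Rlt_le, Rdiv_lt_0_compat; auto.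
      apply Rdiv_lt_0_compat; [|lra]. apply Rmult_lt_0_compat; lra. }
    assert (Q2 : W * (1 - s / 2) / V * rsum v N <= W * (1 - s / 2) / V * V).
    { apply Rmult_le_compat_l; auto. apply Rlt_le, Rdiv_lt_0_compat; auto.
      apply Rmult_lt_0_compat; lra. }
    replace (W * s / 2 / A ^ 2 * A ^ 2) with (W * s / 2) in Q1 by (field; lra).
    replace (W * (1 - s / 2) / V * V) with (W * (1 - s / 2)) in Q2 by (field; lra).
    lra.
Qed.

(** * Integral means of powers of the kernel *)

Lemma polar_form (z : C) : exists alpha, z = polar (Cmod z) alpha.
Proof.
  destruct (Req_dec (Cmod z) 0) as [E|E].
  { exists 0. rewrite E. apply Cmod_eq_0 in E. rewrite E. unfold polar, RtoC. f_equal; ring. }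
  assert (P : 0 < Cmod z) by (generalize (Cmod_ge_0 z); lra).
  assert (S := Cmod_sqr z). destruct z as [x y]. cbn [Re Im fst snd] in S.
  set (m := Cmod (x, y)) in *.
  assert (Bx : -1 <= x / m <= 1).
  { split; apply (Rmult_le_reg_r m); auto; replace (x / m * m) with x by (field; lra); nra. }
  assert (Cx : cos (acos (x / m)) = x / m) by now apply cos_acos.
  assert (Sx : sin (acos (x / m)) = Rabs (y / m)).
  { rewrite sin_acos by auto. rewrite <- sqrt_Rsqr_abs. f_equal. unfold Rsqr.
    apply (Rmult_eq_reg_r (m ^ 2)); [|nra]. replace ((1 - x / m * (x / m)) * m ^ 2) with (m ^ 2 - x ^ 2) by (field; lra).
    replace (y / m * (y / m) * m ^ 2) with (y ^ 2) by (field; lra). lra. }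
  destruct (Rle_lt_dec 0 (y / m)) as [Hy|Hy].
  - exists (acos (x / m)). unfold polar. rewrite Cx, Sx, Rabs_pos_eq by auto. f_equal; field; lra.
  - exists (- acos (x / m)). unfold polar. rewrite cos_neg, sin_neg, Cx, Sx, Rabs_left by auto.
    f_equal; field; lra.
Qed.

Lemma RInt_period_shift (g : R -> R) (T c : R) : rcont g -> (forall t, g (t + T) = g t) ->
  RInt g c (c + T) = RInt g 0 T.
Proof.
  intros Hg HT.
  assert (ex : forall a b, ex_RInt g a b) by (intros; now apply rcont_ex_RInt).
  assert (E : RInt g T (c + T) = RInt g 0 c).
  { assert (K := RInt_comp_lin (V := R_CompleteNormedModule) g 1 T 0 c (ex _ _)).
    replace (1 * 0 + T) with T in K by ring. replace (1 * c + T) with (c + T) in K by ring.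
    rewrite <- K. apply RInt_ext. intros t _. unfold scal; simpl; unfold mult; simpl.
    rewrite !Rmult_1_l. apply HT. }
  assert (C1 := RInt_Chasles (V := R_CompleteNormedModule) g c 0 (c + T) (ex _ _) (ex _ _)).
  assert (C2 := RInt_Chasles (V := R_CompleteNormedModule) g 0 T (c + T) (ex _ _) (ex _ _)).
  assert (C3 := opp_RInt_swap (V := R_CompleteNormedModule) g c 0 (ex _ _)).
  unfold plus, opp in *; simpl in *. lra.
Qed.

Lemma polar_plus_2PI (r t : R) : polar r (t + 2 * PI) = polar r t.
Proof.
  unfold polar. replace (t + 2 * PI) with (t + 2 * INR 1 * PI) by (simpl; ring).
  now rewrite cos_period, sin_period.
Qed.

(** In the Taylor polynomial of degree 7 the last two terms are together nonnegative, and
    [x - x^3 / 6 >= x / 3] since [x^2 <= 4]. The range covers half-angles up to [PI / 2]. *)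
Lemma sin_lower (x : R) : 0 <= x <= 2 -> x / 3 <= sin x.
Proof.
  intros Hx. assert (P := PI2_3_2). unfold PI2 in P.
  destruct (SIN x) as [H _]; [lra|lra|].
  eapply Rle_trans; [|exact H].
  unfold sin_lb, sin_approx, sum_f_R0, sin_term; simpl.
  assert (0 <= x ^ 5) by (apply pow_le; lra).
  assert (x * x <= 4) by nra.
  assert (x ^ 7 <= 4 * x ^ 5) by (simpl in *; nra).
  assert (x ^ 3 <= 4 * x) by (simpl; nra).
  simpl in *. lra.
Qed.

(** The left modulus [X] dominates [1 - a], and [2 X] dominates the chord [|1 - e^(it)| >= t / 3].
    Hence [1 - a + t <= X + 6 X], the origin of 7. *)
Lemma one_minus_polar_ge (a t : R) : 0 <= a < 1 -> 0 <= t <= PI ->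
  ((1 - a) + t) / 7 <= Cmod (1 - polar a t).
Proof.
  intros Ha Ht. set (X := Cmod (1 - polar a t)).
  assert (H1 : 1 - a <= X).
  { unfold X. eapply Rle_trans; [|apply Cmod_1_minus_ge]. rewrite Cmod_polar; lra. }
  assert (H2 : Cmod (1 - polar 1 t) <= 2 * X).
  { replace (1 - polar 1 t)%C with ((1 - polar a t) + RtoC (- (1 - a)) * polar 1 t)%C.
    - eapply Rle_trans; [apply Cmod_triangle|].
      rewrite Cmod_mult, Cmod_unit, Cmod_R, Rabs_Ropp, Rabs_pos_eq by lra. fold X. lra.
    - rewrite (polar_scal a), RtoC_opp, RtoC_minus. ring. }
  assert (H3 : t / 3 <= Cmod (1 - polar 1 t)).
  { assert (Hs : t / 2 / 3 <= sin (t / 2)).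
    { apply sin_lower. generalize PI_4; lra. }
    assert (E : Cmod (1 - polar 1 t) ^ 2 = (2 * sin (t / 2)) ^ 2).
    { rewrite Cmod_sqr. unfold polar; simpl.
      assert (T := sin2_cos2 (t / 2)). unfold Rsqr in T.
      replace t with (2 * (t / 2)) at 1 2 3 4 by field.
      rewrite cos_2a, sin_2a.
      set (c := cos (t / 2)) in *. set (s := sin (t / 2)) in *.
      assert (Ec : c * c = 1 - s * s) by lra.
      transitivity ((1 - c * c + s * s) ^ 2 + 4 * (s * s) * (c * c)); [ring|]. rewrite Ec. ring. }
    apply Rsqr_incr_0_var; [|apply Cmod_ge_0]. rewrite !Rsqr_pow2, E.
    apply pow_incr. lra. }
  lra.
Qed.

Lemma RInt_shifted_power (d q : R) : 0 < d -> 1 < q ->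
  RInt (fun t => Rpower (d + t) (- q)) 0 PI <= Rpower d (1 - q) / (q - 1).
Proof.
  intros Hd Hq. assert (P := PI_RGT_0).
  assert (HI : is_RInt (fun t => Rpower (d + t) (- q)) 0 PI
    (minus (Rpower (d + PI) (1 - q) / (1 - q)) (Rpower (d + 0) (1 - q) / (1 - q)))).
  { apply (is_RInt_derive (V := R_CompleteNormedModule) (fun t => Rpower (d + t) (1 - q) / (1 - q))).
    - rewrite Rmin_left, Rmax_right by lra. intros t Ht.
      assert (H := derivable_pt_lim_power (d + t) (1 - q) ltac:(lra)).
      apply is_derive_Reals in H.
      assert (K := is_derive_comp (fun y => Rpower y (1 - q)) (fun t => d + t) t _ 1 H).
      assert (Hlin : is_derive (fun t => d + t) t 1).
      { auto_derive; auto. }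
      specialize (K Hlin).
      assert (K2 := is_derive_scal _ _ (/ (1 - q)) _ K).
      eapply is_derive_ext; [|replace (Rpower (d + t) (- q)) with
         (/ (1 - q) * scal 1 ((1 - q) * Rpower (d + t) (1 - q - 1))); [exact K2|]].
      + intros u. simpl. unfold Rdiv. ring.
      + unfold scal; simpl; unfold mult; simpl.
        replace (1 - q - 1) with (- q) by ring. field. lra.
    - rewrite Rmin_left, Rmax_right by lra. intros t Ht.
      apply (continuous_comp (fun t => d + t) (fun y => Rpower y (- q))).
      + apply (continuous_plus (fun _ => d) (fun t => t)); [apply continuous_const|apply continuous_id].
      + apply Rpower_continuous; lra. }
  rewrite (is_RInt_unique _ _ _ _ HI). unfold minus, plus, opp; simpl.
  rewrite Rplus_0_r.
  replace (Rpower (d + PI) (1 - q) / (1 - q) + - (Rpower d (1 - q) / (1 - q)))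
    with (Rpower d (1 - q) / (q - 1) - Rpower (d + PI) (1 - q) / (q - 1)) by (field; lra).
  assert (0 < Rpower (d + PI) (1 - q) / (q - 1)); [|lra].
  apply Rdiv_lt_0_compat; [apply Rpower_pos|lra].
Qed.

(** Rotation removes the argument of [z] and evenness halves the period, hence the 2 in the
    constant. The rest is the integral of [(1 - a + t)^(-q)], which behaves like a power because
    [q > 1]. *)
Lemma RInt_kernel_power (q : R) : 1 < q -> exists K, 0 < K /\
  forall (z : C) (r : R), 0 <= r -> r * Cmod z < 1 ->
  RInt (fun t => Rpower (Cmod (1 - Cconj z * polar r t)) (- q)) 0 (2 * PI)
  <= K * Rpower (1 - r * Cmod z) (1 - q).
Proof.
  intros Hq. exists (2 * Rpower 7 q / (q - 1)).
  assert (P7 := Rpower_pos 7 q). assert (PP := PI_RGT_0).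
  split; [apply Rdiv_lt_0_compat; lra|].
  intros z r Hr Hrz. set (a := r * Cmod z) in *.
  assert (Ha : 0 <= a < 1) by (split; [apply Rmult_le_pos; auto; apply Cmod_ge_0|auto]).
  destruct (polar_form z) as [alpha Ez].
  set (g := fun s => Rpower (Cmod (1 - polar a s)) (- q)).
  assert (Hpos : forall s, 0 < Cmod (1 - polar a s)).
  { intros s. eapply Rlt_le_trans; [|apply Cmod_1_minus_ge]. rewrite Cmod_polar; lra. }
  assert (Cg : rcont g).
  { apply (rcont_comp (fun s => Cmod (1 - polar a s)) (fun y => Rpower y (- q))); auto with cont.
    intros t. now apply Rpower_continuous. }
  assert (Hper : forall s, g (s + 2 * PI) = g s) by (intros; unfold g; now rewrite polar_plus_2PI).
  assert (Heven : forall s, g (- s) = g s).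
  { intros s. unfold g. f_equal. rewrite <- (Cmod_conj (1 - polar a s)). f_equal.
    unfold polar, Cconj, Cminus, Cplus, Copp, RtoC; simpl. rewrite cos_neg, sin_neg. f_equal; ring. }
  assert (ex : forall u v, ex_RInt g u v) by (intros; now apply rcont_ex_RInt).
  assert (Eg : RInt (fun t => Rpower (Cmod (1 - Cconj z * polar r t)) (- q)) 0 (2 * PI)
    = RInt g (1 * 0 + - alpha) (1 * (2 * PI) + - alpha)).
  { rewrite <- (RInt_comp_lin (V := R_CompleteNormedModule) g) by auto.
    apply RInt_ext. intros t _. unfold scal; simpl; unfold mult; simpl. rewrite Rmult_1_l.
    unfold g. do 3 f_equal. rewrite Ez at 1. unfold a, polar, Cconj, Cmult; simpl.
    replace (1 * t + - alpha) with (t - alpha) by ring. rewrite cos_minus, sin_minus. f_equal; ring. }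
  rewrite Eg.
  replace (1 * (2 * PI) + - alpha) with ((1 * 0 + - alpha) + 2 * PI) by ring.
  rewrite RInt_period_shift by auto.
  rewrite <- (RInt_period_shift g (2 * PI) (- PI)) by auto.
  replace (- PI + 2 * PI) with PI by ring.
  rewrite <- (RInt_Chasles (V := R_CompleteNormedModule) g (- PI) 0 PI) by auto.
  assert (Esym : RInt g (- PI) 0 = RInt g 0 PI).
  { assert (K := RInt_comp_lin (V := R_CompleteNormedModule) g (-1) 0 0 PI (ex _ _)).
    replace (-1 * 0 + 0) with 0 in K by ring. replace (-1 * PI + 0) with (- PI) in K by ring.
    rewrite <- (opp_RInt_swap (V := R_CompleteNormedModule) g 0 (- PI)) by auto. rewrite <- K.
    rewrite (RInt_ext _ (fun y => scal (-1) (g y))).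
    - rewrite (RInt_scal (V := R_CompleteNormedModule)) by auto.
      unfold opp, scal; simpl; unfold mult; simpl. ring.
    - intros t _. f_equal. replace (-1 * t + 0) with (- t) by ring. apply Heven. }
  rewrite Esym.
  assert (exd : ex_RInt (fun t => Rpower (1 - a + t) (- q)) 0 PI).
  { apply (ex_RInt_continuous (V := R_CompleteNormedModule)).
    rewrite Rmin_left, Rmax_right by lra. intros t Ht.
    apply (continuous_comp (fun t => 1 - a + t) (fun y => Rpower y (- q))).
    + apply (continuous_plus (fun _ => 1 - a) (fun t => t)); [apply continuous_const|apply continuous_id].
    + apply Rpower_continuous; lra. }
  assert (B : RInt g 0 PI <= Rpower 7 q * (Rpower (1 - a) (1 - q) / (q - 1))).
  { eapply Rle_trans; [|apply Rmult_le_compat_l; [lra|apply RInt_shifted_power; lra]].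
    replace (Rpower 7 q * RInt (fun t => Rpower (1 - a + t) (- q)) 0 PI)
      with (scal (Rpower 7 q) (RInt (fun t => Rpower (1 - a + t) (- q)) 0 PI)) by reflexivity.
    rewrite <- (RInt_scal (V := R_CompleteNormedModule)) by auto.
    apply RInt_le; [lra|auto|now apply (ex_RInt_scal (V := R_CompleteNormedModule))|].
    intros t Ht. unfold g, scal; simpl; unfold mult; simpl.
    assert (L := one_minus_polar_ge a t Ha ltac:(lra)).
    replace (Rpower 7 q * Rpower (1 - a + t) (- q)) with (Rpower ((1 - a + t) / 7) (- q)).
    - rewrite !Rpower_Ropp. apply Rinv_le_contravar; [apply Rpower_pos|].
      apply Rle_Rpower_l; lra.
    - replace (1 - a + t) with (7 * ((1 - a + t) / 7)) at 2 by field.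
      rewrite <- Rpower_mult_distr by lra.
      rewrite <- Rmult_assoc, <- Rpower_plus. replace (q + - q) with 0 by ring.
      rewrite Rpower_O by lra. ring. }
  unfold plus; simpl.
  replace (2 * Rpower 7 q / (q - 1) * Rpower (1 - a) (1 - q))
    with (2 * (Rpower 7 q * (Rpower (1 - a) (1 - q) / (q - 1)))) by (field; lra).
  lra.
Qed.

(** * The weight [h] and the separation constant *)

Lemma Rpower_le_antitone (x y a : R) : 0 < x <= y -> a <= 0 -> Rpower y a <= Rpower x a.
Proof.
  intros H Ha. replace a with (- - a) by ring. rewrite !(Rpower_Ropp _ (- a)).
  apply Rinv_le_contravar; [apply Rpower_pos|]. apply Rle_Rpower_l; lra.
Qed.

(** Used with [s = 1 - r], [t = 1 - |z_n|] and [u = 1 - r' |z_n|], where [u] dominates half the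
    maximum of [s] and [t]. Each of the two factors of 2 inside the powers costs at most 2, because
    [p / 2] and [3 p / 2 - 1] are below 1. *)
Lemma weight_bound (h : R -> R) (p s t u : R) :
  (forall t : R, 0 < t < 1 -> 0 < h t) -> 2 / 3 < p < 1 ->
  decreasing_on_01 (fun t => h t / Rpower t (p / 2)) ->
  increasing_on_01 (fun t => h t / Rpower t (1 - p)) ->
  0 < s < 1 -> 0 < t < 1 -> s / 2 <= u -> t / 2 <= u ->
  Rpower (2 * t) (p / 2) * Rpower u (1 - 3 * p / 2)
  <= 4 * (h t / (Rpower s (p - 1) * h s)).
Proof.
  intros Hh Hp Hdec Hinc Hs Ht Hsu Htu.
  assert (hs := Hh s Hs).
  assert (E2 : Rpower (2 * t) (p / 2) <= 2 * Rpower t (p / 2)).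
  { rewrite <- Rpower_mult_distr by lra. apply Rmult_le_compat_r; [apply Rlt_le, Rpower_pos|].
    apply Rle_trans with (Rpower 2 1); [apply Rle_Rpower; lra|rewrite Rpower_1; lra]. }
  assert (EM : forall m, 0 < m -> m / 2 <= u -> Rpower u (1 - 3 * p / 2) <= 2 * Rpower m (1 - 3 * p / 2)).
  { intros m Hm Hmu. apply Rle_trans with (Rpower (m / 2) (1 - 3 * p / 2)).
    - apply Rpower_le_antitone; lra.
    - unfold Rdiv at 1. rewrite <- Rpower_mult_distr by lra. rewrite Rmult_comm.
      apply Rmult_le_compat_r; [apply Rlt_le, Rpower_pos|].
      unfold Rpower. rewrite ln_Rinv by lra.
      replace ((1 - 3 * p / 2) * - ln 2) with ((3 * p / 2 - 1) * ln 2) by ring.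
      fold (Rpower 2 (3 * p / 2 - 1)). apply Rle_trans with (Rpower 2 1); [apply Rle_Rpower; lra|rewrite Rpower_1; lra]. }
  assert (Pt := Rpower_pos t (p / 2)). assert (P2t := Rpower_pos (2 * t) (p / 2)).
  assert (Pu := Rpower_pos u (1 - 3 * p / 2)).
  (* For [t <= s] the powers of [s] combine to [1 - 3 p / 2 = - (p - 1) - p / 2]; for [s < t] those
     of [t] combine to [1 - p]. These are the powers in the two monotonicity hypotheses. *)
  assert (K : Rpower t (p / 2) * Rpower (Rmax s t) (1 - 3 * p / 2) <= h t / (Rpower s (p - 1) * h s)).
  { destruct (Rle_lt_dec t s) as [Hts|Hst].
    - rewrite Rmax_left by auto.
      assert (D := Hdec t s (proj1 Ht) Hts (proj2 Hs)). cbv beta in D.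
      assert (Ps := Rpower_pos s (p / 2)). assert (Ps1 := Rpower_pos s (p - 1)).
      assert (Es : Rpower s (1 - 3 * p / 2) = / (Rpower s (p - 1) * Rpower s (p / 2))).
      { rewrite <- Rpower_plus, <- Rpower_Ropp. f_equal. field. }
      rewrite Es.
      apply (Rmult_le_compat_r (Rpower t (p / 2) / (h s * Rpower s (p - 1)))) in D.
      2:{ apply Rlt_le, Rdiv_lt_0_compat; auto. now apply Rmult_lt_0_compat. }
      replace (h s / Rpower s (p / 2) * (Rpower t (p / 2) / (h s * Rpower s (p - 1))))
        with (Rpower t (p / 2) * / (Rpower s (p - 1) * Rpower s (p / 2))) in D by (field; lra).
      replace (h t / Rpower t (p / 2) * (Rpower t (p / 2) / (h s * Rpower s (p - 1))))
        with (h t / (Rpower s (p - 1) * h s)) in D by (field; lra). exact D.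
    - rewrite Rmax_right by lra. rewrite <- Rpower_plus.
      replace (p / 2 + (1 - 3 * p / 2)) with (1 - p) by field.
      assert (D := Hinc s t (proj1 Hs) (Rlt_le _ _ Hst) (proj2 Ht)). cbv beta in D.
      assert (Ps := Rpower_pos s (1 - p)). assert (Pt1 := Rpower_pos t (1 - p)).
      assert (Es : Rpower s (p - 1) = / Rpower s (1 - p)).
      { rewrite <- Rpower_Ropp. f_equal. ring. }
      rewrite Es.
      apply (Rmult_le_compat_r (Rpower t (1 - p) * Rpower s (1 - p) / h s)) in D.
      2:{ apply Rlt_le, Rdiv_lt_0_compat; auto. now apply Rmult_lt_0_compat. }
      replace (h s / Rpower s (1 - p) * (Rpower t (1 - p) * Rpower s (1 - p) / h s))
        with (Rpower t (1 - p)) in D by (field; lra).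
      replace (h t / Rpower t (1 - p) * (Rpower t (1 - p) * Rpower s (1 - p) / h s))
        with (h t / (/ Rpower s (1 - p) * h s)) in D by (field; lra). exact D. }
  assert (Hm : 0 < Rmax s t) by (eapply Rlt_le_trans; [|apply Rmax_l]; lra).
  assert (Hmu : Rmax s t / 2 <= u) by (unfold Rmax; destruct Rle_dec; lra).
  specialize (EM _ Hm Hmu).
  apply Rle_trans with ((2 * Rpower t (p / 2)) * (2 * Rpower (Rmax s t) (1 - 3 * p / 2))).
  - apply Rmult_le_compat; lra.
  - lra.
Qed.

(** The partial products are nonincreasing, so each of them dominates the infinite product. Half of
    the infimum is a strict lower bound. *)
Lemma carleson_separation (z : nat -> C) : carleson_sequence z ->
  exists delta, 0 < delta /\ forall n N, delta <= separation z n N.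
Proof.
  intros [[Hz _] Hc].
  assert (exists delta, 0 < delta /\ forall n, Rbar_lt (Finite delta) (carleson_product z n)) as (delta & Hd & H).
  { assert (I := Inf_seq_correct (carleson_product z)).
    destruct (Inf_seq (carleson_product z)) as [l| |]; simpl in Hc; [| |easy].
    - assert (P : 0 < l / 2) by lra.
      destruct (I (mkposreal _ P)) as [I1 _]. exists (l / 2). split; auto.
      intros n. specialize (I1 n). simpl in I1. now replace (l - l / 2) with (l / 2) in I1 by field.
    (* The infimum is an extended real; were it infinite, any positive number would do. *)
    - exists 1. split; [lra|]. intros n. exact (I 1 n). }
  exists delta; split; auto. intros n N.
  set (c := fun k => if Nat.eq_dec k n then 1 else pseudo_dist (z k) (z n)).
  assert (c01 : forall k, 0 <= c k <= 1).
  { intros k. unfold c. destruct Nat.eq_dec; [lra|]. split; [apply Cmod_ge_0|].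
    apply pseudo_dist_le_1; apply Hz. }
  assert (E : forall M, prod_f_R0 c M = rprod c (S M)).
  { induction M as [|M IH]; simpl in *; [ring|]. now rewrite IH. }
  assert (mono : forall M m, rprod c (M + m) <= rprod c M).
  { intros M m. induction m as [|m IH]; [rewrite Nat.add_0_r; lra|].
    rewrite Nat.add_succ_r. simpl.
    assert (0 <= rprod c (M + m)) by (apply rprod_ge_0; intros; apply c01).
    generalize (c01 (M + m)%nat). nra. }
  assert (Hle : Rbar_le (carleson_product z n) (Finite (rprod c N))).
  { rewrite <- Lim_seq_const. unfold carleson_product. apply Lim_seq_le_loc.
    exists N. intros M HM.
    change (prod_f_R0 c M <= rprod c N). rewrite E.
    replace (S M) with (N + (S M - N))%nat by lia. apply mono. }
  assert (K := Rbar_lt_le_trans _ _ _ (H n) Hle). simpl in K.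
  change (delta <= rprod c N). lra.
Qed.

(** * Derivatives in the model space *)

Lemma cder_csum (u : nat -> C -> C) (l : nat -> C) (w : C) (N : nat) :
  (forall k, cder (u k) w (l k)) ->
  cder (fun v => csum (fun k => u k v) N) w (csum l N).
Proof.
  intros H. induction N as [|N IH]; simpl; [apply cder_const|]. now apply cder_plus.
Qed.

Lemma cder_kernel (a w : C) : (1 - Cconj a * w)%C <> RtoC 0 ->
  cder (kernel a) w (Cconj a / ((1 - Cconj a * w) * (1 - Cconj a * w)))%C.
Proof.
  intros H.
  assert (H1 : cder (fun v => (1 - Cconj a * v)%C) w (- Cconj a)%C).
  { replace (- Cconj a)%C with (0 + - Cconj a)%C by ring.
    apply (cder_plus (fun _ => RtoC 1) (fun v => (- (Cconj a * v))%C)); [apply cder_const|].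
    apply (cder_ext (fun v => (- Cconj a * v)%C)); [intros; ring|apply cder_linear]. }
  assert (H2 := cder_inv _ w _ H H1).
  replace (Cconj a / ((1 - Cconj a * w) * (1 - Cconj a * w)))%C
    with (- / ((1 - Cconj a * w) * (1 - Cconj a * w)) * - Cconj a)%C by (field; auto).
  exact H2.
Qed.

Lemma H2_norm_ge_0 (f : C -> C) : H2 f -> 0 <= H2_norm f.
Proof.
  intros Hf. destruct (Rle_lt_dec 0 (H2_norm f)) as [|H]; auto. exfalso.
  destruct (H2_norm_limit f (- H2_norm f) Hf) as (d & Hd & D); [lra|].
  specialize (D (1 - d / 2) ltac:(lra)). apply Rabs_def2 in D.
  assert (0 <= circle_mean2 f (1 - d / 2)) by apply sqrt_pos. lra.
Qed.

(** The expansion is applied to [F = f(rho .)] and differentiated at [w = polar (r / rho) t], so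
    [r' = r / rho]. Smallness of the error on the disc of radius [r1] passes to its derivative by
    Cauchy's estimate. [N], [c] and [r'] depend on [eps], their bounds do so only through [eps]
    itself. *)
Lemma derivative_bound (z : nat -> C) (delta : R) (f : C -> C) (r eps : R) :
  blaschke_sequence z -> 0 < delta -> (forall n N, delta <= separation z n N) ->
  model_space z f -> 0 < r < 1 -> 0 < eps ->
  exists (c : nat -> C) (N : nat) (r' : R),
    0 <= r' <= (1 + r) / 2 /\
    rsum (fun n => Cmod (c n) ^ 2 / defect (z n)) N <= 4 / delta ^ 8 * (H2_norm f + eps) ^ 2 /\
    forall t, Cmod (C_derive f (polar r t))
      <= 2 * (rsum (fun n => Cmod (c n) / Cmod (1 - Cconj (z n) * polar r' t) ^ 2) N + eps).
Proof.
  intros Hz Hdelta Hsep Hf Hr Heps.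
  assert (Hz1 : forall n, 0 < Cmod (z n) < 1) by apply Hz.
  assert (Hf2 : H2 f) by apply Hf.
  assert (Hol := holomorphic_hol f (proj1 Hf2)).
  set (rm := (1 + r) / 2). assert (Hrm : r < rm < 1) by (unfold rm; lra).
  set (r1 := (1 + rm) / 2). assert (Hr1 : rm < r1 < 1) by (unfold r1; lra).
  assert (Hq : 0 < rm / r1 < 1).
  { split; [apply Rdiv_lt_0_compat; lra|]. apply (Rmult_lt_reg_r r1); [lra|].
    replace (rm / r1 * r1) with rm by (field; lra). lra. }
  (* Cauchy's estimate on the disc of radius [r1] at points of modulus at most [rm] turns an error
     [eps'] into [eps] for the derivative. *)
  set (eps' := eps * r1 * (1 - rm / r1) ^ 2).
  assert (P2 : 0 < (1 - rm / r1) ^ 2) by (apply pow_lt; lra).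
  assert (Heps' : 0 < eps') by (repeat apply Rmult_lt_0_compat; lra).
  destruct (projection_error_small z f r1 eps' Hz Hf ltac:(lra) Heps') as (N & d & Hd & D).
  destruct (H2_norm_limit f eps Hf2 Heps) as (d' & Hd' & D').
  assert (Hrr : 0 < r / rm < 1).
  { split; [apply Rdiv_lt_0_compat; lra|]. apply (Rmult_lt_reg_r rm); [lra|].
    replace (r / rm * rm) with r by (field; lra). lra. }
  (* The third bound gives [r / rho <= rm]; the last keeps [rho] above 1/2, which explains the
     factor 2 in the conclusion. *)
  set (e := Rmin (Rmin d d') (Rmin (1 - r / rm) (1 / 2))).
  assert (He : 0 < e) by (repeat apply Rmin_glb_lt; lra).
  assert (M1 := Rmin_l (Rmin d d') (Rmin (1 - r / rm) (1 / 2))).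
  assert (M2 := Rmin_r (Rmin d d') (Rmin (1 - r / rm) (1 / 2))).
  assert (M3 := Rmin_l d d'). assert (M4 := Rmin_r d d').
  assert (M5 := Rmin_l (1 - r / rm) (1 / 2)). assert (M6 := Rmin_r (1 - r / rm) (1 / 2)).
  fold e in M1, M2.
  set (rho := 1 - e / 2). assert (Hrho : 1 - e < rho < 1) by (unfold rho; lra).
  assert (Hr' : 0 < r / rho <= rm).
  { split; [apply Rdiv_lt_0_compat; lra|]. apply (Rmult_le_reg_r rho); [lra|].
    replace (r / rho * rho) with (r / rm * rm) by (field; lra).
    rewrite (Rmult_comm rm). apply Rmult_le_compat_r; lra. }
  set (F := fun v => f (RtoC rho * v)%C).
  assert (HF : hol (1 / rho) F) by (apply hol_scale; auto; lra).
  assert (H1rho : 1 < 1 / rho) by (apply inv_gt_1; lra).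
  assert (Hsep' : forall n, (n < N)%nat -> delta <= separation z n N) by auto.
  destruct (kernel_expansion z N delta (1 / rho) F Hz1 Hdelta Hsep' H1rho HF) as (c & Hc1 & Hc2).
  exists c, N, (r / rho). split; [lra|]. split.
  - eapply Rle_trans; [exact Hc1|]. apply Rmult_le_compat_l.
    { apply Rlt_le, Rdiv_lt_0_compat; [lra|now apply pow_lt]. }
    rewrite (rmean_ext _ (fun t => Cmod (f (polar rho t)) ^ 2))
      by (intros; unfold F; now rewrite <- polar_scal).
    specialize (D' rho ltac:(lra)). rewrite circle_mean2_eq in D' by (apply ccont_circle; auto; lra).
    apply Rabs_def2 in D'. set (I := rmean _) in *.
    assert (HI : 0 <= I).
    { apply rmean_ge_0; [|intros; apply pow2_ge_0].
      apply rcont_pow, rcont_Cmod, ccont_circle; auto; lra. }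
    rewrite <- (sqrt_sqrt I) by auto. generalize (sqrt_pos I). nra.
  - intros t. set (w := polar (r / rho) t).
    assert (Hw : Cmod w = r / rho) by (apply Cmod_polar; lra).
    set (E := fun v => (F v - csum (fun n => c n * kernel (z n) v) N)%C).
    assert (HE : forall v, Cmod v <= r1 -> Cmod (E v) <= eps').
    { intros v Hv. assert (Hv1 : Cmod v < 1) by lra. unfold E. rewrite <- Hc2 by auto.
      set (T := cmean _). assert (HT : Cmod T <= eps') by (apply D; lra).
      replace (F v - (F v - blaschke_partial z N v * T))%C with (blaschke_partial z N v * T)%C by ring.
      rewrite Cmod_mult. generalize (Cmod_blaschke_partial_le_1 z Hz N v Hv1)
        (Cmod_ge_0 (blaschke_partial z N v)) (Cmod_ge_0 T). nra. }
    assert (HolE : hol 1 E).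
    { apply hol_minus; [apply (hol_le (1 / rho)); auto; lra|].
      apply (hol_csum 1 (fun n v => (c n * kernel (z n) v)%C)). intros k _.
      apply hol_mult; [apply hol_const|]. apply hol_kernel; [lra|]. generalize (Hz1 k); lra. }
    set (v := polar (r / rho / r1) t).
    assert (Hv0 : 0 <= r / rho / r1 <= rm / r1).
    { split; [apply Rlt_le, Rdiv_lt_0_compat; lra|].
      apply Rmult_le_compat_r; [apply Rlt_le, Rinv_0_lt_compat; lra|lra]. }
    assert (Hv : Cmod v = r / rho / r1) by (apply Cmod_polar; lra).
    assert (Ewv : w = (RtoC r1 * v)%C).
    { unfold v, w. rewrite (polar_scal (r / rho)), (polar_scal (r / rho / r1)), Cmult_assoc, <- RtoC_mult.
      do 2 f_equal. field. lra. }
    (* Rescaling turns the disc of radius [r1] into the unit disc, where the Cauchy integral for the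
       derivative is available. *)
    set (E1 := fun v => E (RtoC r1 * v)%C).
    assert (HE1 : hol (1 / r1) E1) by (apply hol_scale; auto; lra).
    assert (Hir1 : 1 < 1 / r1) by (apply inv_gt_1; lra).
    assert (B1 := Cmod_dkernel_mean_le (1 / r1) eps' E1 v Hir1 HE1 ltac:(lra)).
    assert (B2 : forall s, Cmod (E1 (polar 1 s)) <= eps').
    { intros s. unfold E1. apply HE. rewrite Cmod_mult, Cmod_unit, Cmod_RtoC_pos; lra. }
    specialize (B1 B2).
    assert (C1 := Cauchy_derivative (1 / r1) E1 v Hir1 HE1 ltac:(lra)).
    assert (Nk : forall n, (1 - Cconj (z n) * w)%C <> RtoC 0).
    { intros n. apply one_minus_neq_0. rewrite Cmod_mult, Cmod_conj, Hw. generalize (Hz1 n). nra. }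
    set (k' := fun n => (Cconj (z n) / ((1 - Cconj (z n) * w) * (1 - Cconj (z n) * w)))%C).
    set (l := (C_derive f (polar r t) * RtoC rho + - (1) * csum (fun n => c n * k' n) N)%C).
    assert (Erw : (RtoC rho * w)%C = polar r t).
    { unfold w. rewrite (polar_scal (r / rho)), (polar_scal r), Cmult_assoc, <- RtoC_mult.
      do 2 f_equal. field. lra. }
    assert (C2 : cder E w l).
    { unfold l. apply (cder_ext (fun v => (F v + - (1) * csum (fun n => c n * kernel (z n) v) N)%C)).
      { intros x. unfold E. ring. }
      apply cder_plus.
      - apply (cder_comp f (fun v => (RtoC rho * v)%C)); [|apply cder_linear].
        rewrite Erw. apply cder_C_derive; [apply Hf2|]. rewrite Cmod_polar; lra.
      - apply cder_scal. apply (cder_csum (fun n v => (c n * kernel (z n) v)%C)).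
        intros n. apply cder_scal. now apply cder_kernel. }
    assert (El : dkernel_mean E1 v = (l * RtoC r1)%C).
    { apply (cder_unique E1 v); auto.
      apply (cder_comp E (fun v => (RtoC r1 * v)%C)); [now rewrite <- Ewv|apply cder_linear]. }
    assert (Bl : Cmod l <= eps).
    { rewrite El, Cmod_mult, (Cmod_RtoC_pos r1), Hv in B1 by lra.
      apply (Rmult_le_reg_r r1); [lra|]. eapply Rle_trans; [exact B1|].
      assert (P3 : (1 - rm / r1) ^ 2 <= (1 - r / rho / r1) ^ 2) by (apply pow_incr; lra).
      apply Rle_trans with (eps' / (1 - rm / r1) ^ 2).
      - apply Rmult_le_compat_l; [lra|]. apply Rinv_le_contravar; auto.
      - apply Req_le. unfold eps'. field. split; [lra|]. apply Rgt_not_eq; lra. }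
    assert (Ef : (C_derive f (polar r t) * RtoC rho = csum (fun n => c n * k' n) N + l)%C)
      by (unfold l; ring).
    assert (Bf : Cmod (C_derive f (polar r t)) * rho
      <= rsum (fun n => Cmod (c n) / Cmod (1 - Cconj (z n) * w) ^ 2) N + eps).
    { rewrite <- (Cmod_RtoC_pos rho) at 1 by lra. rewrite <- Cmod_mult, Ef.
      eapply Rle_trans; [apply Cmod_triangle|]. apply Rplus_le_compat; auto.
      eapply Rle_trans; [apply Cmod_csum_le|]. apply rsum_le. intros n _.
      assert (Pn : 0 < Cmod (1 - Cconj (z n) * w)) by now apply Cmod_gt_0.
      rewrite Cmod_mult. apply Rmult_le_compat_l; [apply Cmod_ge_0|].
      unfold k'. rewrite Cmod_div by (apply Cmult_neq_0; auto). rewrite Cmod_mult, Cmod_conj.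
      replace (Cmod (1 - Cconj (z n) * w) ^ 2) with (Cmod (1 - Cconj (z n) * w) * Cmod (1 - Cconj (z n) * w)) by ring.
      rewrite <- (Rmult_1_l (/ _)). apply Rmult_le_compat_r; [|generalize (Hz1 n); lra].
      apply Rlt_le, Rinv_0_lt_compat. now apply Rmult_lt_0_compat. }
    generalize (Cmod_ge_0 (C_derive f (polar r t))). nra.
Qed.

Lemma rmean_derivative_power (z : nat -> C) (c : nat -> C) (N : nat) (K r r' s eps : R) (f : C -> C) :
  (forall n, 0 < Cmod (z n) < 1) -> 0 < s <= 1 -> 0 < r < 1 -> 0 <= r' < 1 -> 0 <= eps ->
  holomorphic_on_disc f ->
  (forall n, RInt (fun t => Rpower (Cmod (1 - Cconj (z n) * polar r' t)) (- (2 * s))) 0 (2 * PI)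
     <= K * Rpower (1 - r' * Cmod (z n)) (1 - 2 * s)) ->
  (forall t, Cmod (C_derive f (polar r t))
      <= 2 * (rsum (fun n => Cmod (c n) / Cmod (1 - Cconj (z n) * polar r' t) ^ 2) N + eps)) ->
  RInt (fun t => rpow (Cmod (C_derive f (polar r t))) s) 0 (2 * PI)
  <= rpow 2 s * (K * rsum (fun n => rpow (Cmod (c n)) s * Rpower (1 - r' * Cmod (z n)) (1 - 2 * s)) N
                 + 2 * PI * rpow eps s).
Proof.
  intros Hz Hs Hr Hr' Heps Hf HK H.
  assert (PP := two_PI_pos).
  assert (ER : forall g : R -> R, @eq R (RInt g 0 (2 * PI)) (2 * PI * rmean g)).
  { intros g. unfold rmean. symmetry. apply (Rmult_eq_reg_r (/ (2 * PI))).
    - unfold Rdiv. generalize (RInt g 0 (2 * PI)). intros x. change R in x. field. apply PI_neq0.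
    - apply Rinv_neq_0_compat; lra. }
  assert (Pk : forall n t, 0 < Cmod (1 - Cconj (z n) * polar r' t)).
  { intros n t. eapply Rlt_le_trans; [|apply Cmod_1_minus_ge].
    rewrite Cmod_mult, Cmod_conj, Cmod_polar by lra. generalize (Hz n). nra. }
  assert (Cd : rcont (fun t => rpow (Cmod (C_derive f (polar r t))) s)).
  { apply (rcont_comp (fun t => Cmod (C_derive f (polar r t))) (fun x => rpow x s)).
    - now apply rcont_Cmod, ccont_C_derive.
    - intros t. apply rcont_rpow; lra. }
  assert (Ck : forall n, rcont (fun t => Rpower (Cmod (1 - Cconj (z n) * polar r' t)) (- (2 * s)))).
  { intros n. apply (rcont_comp (fun t => Cmod (1 - Cconj (z n) * polar r' t)) (fun y => Rpower y (- (2 * s))));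
      auto 10 with cont. intros t. now apply Rpower_continuous. }
  assert (Cs : rcont (fun t => rsum (fun n => rpow (Cmod (c n)) s
       * Rpower (Cmod (1 - Cconj (z n) * polar r' t)) (- (2 * s))) N)).
  { apply (rcont_rsum (fun n t => rpow (Cmod (c n)) s
       * Rpower (Cmod (1 - Cconj (z n) * polar r' t)) (- (2 * s)))).
    intros k _. specialize (Ck k). auto with cont. }
  apply Rle_trans with (2 * PI * rmean (fun t => rpow 2 s * (rsum (fun n => rpow (Cmod (c n)) s
       * Rpower (Cmod (1 - Cconj (z n) * polar r' t)) (- (2 * s))) N + rpow eps s))).
  - rewrite ER. apply Rmult_le_compat_l; [lra|]. apply rmean_le; auto with cont.
    intros t. eapply Rle_trans; [apply rpow_le; [lra|apply H]|].
    assert (Ht : forall k, 0 <= Cmod (c k) / Cmod (1 - Cconj (z k) * polar r' t) ^ 2).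
    { intros k. apply Rmult_le_pos; [apply Cmod_ge_0|].
      apply Rlt_le, Rinv_0_lt_compat, pow_lt, Pk. }
    assert (Hsum : 0 <= rsum (fun n => Cmod (c n) / Cmod (1 - Cconj (z n) * polar r' t) ^ 2) N)
      by (apply rsum_ge_0; auto).
    rewrite rpow_mult by lra. apply Rmult_le_compat_l; [apply rpow_ge_0|].
    eapply Rle_trans; [apply rpow_plus; lra|]. apply Rplus_le_compat_r.
    eapply Rle_trans; [apply rpow_rsum; auto; lra|].
    apply rsum_le. intros n _.
    unfold Rdiv. rewrite rpow_mult.
    + apply Req_le. f_equal. rewrite rpow_Rpower by (apply Rinv_0_lt_compat, pow_lt; auto).
      rewrite <- (Rpower_pow 2), <- Rpower_Ropp, Rpower_mult by auto. f_equal. simpl. ring.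
    + apply Cmod_ge_0.
    + apply Rlt_le, Rinv_0_lt_compat, pow_lt; auto.
  - rewrite rmean_scal, rmean_plus, rmean_const by auto with cont.
    rewrite (rmean_rsum (fun n t => rpow (Cmod (c n)) s
       * Rpower (Cmod (1 - Cconj (z n) * polar r' t)) (- (2 * s))))
      by (intros k _; specialize (Ck k); auto with cont).
    replace (2 * PI * (rpow 2 s * (rsum (fun k => rmean (fun t => rpow (Cmod (c k)) s
       * Rpower (Cmod (1 - Cconj (z k) * polar r' t)) (- (2 * s)))) N + rpow eps s)))
      with (rpow 2 s * (2 * PI * rsum (fun k => rmean (fun t => rpow (Cmod (c k)) s
       * Rpower (Cmod (1 - Cconj (z k) * polar r' t)) (- (2 * s)))) N + 2 * PI * rpow eps s)) by ring.
    apply Rmult_le_compat_l; [apply rpow_ge_0|]. apply Rplus_le_compat_r.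
    rewrite <- !rsum_scal. apply rsum_le. intros n _.
    rewrite rmean_scal by auto.
    replace (2 * PI * (rpow (Cmod (c n)) s * rmean (fun t => Rpower (Cmod (1 - Cconj (z n) * polar r' t)) (- (2 * s)))))
      with (rpow (Cmod (c n)) s * RInt (fun t => Rpower (Cmod (1 - Cconj (z n) * polar r' t)) (- (2 * s))) 0 (2 * PI))
      by (rewrite ER; ring).
    replace (K * (rpow (Cmod (c n)) s * Rpower (1 - r' * Cmod (z n)) (1 - 2 * s)))
      with (rpow (Cmod (c n)) s * (K * Rpower (1 - r' * Cmod (z n)) (1 - 2 * s))) by ring.
    apply Rmult_le_compat_l; [apply rpow_ge_0|apply HK].
Qed.

(* Hoelder with exponents [2 / s] and [(p + 2) / 2]. *)
Lemma coefficient_sum_bound (h : R -> R) (z : nat -> C) (p r r' : R) (c : nat -> C) (N : nat) (A : R) :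
  (forall t : R, 0 < t < 1 -> 0 < h t) -> 2 / 3 < p < 1 ->
  decreasing_on_01 (fun t => h t / Rpower t (p / 2)) ->
  increasing_on_01 (fun t => h t / Rpower t (1 - p)) ->
  (forall n, 0 < Cmod (z n) < 1) -> ex_series (fun n => h (1 - Cmod (z n))) ->
  0 < r < 1 -> 0 <= r' <= (1 + r) / 2 -> 0 < A ->
  rsum (fun n => Cmod (c n) ^ 2 / defect (z n)) N <= A ^ 2 ->
  let s := 2 * p / (p + 2) in
  rsum (fun n => rpow (Cmod (c n)) s * Rpower (1 - r' * Cmod (z n)) (1 - 2 * s)) N
  <= Rpower A s * Rpower (4 * Series (fun n => h (1 - Cmod (z n)))
        * / (Rpower (1 - r) (p - 1) * h (1 - r))) (1 - s / 2).
Proof.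
  intros Hh Hp Hdec Hinc Hz Hser Hr Hr' HA Hsum s.
  assert (Hs : 0 < s < 2).
  { unfold s. split; [apply Rdiv_lt_0_compat; lra|].
    apply (Rmult_lt_reg_r (p + 2)); [lra|]. unfold Rdiv. rewrite Rmult_assoc, Rinv_l; lra. }
  set (S := Series (fun n => h (1 - Cmod (z n)))).
  set (Q := / (Rpower (1 - r) (p - 1) * h (1 - r))).
  assert (Hhr : 0 < h (1 - r)) by (apply Hh; lra).
  assert (HQ : 0 < Q) by (apply Rinv_0_lt_compat, Rmult_lt_0_compat; auto; apply Rpower_pos).
  assert (Hhn : forall n, 0 < h (1 - Cmod (z n))) by (intros n; apply Hh; generalize (Hz n); lra).
  assert (HSN : forall M, rsum (fun n => h (1 - Cmod (z n))) M <= S).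
  { intros M. apply rsum_le_Series; auto. intros; now apply Rlt_le. }
  assert (HS : 0 < S).
  { eapply Rlt_le_trans; [|apply (HSN 1%nat)]. simpl. generalize (Hhn O); lra. }
  assert (HD : forall n, 0 < defect (z n) <= 2 * (1 - Cmod (z n))).
  { intros n. generalize (defect_pos (z n) (proj2 (Hz n))) (Hz n). unfold defect. intros. split; nra. }
  (* The exponents are forced: raised to [1 - s / 2], the first power cancels the [- s / 2] of the
     normalized coefficients and the second becomes [1 - 2 * s]. *)
  set (v := fun n => Rpower (defect (z n)) (p / 2) * Rpower (1 - r' * Cmod (z n)) (1 - 3 * p / 2)).
  assert (Hv : forall n, 0 < v n) by (intros; apply Rmult_lt_0_compat; apply Rpower_pos).
  assert (HV : rsum v N <= 4 * S * Q).
  { apply Rle_trans with (rsum (fun n => 4 * Q * h (1 - Cmod (z n))) N).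
    - apply rsum_le. intros n _. assert (Zn := Hz n).
      assert (W := weight_bound h p (1 - r) (1 - Cmod (z n)) (1 - r' * Cmod (z n))
        Hh Hp Hdec Hinc ltac:(lra) ltac:(lra) ltac:(nra) ltac:(nra)).
      eapply Rle_trans; [|eapply Rle_trans; [exact W|]].
      + apply Rmult_le_compat_r; [apply Rlt_le, Rpower_pos|]. apply Rle_Rpower_l; [lra|apply HD].
      + unfold Q. apply Req_le. unfold Rdiv. ring.
    - rewrite rsum_scal. assert (H := HSN N). nra. }
  assert (K := Hoelder_rsum (fun n => Cmod (c n) / sqrt (defect (z n))) v N A (4 * S * Q) s Hs HA).
  assert (Psq : forall n, 0 < sqrt (defect (z n))) by (intros; apply sqrt_lt_R0, HD).
  eapply Rle_trans; [|apply K; auto].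
  - apply Req_le, rsum_ext. intros n _.
    unfold Rdiv at 1. rewrite rpow_mult by (try apply Cmod_ge_0; apply Rlt_le, Rinv_0_lt_compat, Psq).
    rewrite Rmult_assoc. f_equal.
    rewrite (rpow_Rpower (/ _)) by apply Rinv_0_lt_compat, Psq.
    rewrite <- Rpower_sqrt by apply HD. rewrite <- Rpower_Ropp, Rpower_mult.
    unfold v. rewrite <- Rpower_mult_distr by apply Rpower_pos. rewrite !Rpower_mult.
    rewrite <- Rmult_assoc, <- Rpower_plus.
    replace (- / 2 * s + p / 2 * (1 - s / 2)) with 0 by (unfold s; field; lra).
    rewrite Rpower_O by apply HD. rewrite Rmult_1_l. f_equal. unfold s. field. lra.
  - repeat apply Rmult_lt_0_compat; lra.
  - intros n. apply Rlt_le, Rdiv_le_lt_0_compat || apply Rmult_le_pos; [apply Cmod_ge_0|].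
    apply Rlt_le, Rinv_0_lt_compat, Psq.
  - eapply Rle_trans; [|exact Hsum]. apply Req_le, rsum_ext. intros n _.
    assert (Dn := HD n). unfold Rdiv. rewrite Rpow_mult_distr, pow_inv, <- Rsqr_pow2 with (x := sqrt _), Rsqr_sqrt by lra.
    reflexivity.
Qed.

Theorem theorem6p1 :
  forall (h : R -> R) (z : nat -> C) (p : R),
    (forall t : R, 0 < t < 1 -> 0 < h t) ->
    (forall t : R, 0 < t < 1 -> continuous h t) ->
    filterlim h (at_right 0) (locally 0) ->
    carleson_sequence z ->
    ex_series (fun n => h (1 - Cmod (z n))) ->
    2 / 3 < p < 1 ->
    decreasing_on_01 (fun t => h t / Rpower t (p / 2)) ->
    increasing_on_01 (fun t => h t / Rpower t (1 - p)) ->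
    exists C0 : R, 0 < C0 /\
      at_left 1 (fun r =>
        forall f : C -> C, model_space z f ->
          rpow (RInt (fun theta =>
                   rpow (Cmod (C_derive f (polar r theta))) (2 * p / (p + 2)))
                 0 (2 * PI))
               (1 / (2 * p / (p + 2)))
          <= C0 * H2_norm f
             / Rpower (Rpower (1 - r) (p - 1) * h (1 - r)) (1 / p)).
Proof.
  intros h z p Hh _ _ Hcar Hser Hp Hdec Hinc.
  destruct (carleson_separation z Hcar) as (delta & Hdelta & Hsep).
  destruct Hcar as [Hz _]. assert (Hz1 : forall n, 0 < Cmod (z n) < 1) by apply Hz.
  set (s := 2 * p / (p + 2)).
  (* The left inequality is equivalent to [p > 2 / 3] and puts the exponent [2 * s] in the range of
     [RInt_kernel_power]. *)
  assert (Hs : 1 / 2 < s < 1).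
  { unfold s. split; apply (Rmult_lt_reg_r (p + 2)); try lra;
      unfold Rdiv; rewrite (Rmult_assoc (2 * p)), Rinv_l; lra. }
  destruct (RInt_kernel_power (2 * s)) as (K & HK & HK'); [lra|].
  set (S := Series (fun n => h (1 - Cmod (z n)))).
  assert (HS : 0 < S).
  { assert (Hhn : forall n, 0 < h (1 - Cmod (z n))) by (intros n; apply Hh; generalize (Hz1 n); lra).
    eapply Rlt_le_trans; [|apply (rsum_le_Series _ 1%nat)]; auto.
    - simpl. generalize (Hhn O); lra.
    - intros n; now apply Rlt_le. }
  (* The factors are those of [derivative_bound], of the kernel means, of the coefficients
     ([2 / delta^4] is the root of [4 / delta^8]) and of the weights, fixed before [r] and [f]. *)
  set (X := rpow 2 s * K * (Rpower (2 / delta ^ 4) s * Rpower (4 * S) (1 - s / 2))).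
  assert (HX : 0 < X).
  { unfold X. rewrite rpow_Rpower by lra.
    repeat apply Rmult_lt_0_compat; auto; apply Rpower_pos. }
  exists (rpow X (1 / s)). split; [rewrite rpow_Rpower by auto; apply Rpower_pos|].
  (* The estimate holds on all of [0 < r < 1], with no restriction depending on [f]. *)
  apply at_left_1_iff. exists 1. split; [lra|]. intros r Hr0 f Hf. assert (Hr : 0 < r < 1) by lra.
  assert (Hf2 : H2 f) by apply Hf. assert (Hnorm := H2_norm_ge_0 f Hf2).
  set (nf := H2_norm f) in *.
  set (q := Rpower (1 - r) (p - 1) * h (1 - r)).
  assert (Hq : 0 < q) by (apply Rmult_lt_0_compat; [apply Rpower_pos|apply Hh; lra]).
  set (Y := X * Rpower (/ q) (1 - s / 2)).
  assert (HY : 0 < Y) by (apply Rmult_lt_0_compat; auto; apply Rpower_pos).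
  set (I := RInt (fun theta => rpow (Cmod (C_derive f (polar r theta))) s) 0 (2 * PI)).
  assert (P4 : 0 < delta ^ 4) by now apply pow_lt.
  assert (P24 : 0 < 2 / delta ^ 4) by (apply Rdiv_lt_0_compat; lra).
  assert (PP := two_PI_pos).
  set (Z := Y + rpow 2 s * (2 * PI)).
  assert (HZ : 0 <= Z).
  { assert (0 <= rpow 2 s * (2 * PI)) by (apply Rmult_le_pos; [apply rpow_ge_0|lra]). unfold Z; lra. }
  (* A positive [eps] keeps [A] positive even when [f] has norm 0. Subadditivity of the power
     separates it from [nf], so it can tend to 0 afterwards. *)
  assert (Heps : forall eps, 0 < eps -> I <= Y * rpow nf s + Z * rpow eps s).
  { intros eps Heps.
    destruct (derivative_bound z delta f r eps Hz Hdelta Hsep Hf Hr Heps) as (c & N & r' & Hr' & Hc & Hd).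
    fold nf in Hc.
    set (A := 2 / delta ^ 4 * (nf + eps)).
    assert (HA : 0 < A) by (apply Rmult_lt_0_compat; lra).
    assert (HcA : rsum (fun n => Cmod (c n) ^ 2 / defect (z n)) N <= A ^ 2).
    { eapply Rle_trans; [exact Hc|]. apply Req_le. unfold A. field. lra. }
    assert (B1 := rmean_derivative_power z c N K r r' s eps f Hz1 ltac:(lra) Hr ltac:(lra) ltac:(lra)
      (proj1 Hf2)).
    assert (B2 := coefficient_sum_bound h z p r r' c N A Hh Hp Hdec Hinc Hz1 Hser Hr Hr' HA HcA).
    cbv zeta in B2. fold s S q in B2.
    assert (HKn : forall n, RInt (fun t => Rpower (Cmod (1 - Cconj (z n) * polar r' t)) (- (2 * s))) 0 (2 * PI)
      <= K * Rpower (1 - r' * Cmod (z n)) (1 - 2 * s)).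
    { intros n. apply HK'; [lra|]. generalize (Hz1 n). nra. }
    specialize (B1 HKn Hd). fold I in B1.
    eapply Rle_trans; [exact B1|].
    apply Rle_trans with (rpow 2 s * (K * (Rpower A s * Rpower (4 * S * / q) (1 - s / 2)) + 2 * PI * rpow eps s)).
    { apply Rmult_le_compat_l; [apply rpow_ge_0|]. apply Rplus_le_compat_r.
      apply Rmult_le_compat_l; [lra|exact B2]. }
    assert (EA : Rpower A s <= Rpower (2 / delta ^ 4) s * (rpow nf s + rpow eps s)).
    { unfold A. rewrite <- Rpower_mult_distr, <- (rpow_Rpower (nf + eps)) by lra.
      apply Rmult_le_compat_l; [apply Rlt_le, Rpower_pos|]. apply rpow_plus; lra. }
    assert (Hiq : 0 < / q) by now apply Rinv_0_lt_compat.
    rewrite <- (Rpower_mult_distr (4 * S)) by lra.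
    set (W := Rpower (4 * S) (1 - s / 2) * Rpower (/ q) (1 - s / 2)) in *.
    assert (HW : 0 < W) by (apply Rmult_lt_0_compat; apply Rpower_pos).
    assert (EY : Y = rpow 2 s * K * Rpower (2 / delta ^ 4) s * W) by (unfold Y, X, W; ring).
    assert (P2 := rpow_ge_0 2 s).
    assert (H1 : rpow 2 s * K * W * Rpower A s
      <= rpow 2 s * K * W * (Rpower (2 / delta ^ 4) s * (rpow nf s + rpow eps s))).
    { apply Rmult_le_compat_l; auto. apply Rmult_le_pos; [apply Rmult_le_pos|]; lra. }
    unfold Z. rewrite EY.
    replace (rpow 2 s * (K * (Rpower A s * W) + 2 * PI * rpow eps s))
      with (rpow 2 s * K * W * Rpower A s + rpow 2 s * (2 * PI) * rpow eps s) by ring.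
    lra. }
  assert (HI : I <= Y * rpow nf s).
  { apply Rle_plus_epsilon. intros e He.
    (* Chosen with [eps^s = e / (Z + 1)], so that the error term is at most [e]. *)
    set (eps := Rpower (e / (Z + 1)) (1 / s)).
    assert (Pe : 0 < e / (Z + 1)) by (apply Rdiv_lt_0_compat; lra).
    assert (Ee : rpow eps s = e / (Z + 1)).
    { unfold eps. rewrite rpow_Rpower, Rpower_mult by apply Rpower_pos.
      replace (1 / s * s) with 1 by (field; lra). now apply Rpower_1. }
    eapply Rle_trans; [apply (Heps eps); apply Rpower_pos|]. apply Rplus_le_compat_l.
    rewrite Ee. assert (E : e / (Z + 1) * (Z + 1) = e) by (field; lra).
    set (x := e / (Z + 1)) in *. nra. }
  eapply Rle_trans; [apply rpow_le; [apply Rdiv_lt_0_compat; lra|exact HI]|].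
  unfold Y. rewrite rpow_mult; [|exact (Rlt_le _ _ HY)|apply rpow_ge_0].
  rewrite rpow_mult by (try lra; apply Rlt_le, Rpower_pos).
  rewrite rpow_inv by lra.
  rewrite (rpow_Rpower (Rpower _ _)), Rpower_mult by apply Rpower_pos.
  (* Here the exponent of the statement appears: [s = 2 p / (p + 2)] is [1 / s = 1 / p + 1 / 2]. *)
  replace ((1 - s / 2) * (1 / s)) with (1 / p) by (unfold s; field; lra).
  assert (Eq : Rpower (/ q) (1 / p) = / Rpower q (1 / p)).
  { unfold Rpower. rewrite ln_Rinv by auto. rewrite <- exp_Ropp. f_equal. ring. }
  rewrite Eq. apply Req_le. unfold Rdiv. ring.
Qed.
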